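(* Let $X\in\mathfrak{q}$ be such that $M=\operatorname{Ad}(H)X$ is a pseudo-Riemannian submanifold of a pseudo-hypersphere $\boldsymbol{S}=\{v\in\mathfrak{q}\mid B(v,v)=r\}$, $r>0$. Let $\mathfrak{a}$ be a Cartan subspace of $\mathfrak{q}$ containing $X$, let $R$ be the restricted root system with respect to $\mathfrak{a}$, and let $R_+$ be a positive root system of $R$. Then $M$ is an austere orbit in $\boldsymbol{S}$ if and only if $$\left\{-\frac{1}{\alpha(X)}\,p_X(\alpha)\ \Big|\ \alpha\in R_+\text{ with }\alpha(X)\ne0\right\}$$ is invariant (considering multiplicities) under multiplication by $-1$.
   Context: $G$ is a connected semisimple noncompact real Lie group, $\sigma$ an involution of $G$, $H$ a closed subgroup with $(G_\sigma)_0\subset H\subset G_\sigma$ ($G_\sigma$ the fixed point group of $\sigma$). $\mathfrak{g}=\operatorname{Lie}(G)$, $\mathfrak{h}=\operatorname{Lie}(H)$ is the $(+1)$-eigenspace and $\mathfrak{q}$ the $(-1)$-eigenspace of the induced involution $\sigma$ of $\mathfrak{g}$; $B$ is the Killing form of $\mathfrak{g}$, extended complex-bilinearly to $\mathfrak{g}^{\mathbb{C}}$. $H$ acts on $\mathfrak{q}$ by $\operatorname{Ad}$, and $\boldsymbol{S}$ carries the metric induced by $B|_{\mathfrak{q}}$. ''Pseudo-Riemannian submanifold'' means nondegenerate induced metric. A Cartan subspace of $\mathfrak{q}$ is a maximal abelian subspace of $\mathfrak{q}$ consisting of semisimple elements ($\operatorname{ad}$-diagonalizable over $\mathbb{C}$).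 The restricted root system is $R=\{\alpha\in(\mathfrak{a}^{\mathbb{C}})^*\setminus\{0\}\mid\mathfrak{q}^{\mathbb{C}}_\alpha\ne\{0\}\}$ with $\mathfrak{q}^{\mathbb{C}}_\alpha=\{Y\in\mathfrak{q}^{\mathbb{C}}\mid\operatorname{ad}(A)^2Y=\alpha(A)^2Y\ \forall A\in\mathfrak{a}^{\mathbb{C}}\}$; the multiplicity of $\alpha$ is $\dim_{\mathbb{C}}\mathfrak{q}^{\mathbb{C}}_\alpha$. A root $\alpha$ is identified with its restricted root vector $A_\alpha\in\mathfrak{a}^{\mathbb{C}}$, $B(A,A_\alpha)=\alpha(A)$ for all $A\in\mathfrak{a}^{\mathbb{C}}$. $p_X$ is the orthogonal projection along $X$, i.e. onto the $B$-orthogonal complement of $X$ in $\mathfrak{a}^{\mathbb{C}}$: $p_X(\alpha)=A_\alpha-\frac{\alpha(X)}{B(X,X)}X$. ''Considering multiplicities'' means that the set is regarded as a multiset in which the element given by $\alpha$ is counted $\dim\mathfrak{q}^{\mathbb{C}}_\alpha$ times. $M$ is austere in $\boldsymbol{S}$ if for all $x\in M$ and all normal vectors $\xi\in T_x^\perp M$ (normal space of $M$ in $\boldsymbol{S}$) the odd-degree coefficients (odd elementary symmetric functions of the eigenvalues) of the characteristic polynomial of the shape operator $A_\xi$ vanish; equivalently the spectrum of $A_\xi^{\mathbb{C}}$, with multiplicities, is invariant under multiplication by $-1$. *)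

(* Defs.v *)
From HB Require Import structures.
From mathcomp Require Import all_boot all_order all_algebra.
From mathcomp Require Import complex.
From mathcomp Require Import all_classical all_reals all_analysis.
Export numFieldNormedType.Exports.

Set Implicit Arguments.
Unset Strict Implicit.
Unset Printing Implicit Defensive.

Import GRing.Theory passmx.

Local Open Scope classical_set_scope.
Local Open Scope ring_scope.
Local Open Scope complex_scope.

(* The linear span of a subset; it is the subset itself, packaged as a
   {vspace}, when the subset is a linear subspace. *)
Definition set_span (K : fieldType) (V : vectType K) (S : set V) : {vspace V} :=
  xget 0%VS [set W : {vspace V} |
    S `<=` [set` W] /\
    forall U : {vspace V}, S `<=` [set` U] -> (W <= U)%VS].

Definition end_char_poly (K : fieldType) (V : vectType K) (f : 'End(V)) :
    {poly K} :=
  char_poly (mxof (vbasis {:V}) (vbasis {:V}) f).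

Section SmoothMaps.
Variable (R : realType).
Implicit Types V W : normedModType R.

Fixpoint iter_derive V W (vs : seq V) (f : V -> W) : V -> W :=
  if vs is v :: vs' then fun x => 'D_v (iter_derive vs' f) x else f.

(* C^oo on an open set U: all iterated directional derivatives exist and are
   continuous on U.  The values of f outside U are irrelevant. *)
Definition smooth_on V W (U : set V) (f : V -> W) :=
  forall (vs : seq V) (x : V), U x ->
    {for x, continuous (iter_derive vs f)} /\
    forall v : V, derivable (iter_derive vs f) x v.

End SmoothMaps.

Section Manifolds.
Variable (R : realType).
Implicit Types (E F : normedModType R) (T : topologicalType).

(* The maps are total; only their restrictions to chart_dom, resp. to its
   image, are meaningful. *)
Record chart E T := Chart {
  chart_dom : set T;
  chart_map : T -> E;
  chart_inv : E -> T }.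

Definition chart_img E T (c : chart E T) : set E := chart_map c @` chart_dom c.

Definition is_chart E T (c : chart E T) :=
  [/\ open (chart_dom c),
      open (chart_img c),
      (forall x, chart_dom c x -> chart_inv c (chart_map c x) = x),
      (forall x, chart_dom c x -> {for x, continuous (chart_map c)}) &
      (forall y, chart_img c y -> {for y, continuous (chart_inv c)})].

Definition smooth_map E F T (T' : topologicalType) (A : set (chart E T)) (A' : set (chart F T'))
    (f : T -> T') :=
  continuous f /\
  forall c c', A c -> A' c' ->
    smooth_on (chart_map c @` (chart_dom c `&` f @^-1` chart_dom c'))
              (chart_map c' \o f \o chart_inv c).

Definition smooth_atlas E T (A : set (chart E T)) :=
  [/\ hausdorff_space T,
      @second_countable T,
      (forall c, A c -> is_chart c),
      (forall x, exists2 c, A c & chart_dom c x) &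
      smooth_map A A id].

Definition prod_chart E F T (T' : topologicalType) (c : chart E T) (c' : chart F T') :
    chart (E * F)%type (T * T')%type :=
  Chart (chart_dom c `*` chart_dom c')
        (fun x => (chart_map c x.1, chart_map c' x.2))
        (fun y => (chart_inv c y.1, chart_inv c' y.2)).

Definition prod_atlas E F T (T' : topologicalType) (A : set (chart E T)) (A' : set (chart F T')) :
    set (chart (E * F)%type (T * T')%type) :=
  [set c | exists c1 c2, [/\ A c1, A' c2 & c = prod_chart c1 c2]].

End Manifolds.

(* A group and a topology on the same carrier, with no compatibility. *)
#[short(type="preTopologicalGroupType")]
HB.structure Definition PreTopologicalGroup :=
  {G of Group G & Topological G}.

Section LieGroups.
Variables (R : realType) (n : nat) (G : preTopologicalGroupType).
Implicit Types (A : set (chart 'rV[R]_n G)) (e : chart 'rV[R]_n G)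
  (s : G -> G) (H : set G).

Definition lie_group A :=
  [/\ smooth_atlas A,
      smooth_map (prod_atlas A A) A (fun x : G * G => (x.1 * x.2)%g) &
      smooth_map A A (fun x : G => (x^-1)%g)].

Definition lie_involution A s :=
  [/\ smooth_map A A s,
      (forall x y, s (x * y)%g = (s x * s y)%g) &
      involutive s].

Definition subgroup H :=
  [/\ H 1%g,
      (forall x y, H x -> H y -> H (x * y)%g) &
      (forall x, H x -> H (x^-1)%g)].

Definition fixed_points s : set G := [set x | s x = x].

(* The tangent space of G at 1 is identified with 'rV[R]_n by a chart e around
   1; differential1 e f is the differential at 1 of a map f fixing 1. *)
Definition differential1 e (f : G -> G) (v : 'rV[R]_n) : 'rV[R]_n :=
  'D_v (chart_map e \o f \o chart_inv e) (chart_map e 1%g).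

Definition Ad e (g : G) : 'rV[R]_n -> 'rV[R]_n :=
  differential1 e (fun x => (g * x * g^-1)%g).

(* [u, v] = ad(u)v, where ad is the differential at 1 of g |-> Ad(g). *)
Definition bracket e (u v : 'rV[R]_n) : 'rV[R]_n :=
  'D_u (fun x => Ad e (chart_inv e x) v) (chart_map e 1%g).

(* Matrices act on row vectors from the right. *)
Definition ad_mx e (u : 'rV[R]_n) : 'M[R]_n := lin1_mx (bracket e u).

Definition killing e (u v : 'rV[R]_n) : R := \tr (ad_mx e u *m ad_mx e v).

(* Semisimplicity as in Helgason: the Killing form is nondegenerate. *)
Definition semisimple_lie_algebra e :=
  forall u, (forall v, killing e u v = 0) -> u = 0.

Definition q_space e s : {vspace 'rV[R]_n} :=
  leigenspace (linfun (differential1 e s)) (-1).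

Definition Ad_orbit e H (X : 'rV[R]_n) : set 'rV[R]_n :=
  [set Ad e h X | h in H].

Definition pseudo_hypersphere e s (r : R) : set 'rV[R]_n :=
  [set v | v \in q_space e s /\ killing e v v = r].

End LieGroups.

(* Extrinsic geometry of M included in S included in 'rV[R]_n, the ambient
   (flat) metric being given by a bilinear form b which is only required to be
   nondegenerate on the tangent spaces of S and M. *)
Section PseudoRiemannianSubmanifolds.
Variables (R : realType) (n : nat) (b : 'rV[R]_n -> 'rV[R]_n -> R).
Local Notation V := 'rV[R]_n.
Implicit Types (S M : set V) (x xi : V).

Definition submanifold M :=
  exists k : nat, forall x, M x ->
    exists (U : set V) (f g : V -> V) (W : {vspace V}),
      [/\ open_nbhs x U, open (f @` U), smooth_on U f, smooth_on (f @` U) g &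
      [/\ (forall y, U y -> g (f y) = y), \dim W = k &
          forall y, U y -> (M y <-> f y \in W)]].

Definition smooth_curve (c : R^o -> V) := smooth_on setT c.

Definition curve_in M x (c : R^o -> V) :=
  [/\ smooth_curve c, (forall t, M (c t)) & c 0 = x].

Definition tangent_space M x : {vspace V} :=
  set_span [set v | exists2 c, curve_in M x c & derive1 c 0 = v].

Definition pseudo_riemannian_submanifold S M :=
  [/\ submanifold M,
      M `<=` S &
      forall x, M x -> forall v, v \in tangent_space M x ->
        (forall w, w \in tangent_space M x -> b v w = 0) -> v = 0].

Definition normal_space S M x : set V :=
  [set xi | xi \in tangent_space S x /\
            forall v, v \in tangent_space M x -> b xi v = 0].

Definition orth_proj (W : {vspace V}) (u : V) : V :=
  xget 0 [set w | w \in W /\ forall z, z \in W -> b (u - w) z = 0].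

(* Covariant derivative at time 0, for the Levi-Civita connection of S, of a
   vector field nu tangent to S along a curve in S starting at x. *)
Definition covariant_derivative S x (nu : R^o -> V) : V :=
  orth_proj (tangent_space S x) (derive1 nu 0).

(* Weingarten: A_xi (c' 0) is minus the component tangent to M of the covariant
   derivative in S of any normal field nu along c with nu 0 = xi. *)
Definition shape_operator S M x xi : 'End(subvs_of (tangent_space M x)) :=
  xget 0 [set A : 'End(subvs_of (tangent_space M x)) |
    forall (c nu : R^o -> V),
      curve_in M x c -> smooth_curve nu ->
      (forall t, normal_space S M (c t) (nu t)) -> nu 0 = xi ->
      vsval (A (vsproj (tangent_space M x) (derive1 c 0))) =
        - orth_proj (tangent_space M x) (covariant_derivative S x nu)].

(* Up to sign, the coefficient of degree d - k of the characteristic polynomial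
   is the k-th elementary symmetric function of the eigenvalues. *)
Definition austere S M :=
  forall x xi, M x -> normal_space S M x xi ->
    let p := end_char_poly (shape_operator S M x xi) in
    let d := (\dim (tangent_space M x)) in
    forall k, odd k -> (k <= d)%N -> p`_(d - k) = 0.

End PseudoRiemannianSubmanifolds.

Section RestrictedRoots.
Variables (R : realType) (n : nat) (G : preTopologicalGroupType).
Variable (e : chart 'rV[R]_n G).
Local Notation C := R[i].
Local Notation V := 'rV[R]_n.
Local Notation VC := 'rV[R[i]]_n.

Definition vcomplex (v : V) : VC := map_mx (real_complex R) v.

Definition complexify (W : {vspace V}) : {vspace VC} :=
  <<[seq vcomplex v | v <- vbasis W]>>%VS.

(* Complex linear, resp. bilinear, extensions of ad and of the Killing form. *)
Definition ad_mxC (Z : VC) : 'M[C]_n :=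
  \sum_i Z 0 i *: map_mx (real_complex R) (ad_mx e (delta_mx 0 i)).

Definition killingC (Y Z : VC) : C :=
  \sum_i \sum_j Y 0 i * Z 0 j * (killing e (delta_mx 0 i) (delta_mx 0 j))%:C.

Definition semisimple_element (u : V) :=
  diagonalizable (map_mx (real_complex R) (ad_mx e u)).

Definition abelian_subspace (a : {vspace V}) :=
  forall u v, u \in a -> v \in a -> bracket e u v = 0.

Definition cartan_subspace (q a : {vspace V}) :=
  [/\ (a <= q)%VS,
      abelian_subspace a,
      (forall a' : {vspace V}, (a <= a')%VS -> (a' <= q)%VS ->
         abelian_subspace a' -> a' = a) &
      forall u, u \in a -> semisimple_element u].

Definition dualC (a : {vspace V}) : vectType C :=
  'Hom(subvs_of (complexify a), C^o).

Definition root_space (q a : {vspace V}) (alpha : dualC a) : set VC :=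
  [set Y | Y \in complexify q /\
           forall A : subvs_of (complexify a),
             Y *m ad_mxC (vsval A) *m ad_mxC (vsval A) = alpha A ^+ 2 *: Y].

Definition restricted_roots (q a : {vspace V}) : set (dualC a) :=
  [set alpha | alpha != 0 /\ exists2 Y, root_space q alpha Y & Y != 0].

Definition multiplicity (q a : {vspace V}) (alpha : dualC a) : nat :=
  \dim (set_span (root_space q alpha)).

Definition positive_system (a : {vspace V}) (Rts P : set (dualC a)) :=
  [/\ P `<=` Rts,
      (forall alpha, Rts alpha -> (P alpha <-> ~ P (- alpha))) &
      forall alpha beta, P alpha -> P beta -> Rts (alpha + beta) ->
        P (alpha + beta)].

Definition root_vector (a : {vspace V}) (alpha : dualC a) :
    subvs_of (complexify a) :=
  xget 0 [set A0 | forall A, killingC (vsval A) (vsval A0) = alpha A].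

(* X as an element of the complexification of a; meaningful for X in a. *)
Definition in_complexify (a : {vspace V}) (X : V) : subvs_of (complexify a) :=
  vsproj (complexify a) (vcomplex X).

Definition root_proj (a : {vspace V}) (X : V) (alpha : dualC a) :
    subvs_of (complexify a) :=
  let XC := in_complexify a X in
  root_vector alpha - (alpha XC / killingC (vsval XC) (vsval XC)) *: XC.

Definition scaled_root_proj (a : {vspace V}) (X : V) (alpha : dualC a) :
    subvs_of (complexify a) :=
  - (alpha (in_complexify a X))^-1 *: root_proj X alpha.

(* Number of occurrences of Z in the multiset of the scaled projections of the
   alpha in P with alpha(X) != 0. *)
Definition occurrences (q a : {vspace V}) (X : V) (P : set (dualC a))
    (Z : subvs_of (complexify a)) : nat :=
  \sum_(alpha \in [set alpha | [/\ P alpha,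
                      alpha (in_complexify a X) != 0 &
                      scaled_root_proj X alpha = Z]])
    multiplicity q alpha.

End RestrictedRoots.

Arguments restricted_roots {R n G} e q a _.

(* Main.v *)
From HB Require Import structures.
Require Import Defs.
From mathcomp Require Import all_boot all_order all_algebra all_field.
From mathcomp Require Import complex.
From mathcomp Require Import all_classical all_reals all_analysis.
From mathcomp Require Import ring lra.

Set Implicit Arguments.
Unset Strict Implicit.
Unset Printing Implicit Defensive.

Import Order.TTheory GRing.Theory Num.Theory passmx.

Local Open Scope classical_set_scope.
Local Open Scope ring_scope.

(* Let j be the group inverse of ad x, for x in M.  The tangent space of M at x is
   [h, x], and differentiating [nu, c] = 0 for a normal field nu along a curve c
   shows that the shape operator in the normal direction xi is - j ad(xi) on it.
   As ad x anticommutes with the involution, the odd power traces of this operator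
   are, up to the factor -1/2, the traces of the powers of ad(xi) j on g; austerity
   is their vanishing.  By conjugation one may take x = X.

   The polynomial xi |-> tr((ad(xi) j)^k) on the centralizer of X in q is invariant
   under the centralizer of X in h.  At a regular point A of the intersection of a
   with the orthogonal complement of X, every normal direction is the sum of one in a
   and one of the form [A, Y]; inductively, all the iterated derivatives of the
   polynomial vanish at A as soon as it vanishes on a, and then it is zero.

   On a, a simultaneous diagonalization over C turns the traces into the power sums
   of lambda(xi) / lambda(X), lambda running over the weights of a on g^C.  These are
   the opposites of the pairings of xi with the scaled projections of the roots, each
   positive root counting for itself and its opposite, and a generic xi separates the
   finitely many scaled projections. *)

(** * Strict differentiability *)

(** In the Riemannian case the centralizer of X in H conjugates every normal vector into [a], so
    that only directions in [a] matter. For an indefinite form this fails: a normal vector can be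
    nilpotent, or belong to a Cartan subspace that is not conjugate to [a]. Hence the passage from
    [a] to all normal directions is infinitesimal: a polynomial is determined by its Taylor
    expansion at one point, and invariance under a Lie algebra is enough to compute it.

    The tangent space of the orbit is found without the exponential map. Enough elements of H are
    obtained by linearizing the involution near 1 and inverting by a contraction. Conversely, a
    curve in M is not known to lift to H; but semisimplicity gives one separable polynomial p with
    p(ad x) = 0 for all x in M, and differentiating this equation along a curve confines its
    velocity to [h, x]. The same p makes the group inverse a fixed polynomial in ad x, hence smooth
    along M, which yields the normal fields that determine the shape operator. *)

Section DirectionalDerivatives.
Context {R : realType} {V W : normedModType R}.
Implicit Types (f : V -> W) (x v : V).

Lemma derivable1D f x v (t : R) :
  derivable f (x + t *: v) v -> is_derive t 1 (fun s : R => f (x + s *: v)) ('D_v f (x + t *: v)).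
Proof.
move=> df; have E : (fun h : R => h^-1 *: (((fun s : R => f (x + s *: v)) \o shift t) (h *: (1:R)) - f (x + t *: v)))
   = (fun h => h^-1 *: ((f \o shift (x + t *: v)) (h *: v) - f (x + t *: v))).
  apply: funext => h /=; congr (_ *: (f _ - _)).
  by rewrite [h%:A]mulr1 scalerDl addrCA.
by split; rewrite /derivable /derive E.
Qed.

(** Derivability is assumed in the single direction v, so no linear differential is available; the
    limit is reparametrized by h -> h * k instead. *)
Lemma is_deriveZdir f x v (k : R) : derivable f x v -> is_derive x (k *: v) f (k *: 'D_v f x).
Proof.
move=> df; have [->|k0] := eqVneq k 0.
  by rewrite !scale0r; exact: is_derive0.
suff H : (fun h : R => h^-1 *: ((f \o shift x) (h *: (k *: v)) - f x)) @ 0^' --> k *: 'D_v f x.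
  by split; [apply/cvg_ex; eexists; exact: H|exact: cvg_lim H].
have -> : (fun h : R => h^-1 *: ((f \o shift x) (h *: (k *: v)) - f x)) =
  (fun h : R => k *: ((fun h : R => h^-1 *: ((f \o shift x) (h *: v) - f x)) (h * k))).
  apply: funext => h /=; rewrite !scalerA; congr (_ *: _).
  have [->|h0] := eqVneq h 0; first by rewrite mul0r invr0 mulr0.
  by rewrite invfM mulrCA mulfV ?mulr1.
apply: cvgZl_tmp.
have H1 : (fun h : R => h * k) @ (0:R)^' --> (0:R)^'.
  move=> A [e /= e0 eA]; suff : \forall h \near (0:R)^', A (h * k) by [].
  near=> h; apply: eA => /=.
    rewrite sub0r normrN (normrM h k) -ltr_pdivlMr ?normr_gt0//.
    near: h; apply: dnbhs0_lt; rewrite divr_gt0 ?normr_gt0//.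
  rewrite mulf_neq0 //; near: h; exact: nbhs_dnbhs_neq.
exact: (cvg_comp _ _ H1 df).
Unshelve. all: end_near. Qed.

End DirectionalDerivatives.

Section MeanValue.
Context {R : realType} {V : normedModType R}.

Lemma segment_mvt (f : V -> R) (x v : V) :
  (forall t : R, 0 <= t <= 1 -> derivable f (x + t *: v) v) ->
  exists2 t : R, 0 <= t <= 1 & f (x + v) - f x = 'D_v f (x + t *: v).
Proof.
move=> df; pose g (s : R) := f (x + s *: v).
have dg (t : R) : 0 <= t <= 1 -> is_derive t (1:R) g ('D_v f (x + t *: v)).
  by move=> t01; apply: derivable1D; exact: df.
have [] := @MVT_segment R g (fun t => 'D_v f (x + t *: v)) 0 1 ler01.
- by move=> t; rewrite in_itv /= => /andP[t0 t1]; apply: dg; rewrite !ltW.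
- apply: derivable_within_continuous => t; rewrite in_itv /= => t01.
  by have := dg t t01; case.
- move=> t; rewrite in_itv /= => t01; rewrite /g scale1r scale0r addr0 subr0 mulr1.
  by exists t.
Qed.

End MeanValue.

(** A basis with its coordinate forms and one bound for all of them. The notion covers row vectors
    as well as products of such spaces, on which the group multiplication is read in charts. *)
Definition linear_frame (R : realType) (V : normedModType R) (N : nat) (b : 'I_N -> V)
    (l : 'I_N -> V -> R) (C : R) :=
  [/\ 0 < C, forall x, x = \sum_i l i x *: b i,
      forall i x, `|l i x| <= C * `|x|,
      forall i, `|b i| <= C &
      forall i a x y, l i (a *: x + y) = a * l i x + l i y].

Section StrictDifferentiability.
Context {R : realType} {V : normedModType R}.
Variables (N : nat) (b : 'I_N -> V) (l : 'I_N -> V -> R) (C : R).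
Hypothesis fr : linear_frame b l C.

Let C0 : 0 < C. Proof. by case: fr. Qed.
Let lb x : x = \sum_i l i x *: b i. Proof. by case: fr. Qed.
Let lC i x : `|l i x| <= C * `|x|. Proof. by case: fr. Qed.
Let bC i : `|b i| <= C. Proof. by case: fr. Qed.
Let ll i a x y : l i (a *: x + y) = a * l i x + l i y. Proof. by case: fr. Qed.

(** Going from y to x by changing one coordinate at a time, the mean value theorem applies to each
    step, and continuity of the partial derivatives bounds each error. *)
Lemma strict_differentiability_scalar (f : V -> R) (p : V) :
  (\forall x \near p, forall i, derivable f x (b i)) ->
  (forall i, {for p, continuous (fun x => 'D_(b i) f x)}) ->
  forall e : R, 0 < e -> exists2 d : R, 0 < d & forall x y, `|x - p| < d -> `|y - p| < d ->
    `|f x - f y - \sum_i l i (x - y) * 'D_(b i) f p| <= e * `|x - y|.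
Proof.
move=> df cf e e0.
(* [N.+1] rather than [N] keeps the denominators nonzero when the frame is empty. *)
have NC0 : 0 < N.+1%:R * C by rewrite mulr_gt0.
pose e1 := e / (N.+1%:R * C); have e10 : 0 < e1 by rewrite divr_gt0.
have : \forall x \near p, (forall i, derivable f x (b i)) /\ (forall i, `|'D_(b i) f x - 'D_(b i) f p| <= e1).
  near=> x; split; first by near: x.
  move=> i; rewrite distrC; move: i; near: x; apply: filter_forall => i.
  have /cvgrPdist_le := cf i; exact.
case/nbhs_ballP => d0 /= d00 dd.
(* As [|h| <= 2 * (d0 / K)], the points of the broken path are at distance less than [d0 / K + N.+1
   * C * C * 2 * (d0 / K) = d0] from p. *)
pose K := 1 + 2 * (N.+1%:R * C * C); have K1 : 0 < K by rewrite /K; apply: ltr_pwDl; rewrite ?mulr_ge0// ltW.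
exists (d0 / K); first by rewrite divr_gt0.
move=> x y xp yp; set h := x - y.
pose z (k : nat) := y + \sum_(i < N | (i < k)%N) l i h *: b i.
have hN : `|h| <= 2 * (d0 / K).
  have -> : h = (x - p) - (y - p) by rewrite opprB addrA subrK.
     rewrite (le_trans (ler_normB _ _))//; lra.
have zt (i : 'I_N) (t : R) : 0 <= t <= 1 -> `|z i + t *: (l i h *: b i) - p| < d0.
  move=> /andP[t0 t1]; rewrite /z -addrA (addrC _ (- p)) addrACA.
  have S1 : `|\sum_(j < N | (j < i)%N) l j h *: b j + t *: (l i h *: b i)| <= N.+1%:R * C * C * `|h|.
    rewrite (le_trans (ler_normD _ _))// -natr1 !mulrDl mul1r lerD//.
      rewrite (le_trans (ler_norm_sum _ _ _))//.
      apply: (@le_trans _ _ (\sum_(j < N) (C * C * `|h|))); last first.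
        by rewrite sumr_const card_ord -[leLHS]mulr_natl !mulrA.
      rewrite [leLHS]big_mkcond /=; apply: ler_sum => j _; case: ifP => _; last by rewrite !mulr_ge0 // ltW.
      rewrite normrZ mulrAC ler_pM//.
    rewrite normrZ (ger0_norm t0) -[leRHS]mul1r ler_pM// normrZ mulrAC ler_pM//.
  rewrite (le_lt_trans (ler_normD _ _))//.
  apply: (@lt_le_trans _ _ (d0 / K + N.+1%:R * C * C * (2 * (d0 / K)))).
    rewrite ltr_leD// (le_trans S1)// ler_wpM2l// !mulr_ge0// ltW//.
  have -> : d0 / K + N.+1%:R * C * C * (2 * (d0 / K)) = K * (d0 / K) by rewrite /K; ring.
  by rewrite mulrC divfK ?gt_eqF.
have Dz (i : 'I_N) (t : R) : 0 <= t <= 1 -> derivable f (z i + t *: (l i h *: b i)) (b i) /\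
   `|'D_(b i) f (z i + t *: (l i h *: b i)) - 'D_(b i) f p| <= e1.
  move=> t01; have [] := dd (z i + t *: (l i h *: b i)).
    by rewrite -ball_normE /= distrC; exact: zt.
  by move=> + /(_ i) => /(_ i).
have step (i : 'I_N) : `|f (z i.+1) - f (z i) - l i h * 'D_(b i) f p| <= e1 * (C * `|h|).
  have zS : z i.+1 = z i + l i h *: b i.
    rewrite /z -addrA (bigD1 i) ?ltnS//= [X in y + X]addrC; congr (_ + (_ + _)).
    by apply: eq_bigl => j; rewrite ltnS [RHS]ltn_neqAle andbC.
  have [t t01 E] : exists2 t : R, 0 <= t <= 1 & f (z i + l i h *: b i) - f (z i) =
      'D_(l i h *: b i) f (z i + t *: (l i h *: b i)).
    apply: segment_mvt => t t01; have [D _] := Dz i t t01.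
    by have [] := is_deriveZdir (l i h) D.
  have [D De] := Dz i t t01.
  rewrite zS E; have [_ ->] := is_deriveZdir (l i h) D.
  rewrite -mulrBr normrM mulrC ler_pM//.
have z0 : z 0 = y by rewrite /z big_pred0 ?addr0.
have zN : z N = x.
  rewrite /z (eq_bigl xpredT) => [|i]; last by rewrite ltn_ord.
  by rewrite -lb /h addrC subrK.
have -> : f x - f y - \sum_i l i (x - y) * 'D_(b i) f p =
   \sum_(i < N) (f (z i.+1) - f (z i) - l i h * 'D_(b i) f p).
  rewrite sumrB; congr (_ - _); rewrite -zN -{1}z0.
  by rewrite -(big_mkord xpredT (fun i => f (z i.+1) - f (z i))) telescope_sumr.
rewrite (le_trans (ler_norm_sum _ _ _))//.
apply: (@le_trans _ _ (\sum_(i < N) (e1 * (C * `|h|)))); first by apply: ler_sum => i _; exact: step.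
rewrite sumr_const card_ord /e1 -/h -[leLHS]mulr_natl.
have -> : e * `|h| = N.+1%:R * (e / (N.+1%:R * C) * (C * `|h|)).
  by field; rewrite !gt_eqF// ltr0n.
apply: ler_wpM2r; last by rewrite ler_nat.
apply: mulr_ge0; [exact: ltW|by rewrite mulr_ge0 // ltW].
Unshelve. all: end_near. Qed.

Lemma row_norm_le m (w : 'rV[R]_m) (e : R) : 0 <= e -> (forall j, `|w 0 j| <= e) -> `|w| <= e.
Proof.
move=> e0 we; rewrite /Num.Def.normr /= mx_normrE (bigmax_le _ e0)// => -[i j] _ /=.
by rewrite ord1.
Qed.

Lemma frame_continuous i : continuous (l i).
Proof.
move=> x; apply/cvgrPdist_lt => e e0; near=> y.
have -> : l i x - l i y = l i (x - y).
  by have := ll i (-1) y x; rewrite scaleN1r addrC => ->; rewrite mulN1r addrC.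
rewrite (le_lt_trans (lC _ _))// mulrC -ltr_pdivlMr//.
by near: y; apply: cvgr_dist_lt => //; rewrite divr_gt0.
Unshelve. all: end_near. Qed.

Section Vectors.
Variables (m : nat) (f : V -> 'rV[R]_m) (p : V).
Hypothesis df : \forall x \near p, forall v, derivable f x v.
Hypothesis cf : forall v, {for p, continuous (fun x => 'D_v f x)}.

Let L (h : V) : 'rV[R]_m := \sum_i l i h *: 'D_(b i) f p.

(** The mean value theorem is only valid for scalar functions, hence the argument by coordinates,
    with the smallest of the radii; its default 1 serves [m = 0]. *)
Let strict_frame : forall e : R, 0 < e -> exists2 d : R, 0 < d &
  forall x y, `|x - p| < d -> `|y - p| < d -> `|f x - f y - L (x - y)| <= e * `|x - y|.
Proof.
move=> e e0.
have H j : exists d : R, 0 < d /\ forall x y, `|x - p| < d -> `|y - p| < d ->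
    `|f x 0 j - f y 0 j - \sum_i l i (x - y) * 'D_(b i) (fun x => f x 0 j) p| <= e * `|x - y|.
  have df' : \forall x \near p, forall i, derivable (fun x => f x 0 j) x (b i).
    by apply: filterS df => x dx i; have /derivable_mxP := dx (b i); exact.
  have cf' i : {for p, continuous (fun x => 'D_(b i) (fun x => f x 0 j) x)}.
    have E : \forall x \near p, 'D_(b i) (fun x => f x 0 j) x = ('D_(b i) f x) 0 j.
      by apply: filterS df => x dx; rewrite derive_mx// mxE.
    rewrite /prop_for /continuous_at (nbhs_singleton E).
    apply: (@cvg_trans _ (('D_(b i) f x) 0 j @[x --> p])).
      by apply: near_eq_cvg; apply: filterS E => x ->.
    have cfi : 'D_(b i) f x @[x --> p] --> 'D_(b i) f p := @cf (b i).
    have cj : {for 'D_(b i) f p, continuous (fun M : 'rV[R]_m => M 0 j)} by exact: coord_continuous.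
    exact: (cvg_comp ('D_(b i) f) (fun M : 'rV[R]_m => M 0 j) cfi cj).
  by have [d d0 Hd] := strict_differentiability_scalar df' cf' e0; exists d.
pose d j := sval (cid (H j)).
have d0 : 0 < \big[Order.min/1]_j d j.
  by elim/big_ind : _ => // [x y x0 y0|j _]; [rewrite lt_min x0|rewrite /d; case: cid => ? []].
exists (\big[Order.min/1]_j d j) => // x y xd yd.
apply: row_norm_le => [|j]; first by rewrite mulr_ge0 // ltW.
have := (svalP (cid (H j))).2 x y.
have le : \big[Order.min/1]_j d j <= d j by apply: bigmin_le_cond.
move=> /(_ (lt_le_trans xd le) (lt_le_trans yd le)).
rewrite !mxE summxE; congr (`|_ - _| <= _); apply: eq_bigr => i _.
by rewrite mxE [in RHS]derive_mx ?mxE //; exact: (nbhs_singleton df).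
Qed.

Let Llin : linear L.
Proof.
move=> a x y; rewrite /L scaler_sumr -big_split; apply: eq_bigr => i _ /=.
by rewrite ll scalerDl scalerA.
Qed.

Let LL : {linear V -> 'rV[R]_m} := HB.pack L (GRing.isLinear.Build R V 'rV[R]_m *:%R L Llin).

Let dL : 'd f p = LL :> (V -> 'rV[R]_m) /\ differentiable f p.
Proof.
have cL : continuous LL.
  move=> x; rewrite /continuous_at /= /L; apply: cvg_big => //; first exact: add_continuous.
  move=> i _.
  by apply: cvgZr_tmp; exact: frame_continuous.
have oL : f \o shift p = cst (f p) + LL +o_ 0 id.
  apply/eqaddoP => _/posnumP[e]; have [d d0 Hd] := strict_frame [gt0 of e%:num].
  near=> h; have := Hd (h + p) p; rewrite addrK subrr normr0.
  rewrite /= opprD addrA. move=> H; apply: H; last by [].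
  by near: h; apply: (cvgr0_norm_lt id).
by have E := diff_unique cL oL; split=> //; apply/diff_locallyP; rewrite E.
Unshelve. all: end_near. Qed.

Lemma C1_differentiable : differentiable f p. Proof. by case: dL. Qed.

Lemma C1_strictly_differentiable (e : R) : 0 < e -> exists2 d : R, 0 < d &
  forall x y, `|x - p| < d -> `|y - p| < d -> `|f x - f y - 'D_(x - y) f p| <= e * `|x - y|.
Proof.
move=> /strict_frame[d d0 Hd]; exists d => // x y xd yd.
by rewrite deriveE ?dL.1; [exact: Hd|exact: dL.2].
Qed.

End Vectors.
End StrictDifferentiability.

Lemma row_frame (R : realType) n :
  @linear_frame R 'rV[R]_n n (fun i => delta_mx 0 i) (fun i x => x 0 i) 1.
Proof.
split=> // [x|i x|i|i a x y]; last by rewrite !mxE.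
- by rewrite -row_sum_delta.
- rewrite mul1r [leRHS]/Num.Def.normr /= mx_normrE.
  exact: (@le_bigmax _ _ _ 0 (fun ij : 'I_1 * 'I_n => `|x ij.1 ij.2|) (0, i)).
- apply: row_norm_le => // j; rewrite mxE /=; case: (j == i); by rewrite ?normr1 ?normr0.
Qed.

Lemma prod_frame (R : realType) (V1 V2 : normedModType R) N1 N2 b1 b2 l1 l2 C1 C2 :
  @linear_frame R V1 N1 b1 l1 C1 -> @linear_frame R V2 N2 b2 l2 C2 ->
  @linear_frame R (V1 * V2)%type (N1 + N2)
    (fun i => match fintype.split i with inl j => (b1 j, 0) | inr j => (0, b2 j) end)
    (fun i x => match fintype.split i with inl j => l1 j x.1 | inr j => l2 j x.2 end) (C1 + C2).
Proof.
move=> [C10 lb1 lC1 bC1 ll1] [C20 lb2 lC2 bC2 ll2]; split.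
- exact: addr_gt0.
- move=> [x1 x2]; rewrite big_split_ord /=.
  rewrite (eq_bigr (fun i => (l1 i x1 *: b1 i, 0))); last first.
    by move=> i _; rewrite (unsplitK (inl i)) /=; congr pair; rewrite scaler0.
  rewrite [X in _ = _ + X](eq_bigr (fun i => (0, l2 i x2 *: b2 i))); last first.
    by move=> i _; rewrite (unsplitK (inr i)) /=; congr pair; rewrite scaler0.
  have S1 : \sum_(i < N1) ((l1 i x1 *: b1 i, 0) : V1 * V2) = (x1, 0).
    rewrite [in RHS](lb1 x1); elim/big_rec2: _ => [//|i y1 y2 _ ->].
    by congr pair; rewrite /= addr0.
  have S2 : \sum_(i < N2) ((0, l2 i x2 *: b2 i) : V1 * V2) = (0, x2).
    rewrite [in RHS](lb2 x2); elim/big_rec2: _ => [//|i y1 y2 _ ->].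
    by congr pair; rewrite /= addr0.
  by rewrite S1 S2; congr pair; rewrite /= ?addr0 ?add0r.
- move=> i [x1 x2]; case: (fintype.split i) => j /=.
    rewrite (le_trans (lC1 _ _))// ler_pM// ?(ltW C10)// ?lerDl ?(ltW C20)//.
    by rewrite prod_normE le_max lexx.
  rewrite (le_trans (lC2 _ _))// ler_pM// ?(ltW C20)// ?lerDr ?(ltW C10)//.
  by rewrite prod_normE le_max lexx orbT.
- move=> i; case: (fintype.split i) => j; rewrite prod_normE /= normr0 ge_max.
    by rewrite (le_trans (bC1 _)) ?lerDl ?addr_ge0 ?ltW.
  by rewrite (le_trans (bC2 _)) ?lerDr ?addr_ge0 ?ltW.
- by move=> i a [x1 x2] [y1 y2]; case: (fintype.split i) => j /=; rewrite ?ll1 ?ll2.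
Qed.

(** * The Lie algebra of a Lie group *)

Section Differentiability.
Context {R : realType}.

Lemma near_eq_differentiable (V W : normedModType R) (f g : V -> W) (x : V) :
  (\near x, f x = g x) -> differentiable f x -> differentiable g x.
Proof.
move=> fg df; have fgx : f x = g x := nbhs_singleton fg.
have cd : continuous ('d f x) by exact: diff_continuous.
have og : g \o shift x = cst (g x) + 'd f x +o_ 0 id.
  have := diff_locally df; move=> /eqaddoP H; apply/eqaddoP => e e0.
  have fg0 : \forall h \near 0, f (h + x) = g (h + x).
    by have := fg; rewrite (near_shift 0) /= subr0; apply: filterS => y /=.
  apply: filterS2 (H e e0) fg0 => h + Eh.
  by rewrite /= -![(_ + _ : _ -> _) _]/(_ + _) -![(- _ : _ -> _) _]/(- _) /= Eh fgx.
by apply/diff_locallyP; rewrite (diff_unique cd og).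
Qed.

Lemma differentiable_scale_row (V : normedModType R) m (s : V -> R) (F : V -> 'rV[R]_m) (x : V) :
  differentiable s x -> differentiable F x -> differentiable (fun y => s y *: F y) x.
Proof.
move=> ds dF.
have -> : (fun y => s y *: F y) = \sum_k (fun y => (s y * F y 0 k) *: (delta_mx 0 k : 'rV[R]_m)).
  apply: funext => y; rewrite fct_sumE [in LHS](row_sum_delta (F y)) scaler_sumr.
  by apply: eq_bigr => k _; rewrite scalerA.
apply: differentiable_sum => k; apply: differentiableZl.
apply: differentiableM => //.
apply: (@differentiable_comp _ _ _ _ F (fun M : 'rV[R]_m => M 0 k)) => //.
exact: differentiable_coord.
Qed.

Lemma derive_comp (U V W : normedModType R) (f : U -> V) (g : V -> W) x v :
  differentiable f x -> differentiable g (f x) -> 'D_v (g \o f) x = 'D_('D_v f x) g (f x).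
Proof.
move=> df dg; rewrite (deriveE _ (differentiable_comp df dg)) (deriveE _ dg) (deriveE _ df).
by rewrite diff_comp.
Qed.

Lemma derive_pair (U V W : normedModType R) (f : U -> V) (g : U -> W) x v :
  differentiable f x -> differentiable g x ->
  'D_v (fun y => (f y, g y)) x = ('D_v f x, 'D_v g x).
Proof.
move=> df dg; rewrite (deriveE _ (differentiable_pair df dg)) (deriveE _ df) (deriveE _ dg).
by rewrite (diff_pair df dg).
Qed.

Lemma derive_is_linear (V W : normedModType R) (f : V -> W) (x : V) :
  differentiable f x -> linear (fun v => 'D_v f x).
Proof. by move=> df a u v; rewrite !deriveE // linearP. Qed.

Section MatrixDerivatives.
Variables (V : normedModType R) (x v : V).

Lemma is_derive_mulmx p m q (F : V -> 'M[R]_(p, m)) (M : V -> 'M[R]_(m, q)) dF dM :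
  is_derive x v F dF -> is_derive x v M dM ->
  is_derive x v (fun y => F y *m M y) (dF *m M x + F x *m dM).
Proof.
move=> [dF1 <-] [dM1 <-]; rewrite derive_mx // [X in _ + _ *m X]derive_mx //.
have eF i k : is_derive x v (fun y => F y i k) ('D_v (fun y => F y i k) x).
  by apply: derivableP; exact: (derivable_mxP _ _ _).1 dF1 i k.
have eM k j : is_derive x v (fun y => M y k j) ('D_v (fun y => M y k j) x).
  by apply: derivableP; exact: (derivable_mxP _ _ _).1 dM1 k j.
have E i j : is_derive x v (fun y => (F y *m M y) i j)
   (\sum_k (F x i k * 'D_v (fun y => M y k j) x + M x k j * 'D_v (fun y => F y i k) x)).
  have -> : (fun y => (F y *m M y) i j) = \sum_k (fun y => F y i k * M y k j).
    by apply: funext => y; rewrite fct_sumE mxE.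
  by apply: is_derive_sum => k; exact: is_deriveM.
have dd : derivable (fun y => F y *m M y) x v.
  by apply/derivable_mxP => i j; case: (E i j).
split=> //; rewrite derive_mx //; apply/matrixP => i j; rewrite !mxE; have [_ ->] := E i j.
rewrite -big_split; apply: eq_bigr => k _ /=; rewrite !mxE addrC; congr (_ + _).
by rewrite mulrC.
Qed.

Lemma is_derive_linear_row m p q (L : 'rV[R]_m -> 'M[R]_(p, q)) (f : V -> 'rV[R]_m) df :
  linear L -> is_derive x v f df -> is_derive x v (fun y => L (f y)) (L df).
Proof.
move=> linL [df1 <-].
pose LL : {linear 'rV[R]_m -> 'M[R]_(p, q)} := HB.pack L (GRing.isLinear.Build _ _ _ _ L linL).
have LE w : L w = \sum_k w 0 k *: L (delta_mx 0 k).
  rewrite {1}(row_sum_delta w) -[L]/(LL : _ -> _) linear_sum; apply: eq_bigr => k _.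
  by rewrite linearZ.
have ef k : is_derive x v (fun y => f y 0 k) ('D_v f x 0 k).
  rewrite derive_mx // mxE; apply: derivableP; exact: (derivable_mxP _ _ _).1 df1 0 k.
have E i j : is_derive x v (fun y => L (f y) i j) (\sum_k ('D_v f x) 0 k * L (delta_mx 0 k) i j).
  have -> : (fun y => L (f y) i j) = \sum_k (fun y => L (delta_mx 0 k) i j *: f y 0 k).
    by apply: funext => y; rewrite fct_sumE LE summxE; apply: eq_bigr => k _; rewrite mxE mulrC.
  rewrite (eq_bigr (fun k => L (delta_mx 0 k) i j *: 'D_v f x 0 k)) => [|k _]; last exact: mulrC.
  by apply: is_derive_sum => k; exact: is_deriveZ.
have dd : derivable (fun y => L (f y)) x v.
  by apply/derivable_mxP => i j; case: (E i j).
split=> //; rewrite derive_mx //; apply/matrixP => i j; rewrite !mxE; have [_ ->] := E i j.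
by rewrite (LE ('D_v f x)) summxE; apply: eq_bigr => k _; rewrite mxE.
Qed.

End MatrixDerivatives.

Lemma mul_lin1_mx (F : fieldType) (m p : nat) (f : 'rV[F]_m -> 'rV[F]_p) v : linear f -> v *m lin1_mx f = f v.
Proof.
move=> lf; pose ff : {linear 'rV[F]_m -> 'rV[F]_p} := HB.pack f (GRing.isLinear.Build _ _ _ _ f lf).
exact: (mul_rV_lin1 ff).
Qed.

Lemma lin1_mx_linear (m p q : nat) (F : 'rV[R]_m -> 'rV[R]_p -> 'rV[R]_q) :
  (forall v, linear (F^~ v)) -> linear (fun u => lin1_mx (F u)).
Proof. by move=> lF a u v; apply/matrixP => i j; rewrite !mxE lF !mxE. Qed.

Definition framed (V : normedModType R) := exists N b l C, @linear_frame R V N b l C.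

Lemma framed_row n : framed 'rV[R]_n.
Proof. by exists n; do 3 eexists; exact: row_frame. Qed.

Lemma framed_prod (V1 V2 : normedModType R) : framed V1 -> framed V2 -> framed (V1 * V2)%type.
Proof.
by move=> [N1 [b1 [l1 [C1 f1]]]] [N2 [b2 [l2 [C2 f2]]]]; do 4 eexists; exact: prod_frame f1 f2.
Qed.

Section Smooth.
Variables (V : normedModType R) (m : nat) (U : set V) (f : V -> 'rV[R]_m).
Hypotheses (frV : framed V) (oU : open U) (sf : smooth_on U f).

Let near_derivable vs p : U p -> \forall x \near p, forall v, derivable (iter_derive vs f) x v.
Proof.
move=> Up; have := open_nbhs_nbhs (conj oU Up); apply: filterS => x Ux v.
by have [] := sf vs Ux.
Qed.

Let cont_derive vs p : U p -> forall v, {for p, continuous (fun x => 'D_v (iter_derive vs f) x)}.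
Proof. by move=> Up v; have [] := sf (v :: vs) Up. Qed.

(** [smooth_on] speaks of directional derivatives only, whereas the chain rule needs a differential;
    continuity of the partial derivatives supplies it. *)
Lemma smooth_on_differentiable vs p : U p -> differentiable (iter_derive vs f) p.
Proof.
have [N [b [l [C fr]]]] := frV => Up.
exact: (C1_differentiable fr (near_derivable vs Up) (cont_derive Up)).
Qed.

Lemma smooth_on_strict p (e : R) : U p -> 0 < e -> exists2 d : R, 0 < d &
  forall x y, `|x - p| < d -> `|y - p| < d -> `|f x - f y - 'D_(x - y) f p| <= e * `|x - y|.
Proof.
have [N [b [l [C fr]]]] := frV => Up.
exact: (C1_strictly_differentiable fr (near_derivable [::] Up) (@cont_derive [::] _ Up)).
Qed.

End Smooth.
End Differentiability.

Section Charts.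
Context {R : realType}.

Lemma chart_open_image (E : normedModType R) (T : topologicalType) (c : chart E T) (O : set T) :
  is_chart c -> open O -> O `<=` chart_dom c -> open (chart_map c @` O).
Proof.
move=> [od oi cK cc ic] oO Od; rewrite openE => y [x Ox <-].
have xd := Od _ Ox.
have iy : chart_img c (chart_map c x) by exists x.
have n1 := open_nbhs_nbhs (conj oi iy).
have n2 : \forall z \near chart_map c x, O (chart_inv c z).
  apply: ic => //; rewrite cK //; exact: open_nbhs_nbhs.
by apply: filterS2 n1 n2 => z [w wd <-]; rewrite cK // => Ow; exists w.
Qed.

Lemma open_prod (T T' : topologicalType) (A : set T) (B : set T') :
  open A -> open B -> open (A `*` B).
Proof.
move=> oA oB; rewrite openE => -[x y] [Ax By]; exists (A, B) => //.
by split; exact: open_nbhs_nbhs.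
Qed.

Lemma prod_is_chart (E F : normedModType R) (T T' : topologicalType) (c : chart E T) (c' : chart F T') :
  is_chart c -> is_chart c' -> is_chart (prod_chart c c').
Proof.
move=> [od oi cK cc ic] [od' oi' cK' cc' ic'].
have imgE : chart_img (prod_chart c c') = chart_img c `*` chart_img c'.
  rewrite eqEsubset; split => [_ [[x y] [/= xd yd] <-]|[_ _] [/= [x xd <-] [y yd <-]]].
    by split; [exists x|exists y].
  by exists (x, y).
split.
- exact: open_prod.
- by rewrite imgE; exact: open_prod.
- by move=> [x y] [/= xd yd]; rewrite /= cK ?cK'.
- move=> [x y] [/= xd yd].
  apply: cvg_pair => /=.
    by apply: (@cvg_comp _ _ _ fst (chart_map c)); [exact: cvg_fst|exact: cc].
  by apply: (@cvg_comp _ _ _ snd (chart_map c')); [exact: cvg_snd|exact: cc'].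
- rewrite imgE => -[x y] [/= xd yd].
  apply: cvg_pair => /=.
    by apply: (@cvg_comp _ _ _ fst (chart_inv c)); [exact: cvg_fst|exact: ic].
  by apply: (@cvg_comp _ _ _ snd (chart_inv c')); [exact: cvg_snd|exact: ic'].
Qed.

Lemma smooth_map_chart (E F : normedModType R) (T T' : topologicalType)
    (A : set (chart E T)) (A' : set (chart F T')) (f : T -> T') c c' x :
  smooth_map A A' f -> A c -> A' c' -> is_chart c -> is_chart c' ->
  chart_dom c x -> chart_dom c' (f x) ->
  exists U, [/\ open U, U (chart_map c x) & smooth_on U (chart_map c' \o f \o chart_inv c)].
Proof.
move=> [cf sf] Ac Ac' ic ic' xd fxd.
exists (chart_map c @` (chart_dom c `&` f @^-1` chart_dom c')); split.
- apply: chart_open_image; [exact: ic| |by move=> ? []].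
  case: ic => od _ _ _ _; case: ic' => od' _ _ _ _.
  by apply: openI => //; apply: open_comp => // y _; exact: cf.
- by exists x.
- exact: sf.
Qed.

End Charts.

(** * The adjoint representation and the bracket in charts *)

Section LieGroup.
Context {R : realType} {n : nat} {G : preTopologicalGroupType}.
Variables (A : set (chart 'rV[R]_n G)) (e : chart 'rV[R]_n G).
Hypotheses (lieA : lie_group A) (Ae : A e) (e1 : chart_dom e 1%g).

Local Notation V := 'rV[R]_n.
Local Notation o := (chart_map e 1%g).
Local Notation E := (chart_inv e).

Let chartA c : A c -> is_chart c.
Proof. by case: lieA => -[_ _ + _ _] _ _; apply. Qed.

Let coverA x : exists2 c, A c & chart_dom c x.
Proof. by case: lieA => -[_ _ _ + _] _ _; apply. Qed.

Let mul_continuous : continuous (fun x : G * G => (x.1 * x.2)%g).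
Proof. by case: lieA => _ [+ _] _; apply. Qed.

Let chartK c x : A c -> chart_dom c x -> chart_inv c (chart_map c x) = x.
Proof. by move=> /chartA[_ _ + _ _]; apply. Qed.

Lemma chart_inv_continuous c x : A c -> chart_dom c x -> {for chart_map c x, continuous (chart_inv c)}.
Proof. by move=> /chartA[_ _ _ _ +] xd; apply; exists x. Qed.

Lemma chart_dom_nbhs c x : A c -> chart_dom c x -> nbhs x (chart_dom c).
Proof. by move=> /chartA[od _ _ _ _] xd; exact: open_nbhs_nbhs. Qed.

Lemma near_chart_mapK c x : A c -> chart_dom c x ->
  \forall y \near chart_map c x, chart_map c (chart_inv c y) = y.
Proof.
move=> Ac xd; have [_ oi _ _ _] := chartA Ac.
have : nbhs (chart_map c x) (chart_img c) by apply: open_nbhs_nbhs; split=> //; exists x.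
by apply: filterS => _ [w wd <-]; rewrite chartK.
Qed.

Lemma mul_chart c1 c2 c3 x y : A c1 -> A c2 -> A c3 ->
  chart_dom c1 x -> chart_dom c2 y -> chart_dom c3 (x * y)%g ->
  exists U : set (V * V)%type, [/\ open U, U (chart_map c1 x, chart_map c2 y) &
    smooth_on U (fun p : V * V => chart_map c3 (chart_inv c1 p.1 * chart_inv c2 p.2)%g)].
Proof.
move=> A1 A2 A3 xd yd xyd; case: lieA => _ sm _.
have := @smooth_map_chart _ _ _ _ _ _ _ _ (prod_chart c1 c2) c3 (x, y) sm _ A3 _ (chartA A3) _ xyd.
by apply; [exists c1, c2|exact: prod_is_chart (chartA A1) (chartA A2)|].
Qed.

Lemma mul_chart_differentiable c1 c2 c3 x y vs : A c1 -> A c2 -> A c3 ->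
  chart_dom c1 x -> chart_dom c2 y -> chart_dom c3 (x * y)%g ->
  \forall p \near (chart_map c1 x, chart_map c2 y), differentiable
   (iter_derive vs (fun p : V * V => chart_map c3 (chart_inv c1 p.1 * chart_inv c2 p.2)%g)) p.
Proof.
move=> A1 A2 A3 xd yd xyd; have [U [oU Ux sU]] := mul_chart A1 A2 A3 xd yd xyd.
have := open_nbhs_nbhs (conj oU Ux); apply: filterS => p Up.
exact: (smooth_on_differentiable (framed_prod (framed_row n) (framed_row n)) oU sU).
Qed.

Lemma mulg_continuous (f g : G -> G) x : {for x, continuous f} -> {for x, continuous g} ->
  {for x, continuous (fun z => (f z * g z)%g)}.
Proof.
move=> cf cg; have H : (f z, g z) @[z --> x] --> (f x, g x) by exact: cvg_pair.
exact: (cvg_comp _ _ H (@mul_continuous (f x, g x))).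
Qed.

(** What the chain rule at 1 requires, in a form shared by conjugations, the inversion and the
    involution. *)
Definition local_diff (f : G -> G) :=
  [/\ f 1%g = 1%g, {for 1%g, continuous f} &
      differentiable (chart_map e \o f \o E) o].

Let Eo : E o = 1%g. Proof. exact: chartK. Qed.

Let cEo : E x @[x --> o] --> (1%g : G).
Proof. by have := chart_inv_continuous Ae e1; rewrite /prop_for /continuous_at Eo. Qed.

Lemma near_chart_dom (f : G -> G) : {for 1%g, continuous f} -> f 1%g = 1%g ->
  \forall x \near o, chart_dom e (f (E x)).
Proof.
move=> cf f1; apply: (cvg_comp _ _ cEo cf).
by rewrite f1; exact: chart_dom_nbhs.
Qed.

Let comp_near (f g : G -> G) : local_diff f -> local_diff g ->
  \forall y \near o, ((chart_map e \o f \o E) \o (chart_map e \o g \o E)) y = (chart_map e \o (f \o g) \o E) y.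
Proof.
move=> [f1 cf df] [g1 cg dg]; have := near_chart_dom cg g1; apply: filterS => x xd /=.
by rewrite chartK.
Qed.

Let local_diff_o g : local_diff g -> (chart_map e \o g \o E) o = o.
Proof. by move=> [g1 _ _]; rewrite /= Eo g1. Qed.

Lemma differential1_comp (f g : G -> G) v : local_diff f -> local_diff g ->
  differential1 e (f \o g) v = differential1 e f (differential1 e g v).
Proof.
move=> lf lg; have [f1 cf df] := lf; have [g1 cg dg] := lg.
rewrite /differential1 -(near_eq_derive _ (comp_near lf lg)).
have dfo : differentiable (chart_map e \o f \o E) ((chart_map e \o g \o E) o).
  by rewrite (local_diff_o lg).
by rewrite (derive_comp v dg dfo) (local_diff_o lg).
Qed.

Lemma differential1_linear (f : G -> G) : local_diff f -> linear (differential1 e f).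
Proof. by move=> [_ _ df]; exact: derive_is_linear. Qed.

Lemma differential1_id v : differential1 e id v = v.
Proof.
rewrite /differential1 (near_eq_derive _ (_ : \forall y \near o, (chart_map e \o id \o E) y = id y)).
  by rewrite derive_id.
exact: near_chart_mapK.
Qed.

(** Neither g nor its inverse needs to lie in the domain of [e], so the conjugation is factored
    through charts around them, the constants being inserted as coordinates into the multiplication
    read on a product of charts. *)
Lemma local_diff_conj g : local_diff (fun x => g * x * g^-1)%g.
Proof.
have [c Ac gc] := coverA g; have [d Ad gd] := coverA (g^-1)%g.
split.
- by rewrite mulg1 mulgV.
- apply: mulg_continuous; last exact: cst_continuous.
  by apply: mulg_continuous; [exact: cst_continuous|].
- pose l (y : V) := chart_map c (g * E y)%g.
  pose r (z : V) := chart_map e (chart_inv c z * g^-1)%g.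
  have near1 : \forall y \near o, (r \o l) y = (chart_map e \o (fun x => g * x * g^-1)%g \o E) y.
    have : \forall y \near o, chart_dom c (g * E y)%g.
      have H : {for 1%g, continuous (fun x : G => (g * x)%g)}.
        by apply: mulg_continuous; [exact: cst_continuous|].
      apply: (cvg_comp _ _ cEo H).
      by rewrite mulg1; exact: chart_dom_nbhs.
    by apply: filterS => y yd; rewrite /r /l /= chartK.
  apply: near_eq_differentiable near1 _.
  have lo : l o = chart_map c g by rewrite /l Eo mulg1.
  apply: differentiable_comp.
    have H := nbhs_singleton (mul_chart_differentiable [::] Ac Ae Ac gc e1 _).
    have {}H := H ltac:(by rewrite mulg1).
    have -> : l = (fun p : V * V => chart_map c (chart_inv c p.1 * E p.2)%g) \o (fun y => (chart_map c g, y)).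
      by apply: funext => y; rewrite /l /= chartK.
    apply: differentiable_comp => //; exact: differentiable_pair.
  rewrite lo.
  have H := nbhs_singleton (mul_chart_differentiable [::] Ac Ad Ae gc gd _).
  have {}H := H ltac:(by rewrite mulgV).
  have -> : r = (fun p : V * V => chart_map e (chart_inv c p.1 * chart_inv d p.2)%g) \o (fun y => (y, chart_map d (g^-1)%g)).
    by apply: funext => y; rewrite /r /= chartK.
  apply: differentiable_comp => //; exact: differentiable_pair.
Qed.

Lemma local_diff_smooth f : smooth_map A A f -> f 1%g = 1%g -> local_diff f.
Proof.
move=> sf f1; split=> //; first by case: sf => + _; apply.
have [|U [oU Uo sU]] := smooth_map_chart sf Ae Ae (chartA Ae) (chartA Ae) e1; first by rewrite f1.
exact: (smooth_on_differentiable (framed_row n) oU sU [::] Uo).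
Qed.

Lemma Ad_linear g : linear (Ad e g).
Proof. exact: differential1_linear (local_diff_conj g). Qed.

Lemma Ad_mul g h v : Ad e (g * h)%g v = Ad e g (Ad e h v).
Proof.
rewrite /Ad -differential1_comp; try exact: local_diff_conj.
by congr (differential1 e _ v); apply: funext => x /=; rewrite invgM !mulgA.
Qed.

Lemma Ad1 v : Ad e 1%g v = v.
Proof.
rewrite /Ad (_ : (fun _ => _) = id) ?differential1_id //.
by apply: funext => x; rewrite invg1 mulg1 mul1g.
Qed.

Let mE (p : V * V) : V := chart_map e (E p.1 * E p.2)%g.
Let iE (x : V) : V := chart_map e (E x)^-1%g.

Let mE_diff vs : \forall p \near (o, o), differentiable (iter_derive vs mE) p.
Proof. by apply: (mul_chart_differentiable vs Ae Ae Ae e1 e1); rewrite mulg1. Qed.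

Let inv_continuous : continuous (fun x : G => x^-1)%g.
Proof. by case: lieA => _ _ [+ _]; apply. Qed.

Let iE_local : local_diff (fun x : G => x^-1)%g.
Proof. by apply: local_diff_smooth; [case: lieA|rewrite invg1]. Qed.

Let iE_o : iE o = o. Proof. by rewrite /iE Eo invg1. Qed.

Let iE_diff : differentiable iE o. Proof. by case: iE_local. Qed.

(** Conjugation is a product with x on the left followed by a product with its inverse on the right.
    By the chain rule x then occurs only as the point at which first partial derivatives of the
    multiplication are taken. The inner derivative is expanded in the standard basis because
    [iter_derive] differentiates in fixed directions. *)
Let Ad_formula v : \forall x \near o,
  \sum_j ('D_(0, v) mE (x, o)) 0 j *: 'D_(delta_mx 0 j, 0) mE (x, iE x) = Ad e (E x) v.
Proof.
have c1 : {for o, continuous (fun x : V => (x, o))}.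
  by apply: differentiable_continuous; exact: differentiable_pair.
have c2 : {for o, continuous (fun x : V => (x, iE x))}.
  by apply: differentiable_continuous; exact: differentiable_pair.
rewrite /prop_for /continuous_at iE_o in c2.
have n1 : \forall x \near o, differentiable mE (x, o) := c1 _ (mE_diff [::]).
have n2 : \forall x \near o, differentiable mE (x, iE x) := c2 _ (mE_diff [::]).
have n3 : \forall x \near o, chart_dom e (E x) by apply: (near_chart_dom (f := id)).
have n4 : \forall x \near o, chart_dom e (E x)^-1%g.
  by apply: (near_chart_dom (f := fun x => x^-1)%g); [exact: inv_continuous|rewrite invg1].
have n5 := near_chart_mapK Ae e1.
apply: filterS (filterI (filterI n1 n2) (filterI (filterI n3 n4) n5)) => x [[d1 d2] [[xd xid] xK]].
have mxo : mE (x, o) = x by rewrite /mE /= Eo mulg1.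
have N : \forall y \near o, (mE \o ((fun z => (mE (x, z), iE x)))) y =
    (chart_map e \o (fun z => E x * z * (E x)^-1)%g \o E) y.
  have H : {for 1%g, continuous (fun z : G => (E x * z)%g)}.
    by apply: mulg_continuous; [exact: cst_continuous|].
  have : \forall y \near o, chart_dom e (E x * E y)%g.
    apply: (cvg_comp _ _ cEo H); rewrite mulg1; exact: chart_dom_nbhs.
  apply: filterS => y yd; rewrite /mE /iE /=.
  by rewrite !(chartK Ae).
rewrite /Ad /differential1 -(near_eq_derive _ N).
have dp : differentiable (fun z : V => (x, z)) o by exact: differentiable_pair.
have dm : differentiable (fun z => mE (x, z)) o by apply: (differentiable_comp dp).
have dmi : differentiable (fun z => (mE (x, z), iE x)) o by exact: differentiable_pair.
have dmm : differentiable mE (mE (x, o), iE x) by rewrite mxo.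
rewrite (derive_comp v dmi dmm) mxo.
have -> : 'D_v (fun z => (mE (x, z), iE x)) o = ('D_(0, v) mE (x, o), 0).
  rewrite (derive_pair v dm (differentiable_cst _ _)) derive_cst; congr pair.
  rewrite (@derive_comp _ _ _ _ (fun z : V => (x, z)) mE o v dp d1); congr ('D_ _ _ _).
  have did : differentiable (id : V -> V) o by apply: ex_diff.
  rewrite (derive_pair v (differentiable_cst _ _) did).
  by rewrite derive_cst derive_id.
set w := 'D_(0, v) mE (x, o).
have -> : (w, 0 : V) = \sum_j w 0 j *: (delta_mx 0 j, 0) :> V * V.
  rewrite [in LHS](row_sum_delta w); elim/big_rec2: _ => [//|j y1 y2 _ <-].
  by congr pair; rewrite /= ?scaler0 ?addr0.
rewrite deriveE // linear_sum; apply: eq_bigr => j _.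
by rewrite linearZ deriveE.
Qed.

Lemma Ad_differentiable v : differentiable (fun x => Ad e (E x) v) o.
Proof.
apply: near_eq_differentiable (Ad_formula v) _.
have -> : (fun x => \sum_j ('D_(0, v) mE (x, o)) 0 j *: 'D_(delta_mx 0 j, 0) mE (x, iE x)) =
   \sum_j (fun x => ('D_(0, v) mE (x, o)) 0 j *: 'D_(delta_mx 0 j, 0) mE (x, iE x)).
  by apply: funext => x; rewrite fct_sumE.
apply: differentiable_sum => j; apply: differentiable_scale_row.
  apply: (@differentiable_comp _ _ _ _ (fun x => 'D_(0, v) mE (x, o)) (fun M : 'rV[R]_n => M 0 j)); last exact: differentiable_coord.
  have dp : differentiable (fun z : V => (z, o)) o by exact: differentiable_pair.
  apply: (@differentiable_comp _ _ _ _ (fun z : V => (z, o)) (fun p => 'D_(0, v) mE p) _ dp).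
  exact: nbhs_singleton (mE_diff [:: (0, v)]).
have dp : differentiable (fun z : V => (z, iE z)) o by exact: differentiable_pair.
apply: (@differentiable_comp _ _ _ _ (fun z : V => (z, iE z)) (fun p => 'D_(delta_mx 0 j, 0) mE p) _ dp).
rewrite iE_o.
exact: nbhs_singleton (mE_diff [:: (delta_mx 0 j, 0)]).
Qed.

Lemma bracket_linear_l v : linear (fun u => bracket e u v).
Proof. exact: derive_is_linear (Ad_differentiable v). Qed.

Let Ad_is_derive u v : is_derive o u (fun x => Ad e (E x) v) (bracket e u v).
Proof. by apply: derivableP; apply: diff_derivable; exact: Ad_differentiable. Qed.

Lemma bracket_linear_r u : linear (bracket e u).
Proof.
move=> a v w; rewrite [LHS]/bracket.
have -> : (fun x => Ad e (E x) (a *: v + w)) = a *: (fun x => Ad e (E x) v) + (fun x => Ad e (E x) w).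
  by apply: funext => x; rewrite Ad_linear.
by have [_ ->] := is_deriveD (is_deriveZ a (Ad_is_derive u v)) (Ad_is_derive u w).
Qed.

Lemma mul_ad_mx u v : v *m ad_mx e u = bracket e u v.
Proof. exact: mul_lin1_mx (bracket_linear_r u). Qed.

Lemma ad_mx_linear : linear (ad_mx e).
Proof.
exact: (lin1_mx_linear bracket_linear_l).
Qed.

Lemma mul_Ad_mx g v : v *m lin1_mx (Ad e g) = Ad e g v.
Proof. exact: mul_lin1_mx (Ad_linear g). Qed.

(** Both sides are derivatives at 1 in the direction u: f intertwines the conjugations by x and by
    f(x), which gives an identity between Ad(x) and Ad(f(x)) to be differentiated. *)
Lemma differential1_bracket f u v : local_diff f -> (forall x y, f (x * y) = f x * f y)%g ->
  differential1 e f (bracket e u v) = bracket e (differential1 e f u) (differential1 e f v).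
Proof.
move=> lf fM; have [f1 cf df] := lf.
have dfAd x w : differential1 e f (Ad e x w) = Ad e (f x) (differential1 e f w).
  rewrite /Ad -(differential1_comp _ lf (local_diff_conj x)) -(differential1_comp _ (local_diff_conj (f x)) lf).
  congr (differential1 e _ w); apply: funext => y /=; rewrite !fM; congr (_ * _)%g.
  by apply: (mulgI (f x)); rewrite -fM !mulgV.
have [d1 E1] : is_derive o u (fun x => differential1 e f (Ad e (E x) v)) (differential1 e f (bracket e u v)).
  apply: is_derive_linear_row; [exact: differential1_linear|exact: Ad_is_derive].
rewrite -E1; under eq_fun do rewrite dfAd.
have N : \forall x \near o, ((fun x => Ad e (E x) (differential1 e f v)) \o (chart_map e \o f \o E)) x
     = Ad e (f (E x)) (differential1 e f v).
  by have := near_chart_dom cf f1; apply: filterS => x xd; rewrite /= (chartK Ae).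
rewrite -(near_eq_derive _ N) (@derive_comp _ _ _ _ (chart_map e \o f \o E)) ?(local_diff_o lf) //.
exact: Ad_differentiable.
Qed.

Lemma Ad_bracket g u v : Ad e g (bracket e u v) = bracket e (Ad e g u) (Ad e g v).
Proof.
apply: differential1_bracket; first exact: local_diff_conj.
by move=> x y; rewrite !mulgA -(mulgA (g * x)%g g^-1%g g) mulVg mulg1.
Qed.

(** Differentiate Ad(x)[u, v] = [Ad(x)u, Ad(x)v] at x = 1 in the direction w. *)
Lemma jacobi w u v : bracket e w (bracket e u v) =
  bracket e (bracket e w u) v + bracket e u (bracket e w v).
Proof.
have [_ <-] := Ad_is_derive w (bracket e u v).
under eq_fun do rewrite Ad_bracket -mul_ad_mx.
have D1 := is_derive_linear_row ad_mx_linear (Ad_is_derive w u).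
have [_ ->] := is_derive_mulmx (Ad_is_derive w v) D1.
rewrite Eo.
rewrite (Ad1 u).
rewrite (Ad1 v).
rewrite (mul_ad_mx u (bracket e w v)).
rewrite (mul_ad_mx (bracket e w u) v).
exact: addrC.
Qed.

End LieGroup.

(** * Curves of fixed points of the involution *)

Section LocalInverse.
Context {R : realType}.

Lemma is_derive0_littleo (W : normedModType R) (g : R -> W) (w : W) :
  (forall eps : R, 0 < eps -> \forall t \near (0 : R), `|g t - g 0 - t *: w| <= eps * `|t|) ->
  is_derive (0 : R) (1 : R) g w.
Proof.
move=> H.
suff C : (fun h : R => h^-1 *: ((g \o shift 0) (h *: (1 : R)) - g 0)) @ 0^' --> w.
  by split; [apply/cvg_ex; exists w|exact: cvg_lim C].
apply/cvgrPdist_le => eps eps0; near=> h.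
have h0 : h != 0 by near: h; exact: nbhs_dnbhs_neq.
rewrite /= addr0 [h%:A]mulr1 distrC.
have -> : h^-1 *: (g h - g 0) - w = h^-1 *: (g h - g 0 - h *: w).
  by rewrite [RHS]scalerBr scalerA mulVf // scale1r.
rewrite normrZ normfV ler_pdivrMl ?normr_gt0 // mulrC.
by near: h; apply: cvg_within; exact: H.
Unshelve. all: end_near. Qed.

Section Path.
Variables (V : completeNormedModType R) (Phi : V -> V) (o Y : V).
Hypothesis Phio : Phi o = 0.
Hypothesis strict : forall eps : R, 0 < eps -> exists2 d : R, 0 < d &
  forall x y, `|x - o| < d -> `|y - o| < d -> `|Phi x - Phi y - (x - y)| <= eps * `|x - y|.

(** The equation Phi(x) = t Y is solved by the fixed point of x -> x - Phi(x) + t Y, a contraction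
    of ratio 1/2 near [o]. Continuity of the solution and its derivative at 0 are all that later
    arguments ask of it. *)
Lemma local_inverse_path (r : R) : 0 < r -> exists t0 : R, exists g : R -> V,
  [/\ 0 < t0, continuous g, g 0 = o, (forall t, `|g t - o| < r) &
  is_derive (0 : R) (1 : R) g Y /\ forall t, exists s : R, Phi (g t) = s *: Y].
Proof.
move=> r0; have h0 : (0 : R) < 2^-1 by rewrite invr_gt0.
have [d d0 Hd] := strict h0.
(* Half of the minimum puts the closed ball of radius [r'] inside both open balls. *)
pose r' := Num.min d r / 2.
have m0 : 0 < Num.min d r by rewrite lt_min d0.
have r'0 : 0 < r' by rewrite divr_gt0.
have r'm : r' < Num.min d r by rewrite /r'; lra.
have [r'd r'r] : r' < d /\ r' < r by move: r'm; rewrite lt_min => /andP.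
(* This gives [t0 * |Y| <= r' / 2], the room that the contraction leaves for mapping the ball into
   itself; the summand 1 allows [Y = 0]. *)
pose t0 := r' / (2 * (`|Y| + 1)).
have Y1 : 0 < `|Y| + 1 by rewrite ltr_wpDl.
have t00 : 0 < t0 by rewrite divr_gt0 // mulr_gt0.
have t0Y : t0 * `|Y| <= r' / 2.
  rewrite /t0 -mulrA invfM -!mulrA ler_pM2l // ler_pM2l //.
  by rewrite -[leRHS]mulr1 ler_pM2l // mulrC ler_pdivrMr // mul1r lerDl.
(* The parameter is clamped so that the path is defined on the whole line. *)
pose cl (t : R) := Num.max (- t0) (Num.min t0 t).
have clb t : `|cl t| <= t0.
  rewrite ler_norml /cl le_max lexx /= ge_max; apply/andP; split; first lra.
  by rewrite ge_min lexx.
have clid t : `|t| <= t0 -> cl t = t.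
  rewrite ler_norml => /andP[a b]; rewrite /cl (min_idPr b); exact/max_idPr.
have cl1 t t' : `|cl t - cl t'| <= `|t - t'|.
  have mx (a x y : R) : `|Num.max a x - Num.max a y| <= `|x - y|.
    case: (leP a x) => ax; case: (leP a y) => ay //.
    - by rewrite !ger0_norm; lra.
    - by rewrite !ler0_norm; lra.
    - by rewrite subrr normr0.
  have mn (a x y : R) : `|Num.min a x - Num.min a y| <= `|x - y|.
    case: (leP a x) => ax; case: (leP a y) => ay //.
    - by rewrite subrr normr0.
    - by rewrite !ger0_norm; lra.
    - by rewrite !ler0_norm; lra.
  exact: le_trans (mx _ _ _) (mn _ _ _).
have ex t : exists x : V, `|x - o| <= r' /\ Phi x = cl t *: Y.
  pose T x := x - Phi x + cl t *: Y.
  pose U : set V := [set x | `|x - o| <= r'].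
  have TU : set_fun U U T.
    move=> x xU; rewrite /T /U /=; move: xU; rewrite /U /= => xU.
    have := Hd x o; rewrite subrr normr0 Phio subr0 => /(_ (le_lt_trans xU r'd) d0) H1.
    have -> : x - Phi x + cl t *: Y - o = - (Phi x - (x - o)) + cl t *: Y.
      by rewrite opprB addrAC [x - o - _]addrAC.
    rewrite (le_trans (ler_normD _ _)) // normrN normrZ.
    have : `|cl t| * `|Y| <= r' / 2.
      by rewrite (le_trans _ t0Y) // ler_wpM2r.
    lra.
  have ctr : is_contraction [fun of mkfun TU].
    exists (2^-1%:nng); split; first by rewrite /=; lra.
    move=> [x y] [/= xU yU].
    rewrite /mkfun /T.
    have -> : x - Phi x + cl t *: Y - (y - Phi y + cl t *: Y) = - (Phi x - Phi y - (x - y)).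
      rewrite [in LHS]opprD addrACA subrr addr0 [in LHS]opprB (addrC (Phi y)) addrACA (addrC (- Phi x)).
      by rewrite [RHS]opprB [- (Phi x - Phi y)]opprB.
    by rewrite normrN; apply: Hd; [exact: le_lt_trans r'd|exact: le_lt_trans r'd].
  have cU : closed U.
    have -> : U = closed_ball o r'.
      rewrite closed_ballE //; apply: funext => x /=; rewrite /closed_ball_ /U /=; by rewrite distrC.
    exact: closed_ball_closed.
  have [|x Ux xT] := banach_fixed_point ctr cU.
    by exists o; rewrite /U /= subrr normr0 ltW.
  exists x; split => //; move: xT; rewrite /= /mkfun /T => xT.
  by apply: (addrI (x - Phi x)); rewrite subrK -xT.
pose g t := sval (cid (ex t)).
have g1 t : `|g t - o| <= r' by have [] := svalP (cid (ex t)).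
have g2 t : Phi (g t) = cl t *: Y by have [] := svalP (cid (ex t)).
have gd t : `|g t - o| < d by exact: le_lt_trans r'd.
(* A map at distance 1/2 from the identity has a 2-Lipschitz inverse. *)
have lip t t' : `|g t - g t'| <= 2 * `|Y| * `|t - t'|.
  have := Hd _ _ (gd t) (gd t'); rewrite !g2 -scalerBl => H1.
  have : `|(cl t - cl t') *: Y| <= `|t - t'| * `|Y| by rewrite normrZ ler_wpM2r.
  have := ler_normB ((cl t - cl t') *: Y) ((cl t - cl t') *: Y - (g t - g t')); rewrite subKr.
  lra.
have cl0 : cl 0 = 0 by apply: clid; rewrite normr0 ltW.
have g0 : g 0 = o.
  have := Hd (g 0) o (gd 0); rewrite subrr normr0 => /(_ d0).
  rewrite g2 cl0 scale0r Phio subrr sub0r normrN => H1.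
  have : `|g 0 - o| <= 0 by lra.
  by rewrite normr_le0 subr_eq0 => /eqP.
exists t0, g; split => //.
- move=> t; apply/cvgrPdist_lt => eps eps0; near=> t'.
  rewrite (le_lt_trans (lip _ _)) //.
  apply: (@le_lt_trans _ _ ((2 * (`|Y| + 1)) * `|t - t'|)).
    by rewrite ler_wpM2r // ler_wpM2l // lerDl.
  rewrite mulrC -ltr_pdivlMr ?mulr_gt0 //; near: t'.
  by apply: cvgr_dist_lt => //; rewrite divr_gt0 ?mulr_gt0.
- by move=> t; exact: le_lt_trans r'r.
- split; last by move=> t; exists (cl t).
  apply: is_derive0_littleo => eps eps0.
  have e10 : 0 < eps / (2 * (`|Y| + 1)) by rewrite divr_gt0 ?mulr_gt0.
  have [d1 d10 Hd1] := strict e10.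
  have c0 : \forall t \near (0 : R), `|t| < Num.min t0 (d1 / (2 * (`|Y| + 1))).
    near=> t; near: t; apply: (cvgr0_norm_lt id) => //.
    by rewrite lt_min t00 divr_gt0 ?mulr_gt0.
  apply: filterS c0 => t; rewrite lt_min => /andP[tt0 td1].
  have L1 : `|g t - o| <= 2 * `|Y| * `|t| by have := lip t 0; rewrite g0 subr0.
  have L2 : 2 * `|Y| * `|t| <= 2 * (`|Y| + 1) * `|t|.
    by rewrite ler_wpM2r // ler_wpM2l // lerDl.
  have := Hd1 (g t) o; rewrite subrr normr0 g2 clid ?(ltW tt0) // Phio subr0 => H1.
  rewrite g0 distrC (le_trans (H1 _ d10)) //.
    rewrite (le_lt_trans L1) // (le_lt_trans L2) //.
    by rewrite mulrC -ltr_pdivlMr ?mulr_gt0.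
  apply: (@le_trans _ _ (eps / (2 * (`|Y| + 1)) * (2 * (`|Y| + 1) * `|t|))).
    by apply: ler_wpM2l; [exact: ltW|exact: le_trans L1 L2].
  by rewrite mulrA divfK // gt_eqF // mulr_gt0.
Unshelve. all: end_near. Qed.

End Path.

Lemma local_inverse_path_row n (Phi : 'rV[R]_n -> 'rV[R]_n) (o Y : 'rV[R]_n) :
  Phi o = 0 ->
  (forall eps : R, 0 < eps -> exists2 d : R, 0 < d &
    forall x y, `|x - o| < d -> `|y - o| < d -> `|Phi x - Phi y - (x - y)| <= eps * `|x - y|) ->
  forall r : R, 0 < r -> exists t0 : R, exists g : R -> 'rV[R]_n,
  [/\ 0 < t0, continuous g, g 0 = o, (forall t, `|g t - o| < r) &
  is_derive (0 : R) (1 : R) g Y /\ forall t, exists s : R, Phi (g t) = s *: Y].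
Proof.
pose VC : completeNormedModType R :=
  HB.pack 'rV[R]_n (Uniform_isComplete.Build 'rV[R]_n (@cauchy_cvg 'rV[R]_n)).
exact: (@local_inverse_path VC Phi o Y).
Qed.

End LocalInverse.

Section FixedPoints.
Context {R : realType} {n : nat} {G : preTopologicalGroupType}.
Variables (A : set (chart 'rV[R]_n G)) (e : chart 'rV[R]_n G) (sigma : G -> G).
Hypotheses (lieA : lie_group A) (Ae : A e) (e1 : chart_dom e 1%g).
Hypothesis invs : lie_involution A sigma.

Local Notation V := 'rV[R]_n.
Local Notation o := (chart_map e 1%g).
Local Notation E := (chart_inv e).

Lemma involution1 : sigma 1%g = 1%g.
Proof.
by case: invs => _ sM _; apply: (mulgI (sigma 1%g)); rewrite -sM !mulg1.
Qed.

Lemma involution_local_diff : local_diff e sigma.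
Proof. by apply: (local_diff_smooth lieA Ae e1) involution1; case: invs. Qed.

Let chartA : is_chart e.
Proof. by case: lieA => -[_ _ + _ _] _ _; apply. Qed.

Let chartK x : chart_dom e x -> E (chart_map e x) = x.
Proof. by case: chartA => _ _ + _ _; apply. Qed.

Let L := differential1 e sigma.

Lemma differential_involutive v : L (L v) = v.
Proof.
rewrite /L -(differential1_comp lieA Ae e1 _ involution_local_diff involution_local_diff).
have -> : sigma \o sigma = id by apply: funext => x /=; case: invs.
exact: (differential1_id lieA Ae e1).
Qed.

Let Llin : linear L.
Proof. exact: differential1_linear involution_local_diff. Qed.

Let LM v : v *m lin1_mx L = L v. Proof. exact: mul_lin1_mx. Qed.

Let s := chart_map e \o sigma \o E.

Let so : s o = o. Proof. by rewrite /s /= chartK // involution1. Qed.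

(** Average over the group generated by the involution: where [s] is involutive, Phi(s x) = L(Phi
    x), and the differential of [Phi] at [o] is the identity because [L] is involutive. So [Phi] is
    a local coordinate in which the involution is linear. *)
Let Phi x := 2^-1 *: ((x - o) + L (s x - o)).

Let Phio : Phi o = 0.
Proof. by rewrite /Phi so !subrr -LM mul0mx addr0 scaler0. Qed.

Let Phi_strict (eps : R) : 0 < eps -> exists2 d : R, 0 < d &
  forall x y, `|x - o| < d -> `|y - o| < d -> `|Phi x - Phi y - (x - y)| <= eps * `|x - y|.
Proof.
move=> eps0; have [ss _ _] := invs.
have [|U [oU Uo sU]] := smooth_map_chart ss Ae Ae chartA chartA e1.
  by rewrite involution1.
have [K K0 LK] : exists2 K : R, 0 < K & forall v, `|L v| <= K * `|v|.
  pose LL : {linear V -> V} := HB.pack L (GRing.isLinear.Build _ _ _ _ L Llin).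
  have cL : continuous LL.
    move=> x; apply: differentiable_continuous.
    have -> : (LL : V -> V) = \sum_k (fun y : V => y 0 k *: L (delta_mx 0 k)).
      apply: funext => y; rewrite fct_sumE {1}(row_sum_delta y) linear_sum.
      by apply: eq_bigr => k _; rewrite linearZ.
    apply: differentiable_sum => k; apply: differentiableZl; exact: differentiable_coord.
  exact: (linear_lipschitz (f := LL) cL).
have e10 : 0 < eps / K by rewrite divr_gt0.
have [d d0 Hd] := smooth_on_strict (framed_row n) oU sU Uo e10.
exists d => // x y xd yd.
have -> : Phi x - Phi y - (x - y) = 2^-1 *: L (s x - s y - L (x - y)).
  have key (a b c z w p : V) : 2^-1 *: (z - p + (a - c)) - 2^-1 *: (w - p + (b - c)) - (z - w) =
      2^-1 *: (a - b - (z - w)).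
    by apply/rowP => j; rewrite !mxE; lra.
  rewrite -[in RHS]LM mulmxBl !LM differential_involutive /Phi.
  have -> : L (s x - o) = L (s x) - L o by rewrite -!LM mulmxBl.
  have -> : L (s y - o) = L (s y) - L o by rewrite -!LM mulmxBl.
  have -> : L (s x - s y) = L (s x) - L (s y) by rewrite -!LM mulmxBl.
  exact: key.
rewrite normrZ ger0_norm //.
have H1 : `|s x - s y - L (x - y)| <= eps / K * `|x - y| := Hd x y xd yd.
have H2 := LK (s x - s y - L (x - y)).
have H3 : K * `|s x - s y - L (x - y)| <= eps * `|x - y|.
  by rewrite mulrC -ler_pdivlMr // mulrAC.
have H4 : 0 <= eps * `|x - y| by rewrite mulr_ge0 // ltW.
lra.
Qed.

(** Replaces a one-parameter subgroup. Along the path [Phi] takes values on the line of Y, which [L]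
    fixes, so [Phi] agrees at g(t) and at s(g(t)); as [Phi] is injective near [o], the path consists
    of fixed points. Its image is connected and contains 1. *)
Lemma fixed_points_path Y : L Y = Y -> exists g : R -> V,
  [/\ g 0 = o, is_derive (0 : R) (1 : R) g Y &
     forall t, connected_component (fixed_points sigma) 1%g (E (g t))].
Proof.
move=> LY; have h0 : (0 : R) < 2^-1 by rewrite invr_gt0.
have [d d0 Hd] := Phi_strict h0.
have [sig1 cs ds] := involution_local_diff.
have cso : \forall x \near o, `|s x - o| < d.
  have := differentiable_continuous ds; rewrite /prop_for /continuous_at -/s so => cso.
  by have /cvgrPdist_lt/(_ _ d0) := cso; apply: filterS => x; rewrite distrC.
have n1 := near_chart_dom lieA Ae e1 cs sig1.
have n2 : \forall x \near o, chart_dom e (E x).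
  by apply: (near_chart_dom lieA Ae e1 (f := id)).
have n3 := near_chart_mapK lieA Ae e1.
have n4 : \forall x \near o, {for x, continuous E}.
  have [_ oi _ _ ic] := chartA; have : nbhs o (chart_img e).
    by apply: open_nbhs_nbhs; split=> //; exists 1%g.
  by apply: filterS => x; exact: ic.
have /nbhs_ballP[r0 /= r00 Hr] : \forall x \near o,
    ((`|s x - o| < d) /\ (chart_dom e (sigma (E x)))) /\
    (chart_dom e (E x) /\ (chart_map e (E x) = x /\ {for x, continuous E})).
  exact: filterI (filterI cso n1) (filterI n2 (filterI n3 n4)).
have m0 : 0 < Num.min d r0 by rewrite lt_min d0.
have [t0 [g [t00 cg g0 gm [dg gP]]]] := local_inverse_path_row Y Phio Phi_strict m0.
exists g; split => // t.
have gd u : `|g u - o| < d by have := gm u; rewrite lt_min => /andP[].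
have near u : ((`|s (g u) - o| < d) /\ (chart_dom e (sigma (E (g u))))) /\
    (chart_dom e (E (g u)) /\ (chart_map e (E (g u)) = g u /\ {for g u, continuous E})).
  by apply: Hr; rewrite -ball_normE /= distrC; have := gm u; rewrite lt_min => /andP[].
have fixed u : sigma (E (g u)) = E (g u).
  have [[sd sdom] [gdom [gK _]]] := near u.
  have ss : s (s (g u)) = g u.
    by rewrite /s /= chartK //; have [_ _ ->] := invs.
  have PhiE : Phi (s (g u)) = Phi (g u).
    have [c Pc] := gP u.
    have -> : Phi (s (g u)) = L (Phi (g u)).
      rewrite /Phi ss -[in RHS]LM -scalemxAl mulmxDl !LM differential_involutive.
      by rewrite addrC.
    by rewrite Pc -LM -scalemxAl LM LY.
  have := Hd _ _ sd (gd u); rewrite PhiE subrr sub0r normrN => H1.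
  have : `|s (g u) - g u| <= 0 by lra.
  rewrite normr_le0 subr_eq0 => /eqP sg.
  by rewrite -{2}sg /s /= chartK.
exists ((E \o g) @` [set: R]) => /=; last by exists t.
split.
- by exists 0 => //=; rewrite g0 chartK.
- by move=> _ [u _ <-]; exact: fixed.
- apply: connected_continuous_connected; first by apply/connected_intervalP.
  apply: continuous_subspaceT => u; apply: continuous_comp; first exact: cg.
  by have [_ [_ [_ +]]] := near u.
Qed.

End FixedPoints.

(** * Semisimple elements and the invariant form *)

Section GroupInverse.
Context {F : fieldType} {n : nat}.
Implicit Types x j w g : 'M[F]_n.

(** The inverse of x on its image and zero on its kernel. Being unique, it inherits every symmetry
    of x. *)
Definition group_inverse x j := [/\ x *m j = j *m x, x *m j *m x = x & j *m x *m j = j].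

Lemma group_inverse_unique x j j' : group_inverse x j -> group_inverse x j' -> j = j'.
Proof.
move=> [c1 x1 j1] [c2 x2 j2].
have A1 : x *m j *m (x *m j') = x *m j' by rewrite mulmxA x1.
have A2 : x *m j *m (x *m j') = x *m j by rewrite {1}c1 c2 -mulmxA (mulmxA x) x2 c1.
have A : x *m j = x *m j' by rewrite -A2 A1.
by rewrite -{1}j1 -mulmxA A mulmxA -c1 A c2 j2.
Qed.

(** The idempotent e = x j commutes with w, since e w and w e both equal e w e; the claim for j
    follows. *)
Lemma group_inverse_comm x j w : group_inverse x j -> w *m x = x *m w -> w *m j = j *m w.
Proof.
move=> [c1 x1 j1] cw; pose e := x *m j.
have xe : x *m e = x by rewrite /e c1 mulmxA x1.
have ej : e *m j = j by rewrite /e c1.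
have je : j *m e = j by rewrite /e mulmxA.
have ew1 : e *m w = j *m (w *m x) by rewrite /e c1 -mulmxA cw.
have we1 : w *m e = x *m (w *m j) by rewrite /e mulmxA cw mulmxA.
have ewe : e *m w = w *m e.
  have <- : e *m w *m e = e *m w by rewrite ew1 -!mulmxA xe.
  by rewrite -mulmxA we1 mulmxA x1.
by rewrite -{1}ej mulmxA -ewe ew1 -!mulmxA -/e -ewe mulmxA je.
Qed.

Lemma group_inverse_conj x j g g' : g *m g' = 1%:M -> group_inverse x j ->
  group_inverse (g' *m x *m g) (g' *m j *m g).
Proof.
move=> gg [c1 x1 j1].
have H (a b : 'M[F]_n) : g' *m a *m g *m (g' *m b *m g) = g' *m (a *m b) *m g.
  by rewrite -!mulmxA (mulmxA g g') gg mul1mx.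
by split; rewrite !H ?x1 ?j1 ?c1.
Qed.

Lemma group_inverse_opp x j : group_inverse x j -> group_inverse (- x) (- j).
Proof. by move=> [c1 x1 j1]; split; rewrite !(mulmxN, mulNmx) ?opprK ?c1 // -c1 ?x1 ?c1 ?j1. Qed.

End GroupInverse.

Section Separable.
Context {F : fieldType} {n : nat}.
Implicit Types (x y w : 'M[F]_n.+1) (p : {poly F}).

Definition separable_annihilator x p := horner_mx x p = 0 /\ coprimep p p^`().

(** Since 0 is at most a simple root of p, the gcd of p and X^2 divides X, so that X = u p + v X^2.
    The resulting polynomial depends on p alone, which lets one h serve all points of the orbit. *)
Lemma separable_group_inverse p : coprimep p p^`() ->
  exists h, forall x, horner_mx x p = 0 -> group_inverse x (horner_mx x h).
Proof.
move=> cp.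
have [[u v] Ev] : exists uv : {poly F} * {poly F}, uv.1 * p + uv.2 * ('X * 'X) = 'X.
  have [r0|nr0] := boolP (root p 0); last first.
    have /Bezout_eq1_coprimepP[[u v] /= E] : coprimep p 'X by rewrite coprimepX.
    by exists ('X * u, v); rewrite /= -mulrA [v * _]mulrCA -mulrDr E mulr1.
  have [p1 Ep] := factor_theorem p 0 r0; rewrite subr0 in Ep.
  have /Bezout_eq1_coprimepP[[u v] /= E] : coprimep p1 'X.
    rewrite coprimepX; apply: contraL cp => r1.
    rewrite Ep derivM derivX mulr1; apply/negP => cop.
    have : root (gcdp (p1 * 'X) (p1^`() * 'X + p1)) 0.
      by rewrite root_gcd !rootE !hornerE /= (eqP r1) ?mulr0 ?mul0r ?addr0 ?eqxx.
    by move: cop; rewrite /coprimep => /size_poly1P[c c0 ->]; rewrite rootC (negbTE c0).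
  by exists (u, v); rewrite /= Ep !mulrA -mulrDl E mul1r.
(* With k = v(x) one has x = x^2 k, and then x k^2 is the group inverse. *)
exists ('X * v * v) => x px.
move: (congr1 (horner_mx x) Ev); rewrite rmorphD !rmorphM /= horner_mx_X px mulr0 add0r.
set k := horner_mx x v => Ek.
have kx : k * x = x * k by apply: comm_horner_mx.
have xk : x * x * k = x by rewrite -mulrA -kx mulrA -kx -mulrA.
split; rewrite !mulmxE.
- by apply/esym; rewrite -(mulrA (x * k) k x) kx -[LHS](mulrA x k (x * k)) (mulrA k x k) kx.
- by rewrite !mulrA xk -mulrA kx mulrA xk.
- by rewrite !mulrA -(mulrA (x * k * k) x x) -(mulrA (x * k) k) Ek -(mulrA x k x) kx mulrA xk.
Qed.

Lemma separable_deriv_inj x p (z : 'M[F]_n.+1) : separable_annihilator x p -> horner_mx x p^`() *m z = 0 -> z = 0.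
Proof.
move=> [px /Bezout_eq1_coprimepP[[u v] /= /(congr1 (horner_mx x))]].
rewrite rmorphD !rmorphM /= px mulr0 add0r rmorph1 => E H.
by rewrite -[z]mul1mx -[1%:M]E -mulmxA H mulmx0.
Qed.

(** Derivative of the k-th power at x in the direction y, where y need not commute with x. *)
Fixpoint expmx_deriv x y (k : nat) : 'M[F]_n.+1 :=
  if k is k'.+1 then expmx_deriv x y k' *m x + x ^+ k' *m y else 0.

Definition hornermx_deriv x y p := \sum_(i < size p) p`_i *: expmx_deriv x y i.

Lemma horner_mx_sum x p : horner_mx x p = \sum_(i < size p) p`_i *: x ^+ i.
Proof.
rewrite -{1}[p]coefK poly_def rmorph_sum /=; apply: eq_bigr => i _.
by rewrite linearZ rmorphXn /= horner_mx_X.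
Qed.

Lemma hornermx_deriv_linear x p : linear (fun y => hornermx_deriv x y p).
Proof.
move=> a y y'.
have E k : expmx_deriv x (a *: y + y') k = a *: expmx_deriv x y k + expmx_deriv x y' k.
  elim: k => [|k IH] /=; first by rewrite scaler0 addr0.
  by rewrite IH mulmxDl mulmxDr scalerDr scalemxAl -scalemxAr addrACA.
rewrite /hornermx_deriv scaler_sumr -big_split; apply: eq_bigr => i _ /=.
by rewrite E scalerDr !scalerA mulrC.
Qed.

Lemma hornermx_deriv_comm x z p : z *m x = x *m z -> hornermx_deriv x z p = horner_mx x p^`() *m z.
Proof.
move=> cz.
have E k : expmx_deriv x z k = (x ^+ k.-1 *+ k) *m z.
  elim: k => [|k IH] /=; first by rewrite mulr0n mul0mx.
  rewrite IH -mulmxA cz mulmxA; case: k {IH} => [|k]; first by rewrite !mulr0n !mul0mx add0r mulr1n.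
  by rewrite -mulmxDl -[_ *m x]/(_ * x) mulrnAl -exprSr /= -mulrSr.
rewrite /hornermx_deriv (eq_bigr (fun i : 'I_(size p) => p`_i *: (x ^+ i.-1 *+ i) *m z)); last first.
  by move=> i _; rewrite E scalemxAl.
rewrite -mulmx_suml; congr (_ *m z).
have [->|p0] := eqVneq p 0; first by rewrite deriv0 rmorph0 size_poly0 big_ord0.
have [m sp] : exists m, size p = m.+1 by exists (size p).-1; rewrite prednK // lt0n size_poly_eq0.
rewrite sp.
have dp : p^`() = \sum_(i < m) (p`_i.+1 *+ i.+1) *: 'X^i.
  by rewrite {1}/deriv sp /= poly_def.
rewrite big_ord_recl mulr0n scaler0 add0r dp rmorph_sum; apply: eq_bigr => i _ /=.
by rewrite linearZ rmorphXn /= horner_mx_X -scalerMnr -scalerMnl.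
Qed.

Lemma expmx_deriv_commutator x w k : expmx_deriv x (w *m x - x *m w) k = w *m x ^+ k - x ^+ k *m w.
Proof.
elim: k => [|k IH] /=; first by rewrite mulmx1 mul1mx subrr.
have Ek : x ^+ k *m x = x ^+ k.+1 by rewrite mulmxE -exprSr.
by rewrite IH mulmxBl mulmxBr -(mulmxA w) Ek (mulmxA _ x w) Ek (mulmxA _ w x) addrA subrK.
Qed.

(** Infinitesimal form of the fact that all conjugates of x are annihilated by p. *)
Lemma hornermx_deriv_commutator x w p : horner_mx x p = 0 -> hornermx_deriv x (w *m x - x *m w) p = 0.
Proof.
move=> px.
rewrite /hornermx_deriv (eq_bigr (fun i : 'I_(size p) => w *m (p`_i *: x ^+ i) - (p`_i *: x ^+ i) *m w)).
  by rewrite sumrB -mulmx_sumr -mulmx_suml -horner_mx_sum px mulmx0 mul0mx subrr.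
by move=> i _; rewrite expmx_deriv_commutator scalerBr scalemxAr scalemxAl.
Qed.

End Separable.

(* Row vectors: [v *m ad u] is the bracket [u, v], and [s] is the matrix of the involution. *)
Definition trace_form (R : realType) n (ad : 'rV[R]_n -> 'M[R]_n) (u v : 'rV[R]_n) : R :=
  \tr (ad u *m ad v).

Definition symmetric_algebra (R : realType) n (ad : 'rV[R]_n -> 'M[R]_n) (s : 'M[R]_n) :=
  [/\ linear ad,
      forall u w, ad (u *m ad w) = ad u *m ad w - ad w *m ad u,
      forall u, (forall v, trace_form ad u v = 0) -> u = 0,
      s *m s = 1%:M &
      forall u, ad (u *m s) = s *m ad u *m s].

Section InvariantForm.
Context {R : realType} {n : nat}.
Local Notation V := 'rV[R]_n.
Variables (ad : V -> 'M[R]_n) (s : 'M[R]_n).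
Hypothesis Hs : symmetric_algebra ad s.
Local Notation B := (trace_form ad).

Let ad_linear : linear ad. Proof. by case: Hs. Qed.
Lemma ad_ad (u w : V) : ad (u *m ad w) = ad u *m ad w - ad w *m ad u.
Proof. by case: Hs => _ + _ _ _; apply. Qed.
Lemma trace_form_nondeg u : (forall v, B u v = 0) -> u = 0.
Proof. by case: Hs => _ _ + _ _; apply. Qed.
Lemma s_involutive : s *m s = 1%:M. Proof. by case: Hs. Qed.
Lemma ad_s (u : V) : ad (u *m s) = s *m ad u *m s.
Proof. by case: Hs => _ _ _ _; apply. Qed.

Let adL : {linear V -> 'M[R]_n} := HB.pack ad (GRing.isLinear.Build _ _ _ _ ad ad_linear).

Lemma ad_add u v : ad (u + v) = ad u + ad v. Proof. exact: (linearD adL). Qed.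
Lemma ad_opp u : ad (- u) = - ad u. Proof. exact: (linearN adL). Qed.
Lemma ad_zero : ad 0 = 0. Proof. exact: (linear0 adL). Qed.
Lemma ad_scale a u : ad (a *: u) = a *: ad u.
Proof. by have := ad_linear a u 0; rewrite ad_zero !addr0. Qed.

Lemma ad_eq0 u : ad u = 0 -> u = 0.
Proof. by move=> u0; apply: trace_form_nondeg => v; rewrite /trace_form u0 mul0mx linear0. Qed.

(* The left Leibniz identity makes [ad (u *m ad w)] antisymmetric in [u, w], and the
   Killing form being nondegenerate, [ad] is injective. *)
Lemma ad_anti u w : u *m ad w = - (w *m ad u).
Proof.
apply/eqP; rewrite -addr_eq0; apply/eqP; apply: ad_eq0.
by rewrite ad_add !ad_ad addrC subrKA subrr.
Qed.

Lemma trace_formC u v : B u v = B v u. Proof. exact: mxtrace_mulC. Qed.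
Lemma trace_formDl u v w : B (u + v) w = B u w + B v w.
Proof. by rewrite /trace_form ad_add mulmxDl linearD. Qed.
Lemma trace_formZl a u v : B (a *: u) v = a * B u v.
Proof. by rewrite /trace_form ad_scale -scalemxAl linearZ. Qed.
Lemma trace_formNl u v : B (- u) v = - B u v.
Proof. by rewrite /trace_form ad_opp mulNmx linearN. Qed.
Lemma trace_formDr u v w : B u (v + w) = B u v + B u w.
Proof. by rewrite trace_formC trace_formDl !(trace_formC u). Qed.
Lemma trace_formZr a u v : B u (a *: v) = a * B u v.
Proof. by rewrite trace_formC trace_formZl trace_formC. Qed.
Lemma trace_formNr u v : B u (- v) = - B u v.
Proof. by rewrite trace_formC trace_formNl trace_formC. Qed.
Lemma trace_formBl u v w : B (u - v) w = B u w - B v w.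
Proof. by rewrite trace_formDl trace_formNl. Qed.
Lemma trace_form0l v : B 0 v = 0.
Proof. by rewrite /trace_form ad_zero mul0mx linear0. Qed.
Lemma trace_form0r v : B v 0 = 0. Proof. by rewrite trace_formC trace_form0l. Qed.

Lemma trace_form_ad (u v w : V) : B (u *m ad w) v = - B u (v *m ad w).
Proof.
have trB (M N : 'M[R]_n) : \tr (M - N) = \tr M - \tr N by rewrite raddfB.
rewrite /trace_form !ad_ad mulmxBl mulmxBr !trB opprB -!mulmxA.
by congr (_ - _); rewrite mxtrace_mulC -mulmxA.
Qed.

Lemma trace_form_s (u v : V) : B (u *m s) (v *m s) = B u v.
Proof.
rewrite /trace_form !ad_s -!mulmxA (mulmxA s s) s_involutive mul1mx mxtrace_mulC.
by rewrite -!mulmxA s_involutive mulmx1.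
Qed.

Lemma bracket_s (u w : V) : (u *m ad w) *m s = (u *m s) *m ad (w *m s).
Proof. by rewrite ad_s !mulmxA -(mulmxA u s s) s_involutive mulmx1. Qed.

Lemma trace_form_split u v : u *m s = u -> v *m s = - v -> B u v = 0.
Proof.
move=> us vs; have := trace_form_s u v; rewrite us vs trace_formNr => E.
by have : B u v = 0 by lra.
Qed.

Lemma trace_form_nondeg_q u : u *m s = - u -> (forall v, v *m s = - v -> B u v = 0) -> u = 0.
Proof.
move=> us H; apply: trace_form_nondeg => v.
have -> : v = 2^-1 *: (v + v *m s) + 2^-1 *: (v - v *m s).
  by apply/rowP => i; rewrite !mxE; lra.
rewrite trace_formDr [X in _ + X]H ?addr0.
  rewrite trace_formC; apply: trace_form_split => //.
  by rewrite -scalemxAl mulmxDl -mulmxA s_involutive mulmx1 addrC.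
by rewrite -scalemxAl mulmxBl -mulmxA s_involutive mulmx1 -scalerN opprB.
Qed.

Lemma trace_form_nondeg_h u : u *m s = u -> (forall v, v *m s = v -> B u v = 0) -> u = 0.
Proof.
move=> us H; apply: trace_form_nondeg => v.
have -> : v = 2^-1 *: (v + v *m s) + 2^-1 *: (v - v *m s).
  by apply/rowP => i; rewrite !mxE; lra.
rewrite trace_formDr H ?add0r.
  apply: trace_form_split => //.
  by rewrite -scalemxAl mulmxBl -mulmxA s_involutive mulmx1 -scalerN opprB.
by rewrite -scalemxAl mulmxDl -mulmxA s_involutive mulmx1 addrC.
Qed.

Section AtPoint.
Variables (x : V) (j : 'M[R]_n).
Hypothesis xq : x *m s = - x.
Hypothesis xj : group_inverse (ad x) j.
Local Notation e := (ad x *m j).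

Lemma s_ad_anti : s *m ad x *m s = - ad x. Proof. by rewrite -ad_s xq ad_opp. Qed.

(** Conjugation by s maps ad x to its opposite, and the group inverse of the opposite is unique. *)
Lemma s_ginv_anti : s *m j *m s = - j.
Proof.
apply: (@group_inverse_unique _ _ (- ad x)); last exact: group_inverse_opp.
by rewrite -s_ad_anti; exact: group_inverse_conj s_involutive xj.
Qed.

Lemma swap_ad : ad x *m s = - (s *m ad x).
Proof. by rewrite -mulmxN -s_ad_anti !mulmxA s_involutive mul1mx. Qed.

Lemma swap_ginv : j *m s = - (s *m j).
Proof. by rewrite -mulmxN -s_ginv_anti !mulmxA s_involutive mul1mx. Qed.

Lemma e_s : e *m s = s *m e.
Proof. by rewrite -mulmxA swap_ginv mulmxN [in LHS]mulmxA swap_ad mulNmx opprK mulmxA. Qed.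

Lemma ad_eE : ad x *m e = ad x.
Proof. by have [c x1 _] := xj; rewrite c mulmxA x1. Qed.
Lemma e_adE : e *m ad x = ad x. Proof. by have [_ x1 _] := xj. Qed.
Lemma j_eE : j *m e = j. Proof. by have [_ _ j1] := xj; rewrite mulmxA. Qed.
Lemma j_adE : j *m ad x = e. Proof. by have [-> _ _] := xj. Qed.
Lemma e_idem : e *m e = e. Proof. by rewrite mulmxA e_adE. Qed.

(** [e] is the projection onto the image of ad x along its kernel, so this is the part of that image
    in q, that is [h, x]. *)
Definition tangent_vec (u : V) := u *m s = - u /\ u *m e = u.

Lemma tangent_vecP u : tangent_vec u <-> exists2 y, y *m s = y & u = y *m ad x.
Proof.
split=> [[us ue]|[y ys ->]]; last first.
  split; last by rewrite -mulmxA ad_eE.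
  by rewrite -mulmxA swap_ad mulmxN mulmxA ys.
exists (u *m j).
  by rewrite -mulmxA swap_ginv mulmxN mulmxA us mulNmx opprK.
by rewrite -mulmxA j_adE.
Qed.

Lemma normal_vecP v : v *m s = - v ->
  (forall u, tangent_vec u -> B v u = 0) <-> v *m ad x = 0.
Proof.
move=> vs; split=> [H|vx u /tangent_vecP[y ys ->]]; last first.
  by rewrite trace_formC trace_form_ad vx trace_form0r oppr0.
have vxs : (v *m ad x) *m s = v *m ad x.
  by rewrite bracket_s vs xq ad_opp mulmxN mulNmx opprK.
apply: (trace_form_nondeg_h vxs) => y ys.
rewrite trace_form_ad H ?oppr0 //; apply/tangent_vecP; by exists y.
Qed.

Lemma tangent_nondeg u : tangent_vec u -> (forall v, tangent_vec v -> B u v = 0) -> u = 0.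
Proof.
move=> [us ue] H; have ux : u *m ad x = 0 by apply/(normal_vecP us).
by rewrite -ue mulmxA ux mul0mx.
Qed.

Lemma tangent_decomp v : v *m s = - v -> tangent_vec (v *m e) /\ (v - v *m e) *m ad x = 0.
Proof.
move=> vs; split; last by rewrite mulmxBl -mulmxA e_adE subrr.
by split; [rewrite -mulmxA e_s mulmxA vs mulNmx|rewrite -mulmxA e_idem].
Qed.

Lemma ad_self : x *m ad x = 0.
Proof.
have := ad_anti x x; move/eqP; rewrite -addr_eq0 -mulr2n -scaler_nat scaler_eq0.
by rewrite pnatr_eq0 /= => /eqP.
Qed.

Lemma commuting xi : xi *m ad x = 0 -> ad xi *m ad x = ad x *m ad xi.
Proof. by move=> H; apply/eqP; rewrite -subr_eq0 -ad_ad H ad_zero. Qed.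

Lemma commuting_ginv xi : xi *m ad x = 0 -> ad xi *m j = j *m ad xi.
Proof. by move=> /commuting; exact: group_inverse_comm. Qed.

End AtPoint.
End InvariantForm.

(** * Velocities of smooth curves *)

Section SmoothScalar.
Context {R : realType}.
Implicit Types f g : R -> R.

(** Regularity on the whole line, graded by order so that closure under products and inverses is an
    induction on k. Smooth curves are built entry by entry from such functions. *)
Fixpoint n_derivable (k : nat) f : Prop :=
  if k is k'.+1 then (forall t, derivable f t 1) /\ n_derivable k' (fun t => 'D_1 f t) else True.

Definition smooth_scalar f := forall k, n_derivable k f.

Lemma n_derivableW k f : n_derivable k.+1 f -> n_derivable k f.
Proof. by elim: k f => [//|k IH] f [df d2]; split=> //; exact: IH. Qed.

Lemma n_derivable_cst k c : n_derivable k (cst c).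
Proof.
elim: k c => [//|k IH] c; split=> [t|]; first exact: derivable_cst.
have -> : (fun t => 'D_1 (cst c : R -> R) t) = cst 0 by apply: funext => t; rewrite derive_cst.
exact: IH.
Qed.

Lemma n_derivableD k f g : n_derivable k f -> n_derivable k g -> n_derivable k (fun t => f t + g t).
Proof.
elim: k f g => [//|k IH] f g [df f2] [dg g2]; split=> [t|]; first exact: derivableD.
have -> : (fun t => 'D_1 (fun t => f t + g t) t) = (fun t => 'D_1 f t + 'D_1 g t).
  by apply: funext => t; rewrite (deriveD (df t) (dg t)).
exact: IH.
Qed.

Lemma n_derivableM k f g : n_derivable k f -> n_derivable k g -> n_derivable k (fun t => f t * g t).
Proof.
elim: k f g => [//|k IH] f g kf kg; have [df f2] := kf; have [dg g2] := kg.
split=> [t|]; first exact: derivableM.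
have -> : (fun t => 'D_1 (fun t => f t * g t) t) = (fun t => f t * 'D_1 g t + g t * 'D_1 f t).
  by apply: funext => t; rewrite (deriveM (df t) (dg t)).
by apply: n_derivableD; apply: IH => //; exact: n_derivableW.
Qed.

Lemma n_derivableV k f : (forall t, f t != 0) -> n_derivable k f -> n_derivable k (fun t => (f t)^-1).
Proof.
move=> f0; elim: k => [//|k IH] kf; have [df f2] := kf.
have dV t := derivableV (f0 t) (df t).
split=> [t|]; first exact: dV.
have -> : (fun t => 'D_1 (fun t => (f t)^-1) t) = (fun t => (cst (-1) t * 'D_1 f t) * ((f t)^-1 * (f t)^-1)).
  apply: funext => t; rewrite (deriveV (f0 t) (df t)) /cst /GRing.scale /=.
  by field; exact: f0.
have kV := IH (n_derivableW kf).
by apply: n_derivableM; apply: n_derivableM => //; exact: n_derivable_cst.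
Qed.

Lemma n_derivable_id k : n_derivable k id.
Proof.
case: k => [//|k]; split=> [t|]; first exact: derivable_id.
have -> : (fun t => 'D_1 (id : R -> R) t) = cst 1 by apply: funext => t; rewrite derive_id.
exact: n_derivable_cst.
Qed.

Lemma smooth_sum I (r : seq I) (F : I -> R -> R) :
  (forall i, smooth_scalar (F i)) -> smooth_scalar (fun t => \sum_(i <- r) F i t).
Proof.
move=> H k; elim: r => [|i r IH].
  by under eq_fun do rewrite big_nil; exact: n_derivable_cst.
by under eq_fun do rewrite big_cons; apply: n_derivableD => //; exact: H.
Qed.

(* A bounded smooth reparametrization of the line with speed 1 at 0. *)
Definition slow (K t : R) := t * (1 + (K * t) * (K * t))^-1.

Lemma slow_den K t : 1 + (K * t) * (K * t) != 0 :> R.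
Proof. by rewrite gt_eqF // ltr_pwDl // -expr2 sqr_ge0. Qed.

Lemma slow_smooth K : smooth_scalar (slow K).
Proof.
move=> k; apply: n_derivableM; first exact: n_derivable_id.
apply: n_derivableV => [t|]; first exact: slow_den.
apply: n_derivableD; first exact: n_derivable_cst.
by apply: n_derivableM; apply: n_derivableM; exact: n_derivable_cst || exact: n_derivable_id.
Qed.

Lemma slow0 K : slow K 0 = 0. Proof. by rewrite /slow mul0r. Qed.

Lemma slow_bound K t : 0 < K -> `|slow K t| <= K^-1.
Proof.
move=> K0; have d0 : 0 < 1 + (K * t) * (K * t) by rewrite ltr_pwDl // -expr2 sqr_ge0.
rewrite /slow normrM normfV (gtr0_norm d0) ler_pdivrMr // ler_pdivlMl //.
have -> : K * `|t| = `|K * t| by rewrite normrM (gtr0_norm K0).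
rewrite -expr2 -real_normK ?num_real //; have := sqr_ge0 (`|K * t| - 1); nra.
Qed.

Lemma is_derive_slow K : is_derive (0 : R) 1 (slow K) 1.
Proof.
have nd k : n_derivable k (fun t : R => 1 + (K * t) * (K * t)).
  apply: n_derivableD; first exact: n_derivable_cst.
  by apply: n_derivableM; apply: n_derivableM; exact: n_derivable_cst || exact: n_derivable_id.
pose h (t : R) := (1 + (K * t) * (K * t))^-1.
have [dh _] : n_derivable 1 h by apply: n_derivableV => [t|//]; exact: slow_den.
have [d1 E] := is_deriveM (is_derive_id (0 : R) (1 : R)) (derivableP (dh 0)).
have -> : slow K = (id : R -> R) * h by [].
split=> //; rewrite E /= scale0r add0r /h !mulr0 addr0 invr1.
exact: mulr1.
Qed.

End SmoothScalar.

Lemma is_derive_scalel (R : realType) (V : normedModType R) (phi : R -> R) (w : V) (t d : R) :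
  is_derive t (1 : R) phi d -> is_derive t (1 : R) (fun t => phi t *: w) (d *: w).
Proof.
move=> [dphi E]; have df : differentiable phi t by apply/derivable1_diffP.
have dl : differentiable (fun t => phi t *: w) t by exact: differentiableZl.
split; first exact: diff_derivable.
by rewrite (deriveE _ dl) (diffZl w df) -E (deriveE _ df).
Qed.

Lemma is_derive_line (R : realType) (V : normedModType R) (phi : R -> R) (p w : V) (t d : R) :
  is_derive t (1 : R) phi d -> is_derive t (1 : R) (fun t => p + phi t *: w) (d *: w).
Proof.
move=> /(is_derive_scalel w)[d1 E].
have dc : derivable (cst p : R -> V) t 1 by exact: derivable_cst.
split; first exact: (derivableD dc d1).
by have := deriveD dc d1; rewrite derive_cst add0r E.
Qed.

Section SmoothCurves.
Context {R : realType} {n : nat}.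
Local Notation V := 'rV[R]_n.
Implicit Types c : R^o -> V.

Lemma smooth_curve_entries c : smooth_curve c -> forall i, smooth_scalar (fun t => c t 0 i).
Proof.
move=> sc i k.
suff H l : n_derivable k (fun t => iter_derive (nseq l (1 : R^o)) c t 0 i) by exact: (H 0).
elim: k l => [//|k IH] l.
have d t : derivable (iter_derive (nseq l (1 : R^o)) c) t 1 by have [_] := sc (nseq l 1) t I; apply.
split=> [t|]; first exact: (derivable_mxP _ _ _).1 (d t) 0 i.
have -> : (fun t => 'D_1 (fun t => iter_derive (nseq l (1 : R^o)) c t 0 i) t) =
   (fun t => iter_derive (nseq l.+1 (1 : R^o)) c t 0 i).
  by apply: funext => t /=; rewrite derive_mx // mxE.
exact: IH.
Qed.

Lemma entries_smooth_curve c : (forall i, smooth_scalar (fun t => c t 0 i)) -> smooth_curve c.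
Proof.
move=> sc.
have H vs i : smooth_scalar (fun t => iter_derive vs c t 0 i).
  elim: vs i => [|v vs IH] i; first exact: sc.
  have d t : derivable (iter_derive vs c) t 1.
    by apply/derivable_mxP => a b; rewrite ord1; have [+ _] := IH b 1%N; apply.
  have -> : (fun t => iter_derive (v :: vs) c t 0 i) =
     (fun t => cst (v : R) t * 'D_1 (fun t => iter_derive vs c t 0 i) t).
    apply: funext => t /=.
    have -> : v = v *: (1 : R^o) by rewrite [RHS]mulr1.
    have [_ ->] := is_deriveZdir v (d t); rewrite mxE [v%:A]mulr1; congr (_ * _).
    by rewrite derive_mx // mxE.
  move=> k; apply: n_derivableM; first exact: n_derivable_cst.
  by have [_] := IH i k.+1.
move=> vs t _.
have d : derivable (iter_derive vs c) t 1.
  by apply/derivable_mxP => a b; rewrite ord1; have [+ _] := H vs b 1%N; apply.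
split; first by apply: differentiable_continuous; exact/derivable1_diffP.
move=> v; have -> : v = v *: (1 : R^o) by rewrite [RHS]mulr1.
by have [] := is_deriveZdir v d.
Qed.

Lemma smooth_curve_is_derive c t : smooth_curve c -> is_derive (t : R) (1 : R) c (derive1 c t).
Proof.
by move=> sc; rewrite derive1E; apply: derivableP; have [_] := sc [::] t I; apply.
Qed.

Lemma smooth_on_comp_line (O : set V) (g : V -> V) (p w : V) (phi : R -> R) :
  open O -> smooth_on O g -> smooth_scalar phi -> (forall t, O (p + phi t *: w)) ->
  smooth_curve (fun t => g (p + phi t *: w)).
Proof.
move=> oO sg sphi Op; apply: entries_smooth_curve => i k.
(* Generalizing over [vs] closes the induction: differentiating along the line multiplies by the
   derivative of phi and prepends [w]. *)
suff H vs : n_derivable k (fun t => iter_derive vs g (p + phi t *: w) 0 i) by exact: (H [::]).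
elim: k vs => [//|k IH] vs.
have D (t : R) : is_derive t (1 : R) (fun t => iter_derive vs g (p + phi t *: w))
    ('D_1 phi t *: 'D_w (iter_derive vs g) (p + phi t *: w)).
  have dphi : is_derive t (1 : R) phi ('D_1 phi t) by apply: derivableP; have [+ _] := sphi 1%N; apply.
  have [dl1 El] := is_derive_line p w dphi.
  have dl : differentiable (fun t => p + phi t *: w) t by apply/derivable1_diffP.
  have dg : differentiable (iter_derive vs g) (p + phi t *: w).
    exact: (smooth_on_differentiable (framed_row n) oO sg).
  split.
    by apply: diff_derivable; exact: (@differentiable_comp _ _ _ _ (fun t => p + phi t *: w)).
  rewrite (@derive_comp _ _ _ _ (fun t => p + phi t *: w) _ t 1 dl dg) El.
  by rewrite (deriveE _ dg) (deriveE _ dg) linearZ.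
have E (t : R) : is_derive t (1 : R) (fun t => iter_derive vs g (p + phi t *: w) 0 i)
    ('D_1 phi t * iter_derive (w :: vs) g (p + phi t *: w) 0 i).
  have [d1 d2] := D t; split; first exact: (derivable_mxP _ _ _).1 d1 0 i.
  by have := congr1 (fun M : 'rV[R]_n => M 0 i) d2; rewrite derive_mx // !mxE.
split=> [t|]; first by case: (E t).
have -> : (fun t => 'D_1 (fun t => iter_derive vs g (p + phi t *: w) 0 i) t) =
   (fun t => 'D_1 phi t * iter_derive (w :: vs) g (p + phi t *: w) 0 i).
  by apply: funext => t; case: (E t).
by apply: n_derivableM; [have [_] := sphi k.+1|exact: IH].
Qed.

End SmoothCurves.

Section TangentSpaces.
Context {R : realType} {n : nat}.
Local Notation V := 'rV[R]_n.
Implicit Types (M : set V) (W : {vspace V}).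

Lemma set_span_vspace (K : fieldType) (E : vectType K) (S : set E) (W : {vspace E}) :
  (forall v, S v <-> v \in W) -> set_span S = W.
Proof.
move=> SW; rewrite /set_span; set Q := [set W0 : {vspace E} | _].
have QW : Q W.
  split=> [v /SW//|U SU]; apply/subvP => v /SW; exact: SU.
have [Q1 Q2] := @xgetPex _ 0%VS Q (ex_intro _ W QW).
apply/eqP; rewrite eqEsubv; apply/andP; split; last by apply/subvP => v /SW; exact: Q1.
by apply: Q2 => v /SW.
Qed.

Lemma vspace_derive (W : {vspace V}) (z : R -> V) (v : V) :
  (\forall t \near (0 : R), z t \in W) -> is_derive (0 : R) (1 : R) z v -> v \in W.
Proof.
move=> zW dz; pose L (u : V) := u - projv W u.
have Llin : linear L by move=> a x y; rewrite /L linearP scalerBr opprD addrACA.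
have L0 u : L u = 0 -> u \in W.
  by move=> /eqP; rewrite subr_eq0 => /eqP ->; exact: memv_proj.
have LW u : u \in W -> L u = 0 by move=> uW; rewrite /L projv_id // subrr.
apply: L0; have [_ <-] := is_derive_linear_row Llin dz.
have E : \forall t \near (0 : R), L (z t) = cst 0 t by apply: filterS zW => t /LW.
by rewrite (near_eq_derive _ E) derive_cst.
Qed.

(** The paths obtained from fixed points are only differentiable at 0, whereas [curve_in] asks for
    smooth curves on the whole line. In a straightening chart the velocity lies in the linear model,
    and a bounded slow motion along a line there is carried back to M. *)
Lemma submanifold_velocity M x (z : R -> V) v : submanifold M -> M x ->
  z 0 = x -> (\forall t \near (0 : R), M (z t)) -> is_derive (0 : R) (1 : R) z v ->
  exists2 c : R^o -> V, curve_in M x c & derive1 c 0 = v.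
Proof.
move=> [k sM] Mx z0 Mz dz.
have [U [f [g [W [[oU Ux] ofU sf sg [gf _ MW]]]]]] := sM x Mx.
have df : differentiable f x := smooth_on_differentiable (framed_row n) oU sf [::] Ux.
have ddz : differentiable z 0 by apply/derivable1_diffP; case: dz.
have cz : z t @[t --> (0 : R)] --> x by rewrite -z0; exact: differentiable_continuous.
have Uz : \forall t \near (0 : R), U (z t) by apply: cz; exact: open_nbhs_nbhs.
pose w := 'D_v f x.
have dfz : is_derive (0 : R) (1 : R) (f \o z) w.
  have dfz0 : differentiable f (z 0) by rewrite z0.
  split; first by apply: diff_derivable; exact: differentiable_comp.
  by rewrite (derive_comp (1 : R) ddz dfz0) z0; have [_ ->] := dz.
have wW : w \in W.
  by apply: vspace_derive dfz; apply: filterS2 Uz Mz => t Ut Mt; apply/(MW _ Ut).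
have pO : (f @` U) (f x) by exists x.
have pW : f x \in W by apply/(MW _ Ux).
have /nbhs_ballP[d /= d0 Hd] := open_nbhs_nbhs (conj ofU pO).
(* Keeps [slow K t *: w] shorter than [d], hence the line inside the image of the chart. *)
pose K := (`|w| + 1) / d; have w1 : 0 < `|w| + 1 by rewrite ltr_wpDl.
have K0 : 0 < K by rewrite divr_gt0.
have inO t : (f @` U) (f x + slow K t *: w).
  apply: Hd; rewrite -ball_normE /= opprD addrA subrr sub0r normrN normrZ.
  apply: (@le_lt_trans _ _ (K^-1 * `|w|)); first by rewrite ler_wpM2r // slow_bound.
  by rewrite /K invf_div mulrAC ltr_pdivrMr // ltr_pM2l // ltrDl.
pose c (t : R^o) := g (f x + slow K t *: w).
exists c; first split.
- exact: (smooth_on_comp_line ofU sg (slow_smooth K) inO).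
- move=> t; have [y Uy E] := inO t; rewrite /c -E gf //; apply/(MW _ Uy).
  by rewrite E memvD // memvZ.
- by rewrite /c slow0 scale0r addr0 gf.
rewrite derive1E /c.
have [dl El] := is_derive_line (f x) w (is_derive_slow K).
have dl' : differentiable (fun t => f x + slow K t *: w) 0 by apply/derivable1_diffP.
have dg : differentiable g (f x + slow K 0 *: w).
  by rewrite slow0 scale0r addr0; exact: (smooth_on_differentiable (framed_row n) ofU sg [::] pO).
rewrite (@derive_comp _ _ _ _ (fun t => f x + slow K t *: w) g (0 : R) (1 : R) dl' dg) El scale1r slow0 scale0r addr0.
rewrite slow0 scale0r addr0 in dg.
rewrite /w -(derive_comp v df dg).
have E : \forall y \near x, (g \o f) y = id y.
  by apply: filterS (open_nbhs_nbhs (conj oU Ux)) => y Uy /=; rewrite gf.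
by rewrite (near_eq_derive _ E) derive_id.
Qed.

End TangentSpaces.

(** * Characteristic polynomials and power traces *)

Section PowerSums.
Context {F : numFieldType}.
Implicit Types s t : seq F.

Lemma sum_horner s (p : {poly F}) :
  \sum_(x <- s) p.[x] = \sum_(i < size p) p`_i * \sum_(x <- s) x ^+ i.
Proof.
under eq_bigr do rewrite horner_coef.
by rewrite exchange_big; apply: eq_bigr => i _; rewrite mulr_sumr.
Qed.

(* Evaluate a polynomial vanishing at all the values but one. *)
Lemma power_sums_perm_eq s t :
  (forall k, \sum_(x <- s) x ^+ k = \sum_(x <- t) x ^+ k) -> perm_eq s t.
Proof.
move=> E; apply/allP => z _ /=.
pose u := undup [seq x <- s ++ t | x != z]; pose p : {poly F} := \prod_(y <- u) ('X - y%:P).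
have Ep : \sum_(x <- s) p.[x] = \sum_(x <- t) p.[x].
  by rewrite !sum_horner; apply: eq_bigr => i _; rewrite E.
have pz : p.[z] != 0.
  by rewrite -rootE root_prod_XsubC mem_undup mem_filter eqxx.
have C v : {subset v <= s ++ t} -> \sum_(x <- v) p.[x] = (count_mem z v)%:R * p.[z].
  move=> sv; rewrite (bigID (pred1 z)) /= [X in _ + X]big1_seq ?addr0; last first.
    move=> x /andP[xz /sv xst]; apply/eqP; rewrite -rootE root_prod_XsubC mem_undup.
    by rewrite mem_filter xz.
  rewrite (eq_bigr (fun=> p.[z])); last by move=> x /eqP ->.
  by rewrite big_const_seq iter_addr_0 mulr_natl.
have : (count_mem z s)%:R * p.[z] = (count_mem z t)%:R * p.[z].
  by rewrite -!C // => x xs; rewrite mem_cat xs ?orbT.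
by move=> /(mulIf pz)/eqP; rewrite eqr_nat.
Qed.

Lemma odd_power_sums_perm_eq s :
  perm_eq s (map -%R s) <-> (forall k, odd k -> \sum_(x <- s) x ^+ k = 0).
Proof.
have E k : \sum_(x <- map -%R s) x ^+ k = (-1) ^+ k * \sum_(x <- s) x ^+ k.
  by rewrite big_map mulr_sumr; apply: eq_bigr => x _; exact: exprNn.
split=> [ps k ko|H].
  have := E k; rewrite -(perm_big _ ps) /= -signr_odd ko expr1 mulN1r => /eqP.
  by rewrite -addr_eq0 -mulr2n mulrn_eq0 /= => /eqP.
apply: power_sums_perm_eq => k; rewrite E -signr_odd.
by case: (boolP (odd k)) => [/H ->|_]; rewrite ?mulr0 // mul1r.
Qed.

(* The odd coefficients vanish when [p] and [p(-X)] agree up to sign. *)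
Lemma odd_coefs_perm_eq s :
  perm_eq s (map -%R s) <-> (forall k, odd k -> (k <= size s)%N ->
    (\prod_(x <- s) ('X - x%:P))`_(size s - k) = 0).
Proof.
pose p : {poly F} := \prod_(x <- s) ('X - x%:P).
have sp : size p = (size s).+1 by rewrite size_prod_XsubC.
have E : \prod_(x <- map -%R s) ('X - x%:P) = (-1) ^+ size s *: (p \Po (- 'X)).
  rewrite big_map /p; elim: s {p sp} => [|x s IH]; first by rewrite !big_nil comp_polyC expr0 scale1r.
  rewrite !big_cons IH /= comp_polyM exprS -scalerA scaleN1r -scalerAr -scalerN -mulNr.
  by rewrite comp_polyB comp_polyX comp_polyC opprB opprK polyCN opprK addrC.
have C i : (p \Po - 'X)`_i = (-1) ^+ i * p`_i.
  have -> : p \Po - 'X = \poly_(i < size p) ((-1) ^+ i * p`_i).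
    rewrite comp_polyE poly_def; apply: eq_bigr => k _.
    have -> : (- 'X) ^+ k = ((-1) ^+ k)%:P * 'X^k :> {poly F} by rewrite polyC_exp polyCN polyC1; exact: exprNn.
    by rewrite mul_polyC scalerA [p`_k * _]mulrC.
  by rewrite coef_poly; case: ltnP => // /(nth_default 0) ->; rewrite mulr0.
split=> [/(perm_big _) /= ps k ko ks|H].
  have := E; rewrite -ps -/p => /(congr1 (fun q : {poly F} => q`_(size s - k))).
  rewrite coefZ C mulrA -exprD -signr_odd oddD oddB // ko addbT addbN addbb /= mulN1r => /eqP.
  by rewrite -addr_eq0 -mulr2n mulrn_eq0 /= => /eqP.
apply: prod_XsubC_eq; rewrite E -/p; apply/polyP => i; rewrite coefZ C mulrA -exprD -signr_odd oddD.
have [si|si] := ltnP (size s) i.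
  by rewrite !nth_default ?mulr0 // sp.
have [eo|eo] := boolP (odd (size s) == odd i).
  by rewrite (eqP eo) addbb mul1r.
have -> : p`_i = 0; last by rewrite mulr0.
have := H (size s - i)%N; rewrite subKn // leq_subr; apply => //.
by rewrite oddB //; move: eo; case: odd; case: odd.
Qed.

End PowerSums.

Section CharPolySimilar.
Context {F : fieldType}.

Lemma char_poly_similar n (A T P : 'M[F]_n) : P \in unitmx -> P *m A = T *m P ->
  char_poly A = char_poly T.
Proof.
move=> Pu PA; pose PC := map_mx (@polyC F) P.
have dP : \det PC != 0.
  by rewrite det_map_mx polyC_eq0 -unitfE -unitmxE.
apply: (mulfI dP); rewrite /char_poly -det_mulmx mulrC -det_mulmx; congr (\det _).
rewrite /char_poly_mx mulmxBr mulmxBl scalar_mxC -/PC; congr (_ - _).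
by rewrite -!map_mxM PA.
Qed.

Lemma exp_similar n (A T P : 'M[F]_n) k : P *m A = T *m P -> P *m A ^+ k = T ^+ k *m P.
Proof.
move=> PA; elim: k => [|k IH]; first by rewrite !expr0 mulmx1 mul1mx.
by rewrite !exprSr -!mulmxE mulmxA IH -mulmxA PA mulmxA.
Qed.

Lemma mxtrace_exp_similar n (A T P : 'M[F]_n) k : P \in unitmx -> P *m A = T *m P ->
  \tr (A ^+ k) = \tr (T ^+ k).
Proof.
move=> Pu /(exp_similar k) E.
by rewrite -[T ^+ k](mulmxK Pu) -E mxtrace_mulC mulKmx.
Qed.

Lemma trig_exp n (T : 'M[F]_n) k : is_trig_mx T ->
  is_trig_mx (T ^+ k) /\ forall i, (T ^+ k) i i = T i i ^+ k.
Proof.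
move=> /is_trig_mxP Tt; elim: k => [|k [/is_trig_mxP IH1 IH2]].
  rewrite expr0; split; first exact: scalar_mx_is_trig.
  by move=> i; rewrite mxE eqxx.
rewrite exprS; split.
  apply/is_trig_mxP => i l il; rewrite mxE big1 // => m _.
  have [im|mi] := ltnP i m; first by rewrite Tt ?mul0r.
  by rewrite IH1 ?mulr0 // (leq_ltn_trans mi).
move=> i; rewrite mxE (bigD1 i) //= big1 ?addr0 ?IH2 ?exprS // => m mi.
case: (ltngtP i m) => [im|mi'|/val_inj E]; first by rewrite Tt ?mul0r.
  by rewrite IH1 ?mulr0.
by rewrite E eqxx in mi.
Qed.

End CharPolySimilar.

(** Each side says that the complex spectrum with multiplicities is symmetric under negation; a
    triangularization over the complex numbers puts this spectrum on a diagonal. *)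
Lemma odd_coefs_trace (R : rcfType) n (A : 'M[R]_n) :
  (forall k, odd k -> (k <= n)%N -> (char_poly A)`_(n - k) = 0) <->
  (forall k, odd k -> \tr (A ^+ k) = 0).
Proof.
case: n A => [|n] A.
  split=> [_ k _|_ k ko]; first by rewrite /mxtrace big_ord0.
  by rewrite leqn0 => /eqP k0; rewrite k0 in ko.
pose AC := map_mx (real_complex R) A.
have [P Pu /= tT] := Schur AC isT; set T := conjmx P AC in tT.
have {}Pu := unitarymx_unit Pu.
have PA : P *m AC = T *m P by rewrite /T conjumx // mulmxKV.
pose ds := [seq T i i | i <- enum 'I_n.+1].
have sds : size ds = n.+1 by rewrite size_map size_enum_ord.
have cP : map_poly (real_complex R) (char_poly A) = \prod_(x <- ds) ('X - x%:P).
  by rewrite map_char_poly (char_poly_similar Pu PA) char_poly_trig // big_map big_enum.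
have tP k : real_complex R (\tr (A ^+ k)) = \sum_(x <- ds) x ^+ k.
  have -> : real_complex R (\tr (A ^+ k)) = \tr (AC ^+ k).
    by rewrite -rmorphXn /mxtrace rmorph_sum; apply: eq_bigr => i _; rewrite mxE.
  rewrite (mxtrace_exp_similar k Pu PA) /mxtrace big_map big_enum; apply: eq_bigr => i _.
  by have [_ ->] := trig_exp k tT.
have inj0 (x : R) : real_complex R x = 0 -> x = 0.
  by move=> /eqP; rewrite fmorph_eq0 => /eqP.
apply: (iff_trans _ (iff_trans (iff_sym (odd_coefs_perm_eq ds)) (iff_trans (odd_power_sums_perm_eq ds) _))).
  rewrite -cP sds; split=> H k ko kn; first by rewrite coef_map H // rmorph0.
  by apply: inj0; rewrite -coef_map; exact: H.
by split=> H k ko; [apply: inj0; rewrite tP H|rewrite -tP H // rmorph0].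
Qed.

Lemma dim_subvsT (K : fieldType) (V : vectType K) (W : {vspace V}) :
  \dim {: subvs_of W} = \dim W.
Proof. by rewrite dimvf. Qed.

Section RestrictedTrace.
Context {F : fieldType} {n : nat}.

(* With [I] and [Q] the matrices of the inclusion of [W] and of the projection
   given by [P], [Q *m I = P] and [I *m Q = 1]. *)
Lemma mxtrace_restrict (W : {vspace 'rV[F]_n}) (f : 'End(subvs_of W)) (A P : 'M[F]_n) k :
  (forall u, vsval (f u) = vsval u *m A) ->
  (forall v, v *m P \in W) -> (forall u, u \in W -> u *m P = u) ->
  \tr (mxof (vbasis {:subvs_of W}) (vbasis {:subvs_of W}) f ^+ k) = \tr (A ^+ k *m P).
Proof.
move=> fA PW WP; set b := vbasis _; set N := mxof b b f.
have bP : basis_of {:subvs_of W} b := vbasisP _.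
pose I : 'M[F]_(\dim {:subvs_of W}, n) := lin1_mx (fun v => vsval (vecof b v)).
have lI : linear (fun v => vsval (vecof b v)) by move=> a u v; rewrite !linearP.
pose Q : 'M[F]_(n, \dim {:subvs_of W}) := lin1_mx (fun v => rVof b (vsproj W (v *m P))).
have lQ : linear (fun v => rVof b (vsproj W (v *m P))).
  by move=> a u v; rewrite mulmxDl -scalemxAl !linearP.
have vI v : v *m I = vsval (vecof b v) by rewrite mul_lin1_mx.
have vQ v : v *m Q = rVof b (vsproj W (v *m P)) by rewrite mul_lin1_mx.
have IQ : I *m Q = 1%:M.
  apply/row_matrixP => i; rewrite !rowE mulmxA mulmx1 vI vQ WP ?subvsP // vsvalK.
  exact: vecofK.
have QI : Q *m I = P.
  by apply/row_matrixP => i; rewrite !rowE mulmxA vQ vI rVofK // vsprojK.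
have NI : N *m I = I *m A.
  apply/row_matrixP => i; rewrite !rowE !mulmxA !vI mul_mxof rVofK //.
have NkI : N ^+ k *m I = I *m A ^+ k.
  elim: k => [|k IH]; first by rewrite !expr0 mulmx1 mul1mx.
  by rewrite !exprSr -mulmxA NI mulmxA IH -mulmxA.
by rewrite -[N ^+ k]mulmx1 -IQ mulmxA NkI mxtrace_mulC !mulmxA QI mxtrace_mulC.
Qed.

End RestrictedTrace.

(** * Extrinsic geometry of the orbit *)

Section Kernels.
Context {F : fieldType}.

Definition mulmx_kernel (n m : nat) (M : 'M[F]_(n, m)) : {vspace 'rV[F]_n} :=
  lker (linfun (mulmxr M : 'rV[F]_n -> 'rV[F]_m)).

Lemma mem_mulmx_kernel n m (M : 'M[F]_(n, m)) u : (u \in mulmx_kernel M) = (u *m M == 0).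
Proof. by rewrite memv_ker lfunE. Qed.

End Kernels.

Section DerivativeHorner.
Context {R : realType} {n : nat}.

Lemma is_derive_exp (V : normedModType R) (Y : V -> 'M[R]_n.+1) (x v : V) dY k :
  is_derive x v Y dY -> is_derive x v (fun t => Y t ^+ k) (expmx_deriv (Y x) dY k).
Proof.
move=> D; elim: k => [|k IH] /=; first exact: is_derive_cst.
have -> : (fun t => Y t ^+ k.+1) = (fun t => Y t ^+ k *m Y t).
  by apply: funext => t; rewrite exprSr.
exact: is_derive_mulmx IH D.
Qed.

Lemma is_derive_horner_mx (V : normedModType R) (Y : V -> 'M[R]_n.+1) (x v : V) dY p :
  is_derive x v Y dY -> is_derive x v (fun t => horner_mx (Y t) p) (hornermx_deriv (Y x) dY p).
Proof.
move=> D; have -> : (fun t => horner_mx (Y t) p) = \sum_(i < size p) (p`_i *: (fun t => Y t ^+ i)).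
  by apply: funext => t; rewrite fct_sumE horner_mx_sum.
apply: is_derive_sum => i; apply: is_deriveZ; exact: is_derive_exp.
Qed.

Lemma smooth_mulmx p q r (F : R -> 'M[R]_(p, q)) (G : R -> 'M[R]_(q, r)) :
  (forall i j, smooth_scalar (fun t => F t i j)) -> (forall i j, smooth_scalar (fun t => G t i j)) ->
  forall i j, smooth_scalar (fun t => (F t *m G t) i j).
Proof.
move=> sF sG i j; under eq_fun do rewrite mxE.
by apply: smooth_sum => k l; apply: n_derivableM; [exact: sF|exact: sG].
Qed.

Lemma smooth_linear_row p q r (L : 'rV[R]_p -> 'M[R]_(q, r)) (c : R -> 'rV[R]_p) :
  linear L -> (forall i, smooth_scalar (fun t => c t 0 i)) ->
  forall i j, smooth_scalar (fun t => L (c t) i j).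
Proof.
move=> linL sc i j.
pose LL : {linear 'rV[R]_p -> 'M[R]_(q, r)} := HB.pack L (GRing.isLinear.Build _ _ _ _ L linL).
have -> : (fun t => L (c t) i j) = (fun t => \sum_k c t 0 k * L (delta_mx 0 k) i j).
  apply: funext => t; rewrite {1}(row_sum_delta (c t)) -[L]/(LL : _ -> _) linear_sum summxE.
  by apply: eq_bigr => k _; rewrite linearZ mxE.
by apply: smooth_sum => k l; apply: n_derivableM; [exact: sc|exact: n_derivable_cst].
Qed.

Lemma smooth_horner_mx (Y : R -> 'M[R]_n.+1) p :
  (forall i j, smooth_scalar (fun t => Y t i j)) ->
  forall i j, smooth_scalar (fun t => horner_mx (Y t) p i j).
Proof.
move=> sY.
have sX k i j : smooth_scalar (fun t => (Y t ^+ k) i j).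
  elim: k i j => [|k IH] i j; first by move=> l; exact: n_derivable_cst.
  have -> : (fun t => (Y t ^+ k.+1) i j) = (fun t => (Y t ^+ k *m Y t) i j).
    by apply: funext => t; rewrite exprSr.
  exact: smooth_mulmx.
move=> i j.
have -> : (fun t => horner_mx (Y t) p i j) = (fun t => \sum_(k < size p) p`_k * (Y t ^+ k) i j).
  by apply: funext => t; rewrite horner_mx_sum summxE; apply: eq_bigr => k _; rewrite mxE.
by apply: smooth_sum => k l; apply: n_derivableM; [exact: n_derivable_cst|exact: sX].
Qed.

End DerivativeHorner.

(** * Tangent spaces, normal spaces and shape operators of the orbit *)

Section OrbitGeometry.
Context {R : realType} {n : nat}.
Local Notation V := 'rV[R]_n.+1.
Variables (ad : V -> 'M[R]_n.+1) (s : 'M[R]_n.+1) (r : R) (S M : set V) (p h : {poly R}).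
Hypothesis Hs : symmetric_algebra ad s.
Local Notation B := (trace_form ad).
Hypothesis r0 : 0 < r.
Hypothesis SE : forall v, S v <-> v *m s = - v /\ B v v = r.
Hypothesis MS : M `<=` S.
Hypothesis subM : submanifold M.
Hypothesis cop_p : coprimep p p^`().
Hypothesis M_p : forall x, M x -> horner_mx (ad x) p = 0.
Hypothesis inv_h : forall x : 'M[R]_n.+1, horner_mx x p = 0 -> group_inverse x (horner_mx x h).
Hypothesis M_path : forall x y, M x -> y *m s = y -> exists z : R -> V,
  [/\ z 0 = x, \forall t \near (0 : R), M (z t) & is_derive (0 : R) (1 : R) z (y *m ad x)].

Local Notation ginv x := (horner_mx (ad x) h).

Let ginvP x : M x -> group_inverse (ad x) (ginv x).
Proof. by move=> /M_p; exact: inv_h. Qed.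

Let ad_linear : linear ad. Proof. by case: Hs. Qed.

Let rn0 : r != 0. Proof. by rewrite gt_eqF. Qed.

Let qB (a b : V) : a *m s = - a -> b *m s = - b -> (a - b) *m s = - (a - b).
Proof. by move=> sa sb; rewrite mulmxBl sa sb opprB opprK addrC. Qed.

Let qZ k (a : V) : a *m s = - a -> (k *: a) *m s = - (k *: a).
Proof. by move=> sa; rewrite -scalemxAl sa scalerN. Qed.

Lemma is_derive_form (c d : R -> V) (t : R) c' d' :
  is_derive t (1 : R) c c' -> is_derive t (1 : R) d d' ->
  is_derive t (1 : R) (fun t => B (c t) (d t)) (B c' (d t) + B (c t) d').
Proof.
move=> Dc Dd.
have [dP EP] := is_derive_mulmx (is_derive_linear_row ad_linear Dc) (is_derive_linear_row ad_linear Dd).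
have -> : (fun t => B (c t) (d t)) = \sum_i (fun t => (ad (c t) *m ad (d t)) i i).
  by apply: funext => u; rewrite fct_sumE.
have -> : B c' (d t) + B (c t) d' = \sum_i (ad c' *m ad (d t) + ad (c t) *m ad d') i i.
  by rewrite /trace_form -mxtraceD.
apply: is_derive_sum => i; rewrite -EP.
by split; [exact: (derivable_mxP _ _ _).1|rewrite derive_mx // mxE].
Qed.

Lemma is_derive_q (c : R -> V) (t : R) c' : (forall t, c t *m s = - c t) ->
  is_derive t (1 : R) c c' -> c' *m s = - c'.
Proof.
move=> cs D.
have lin : linear (fun u : V => u *m s) by move=> a u v; rewrite mulmxDl scalemxAl.
have [_ <-] := is_derive_linear_row lin D.
under eq_fun do rewrite cs.
by have [_ ->] := is_deriveN D.
Qed.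

Lemma sphere_velocity_sub x v (c : R^o -> V) : curve_in S x c -> derive1 c 0 = v ->
  v *m s = - v /\ B v x = 0.
Proof.
move=> [sc Sc c0] cv; have D := smooth_curve_is_derive 0 sc; rewrite cv in D.
split; first by apply: is_derive_q D => t; have /SE[] := Sc t.
have [_ E] := is_derive_form D D.
have C : (fun t : R => B (c t) (c t)) = cst r by apply: funext => t; have /SE[] := Sc t.
move: E; rewrite C derive_cst c0 (trace_formC ad x) => E.
by have : B v x = 0 by lra.
Qed.

Lemma is_derive_slowM K (g : R -> R) : smooth_scalar g ->
  is_derive (0 : R) (1 : R) (fun t => slow K t * g t) (g 0).
Proof.
move=> sg; have [dg _] := sg 1%N.
have [d E] := is_deriveM (is_derive_slow K) (derivableP (dg 0)).
by split=> //; rewrite E slow0 scale0r add0r; exact: mulr1.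
Qed.

(** A rational parametrization of the conic through x in the plane of x and u: with z = [slow K t]
    and D = 1 + k z^2 / 4, the curve is ((1 - k z^2 / 4) x + z u) / D. Unlike trigonometric
    functions it is uniform in the sign of B(u, u). *)
Lemma sphere_velocity_sup x u : S x -> u *m s = - u -> B u x = 0 ->
  exists2 c : R^o -> V, curve_in S x c & derive1 c 0 = u.
Proof.
move=> /SE[xs xx] us ux.
(* k may be negative. The choice of K bounds both z and k z by 1 in absolute value, so that D stays
   positive. *)
pose k := B u u / r; pose K := `|k| + 1; have K0 : 0 < K by rewrite ltr_wpDl.
pose D t := 1 + k * slow K t * slow K t * 4^-1.
have sD : smooth_scalar D.
  move=> l; apply: n_derivableD; first exact: n_derivable_cst.
  apply: n_derivableM; last exact: n_derivable_cst.
  by apply: n_derivableM; [apply: n_derivableM; [exact: n_derivable_cst|]|]; exact: slow_smooth.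
have D0 t : D t != 0.
  have b1 : `|slow K t| <= 1.
    apply: (le_trans (slow_bound t K0)); rewrite invf_le1 // /K; have := normr_ge0 k; lra.
  have b2 : `|k * slow K t| <= 1.
    rewrite normrM (le_trans (ler_wpM2l (normr_ge0 k) (slow_bound t K0))) // ler_pdivrMr // mul1r /K; lra.
  have : `|k * slow K t * slow K t| <= 1 by rewrite normrM mulr_ile1.
  by rewrite ler_norml => /andP[b3 b4]; rewrite gt_eqF // /D; lra.
have sV : smooth_scalar (fun t => (D t)^-1) by move=> l; apply: n_derivableV.
pose a1 t := - (k * slow K t * (2^-1 * (D t)^-1)).
pose b1 t := (D t)^-1.
have sa1 : smooth_scalar a1.
  move=> l; have -> : a1 = (fun t => cst (-1) t * (k * slow K t * (2^-1 * (D t)^-1))).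
    by apply: funext => t; rewrite /cst /= mulN1r.
  apply: n_derivableM; first exact: n_derivable_cst.
  apply: n_derivableM.
    by apply: n_derivableM; [exact: n_derivable_cst|exact: slow_smooth].
  by apply: n_derivableM; [exact: n_derivable_cst|].
pose c (t : R^o) : V := x + (slow K t * a1 t) *: x + (slow K t * b1 t) *: u.
have sc : smooth_curve c.
  apply: entries_smooth_curve => i l.
  have -> : (fun t => c t 0 i) = (fun t => cst (x 0 i) t + slow K t * a1 t * x 0 i + slow K t * b1 t * u 0 i).
    by apply: funext => t; rewrite !mxE.
  apply: n_derivableD; [apply: n_derivableD; first exact: n_derivable_cst|];
   (apply: n_derivableM; last exact: n_derivable_cst); apply: n_derivableM => //; exact: slow_smooth.
exists c; first split=> //.
- move=> t; apply/SE; split.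
    by rewrite /c !mulmxDl -!scalemxAl xs us !scalerN !opprD.
  rewrite /c !(trace_formDl Hs, trace_formDr Hs, trace_formZl Hs, trace_formZr Hs) ux (trace_formC ad x u) ux xx.
  have -> : B u u = k * r by rewrite /k divfK.
  have Dk : k * slow K t * slow K t = 4 * (D t - 1) by rewrite /D; field.
  rewrite /a1 /b1; have := Dk; have := D0 t; set d := D t; set z := slow K t => d0 E.
  transitivity (r * ((1 - (k * z * z) * (2^-1 / d)) ^+ 2 + (k * z * z) / d ^+ 2)); first by field.
  by rewrite E; field.
- by rewrite /c slow0 !mul0r !scale0r !addr0.
rewrite derive1E /c.
have a10 : a1 0 = 0 by rewrite /a1 slow0 mulr0 mul0r oppr0.
have b10 : b1 0 = 1 by rewrite /b1 /D slow0 !(mulr0, mul0r) addr0 invr1.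
have [d1 E1] := is_derive_line x x (is_derive_slowM K sa1).
have [d2 E2] := is_derive_scalel u (is_derive_slowM K sV).
have := deriveD d1 d2; rewrite E1 E2 a10 scale0r add0r.
by rewrite -/(b1 0) b10 scale1r.
Qed.

Definition q_kernel : {vspace V} := mulmx_kernel (s + 1%:M).

Lemma mem_q_kernel u : (u \in q_kernel) = (u *m s == - u).
Proof. by rewrite mem_mulmx_kernel mulmxDr mulmx1 addr_eq0. Qed.

Definition form_col (x : V) : 'cV[R]_n.+1 := \col_i B (delta_mx 0 i) x.

Definition sphere_tangent x : {vspace V} :=
  (q_kernel :&: mulmx_kernel (form_col x))%VS.

Lemma mem_sphere_tangent x u : u \in sphere_tangent x <-> u *m s = - u /\ B u x = 0.
Proof.
have E : u *m form_col x = (B u x)%:M.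
  apply/matrixP => i j; rewrite !ord1 !mxE eqxx mulr1n {2}(row_sum_delta u).
  elim/big_rec2 : _ => [|k a b _ ->]; first by rewrite (trace_form0l Hs).
  by rewrite (trace_formDl Hs) (trace_formZl Hs) mxE.
rewrite memv_cap mem_q_kernel mem_mulmx_kernel E; split.
  by move=> /andP[/eqP -> /eqP/matrixP/(_ 0 0)]; rewrite !mxE eqxx mulr1n.
by move=> [-> ->]; rewrite eqxx /=; apply/eqP/matrixP => i j; rewrite !mxE mul0rn.
Qed.

Lemma tangent_space_sphere x : S x -> tangent_space S x = sphere_tangent x.
Proof.
move=> Sx; apply: set_span_vspace => v; split.
  by move=> [c cS cv]; apply/mem_sphere_tangent; exact: sphere_velocity_sub cS cv.
by move=> /mem_sphere_tangent[vs vx]; exact: sphere_velocity_sup.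
Qed.

Definition orbit_tangent x : {vspace V} := (q_kernel :&: mulmx_kernel (ad x *m ginv x - 1%:M))%VS.

Lemma mem_orbit_tangent x u : u \in orbit_tangent x <-> tangent_vec ad s x (ginv x) u.
Proof.
rewrite memv_cap mem_q_kernel mem_mulmx_kernel mulmxBr mulmx1 subr_eq0; split.
  by move=> /andP[/eqP ? /eqP ?].
by move=> [-> ->]; rewrite !eqxx.
Qed.

(** A velocity v is split into z commuting with x and a bracket with x. Differentiating p(ad c) = 0,
    the bracket contributes nothing and z contributes p'(ad x) ad z; as p is separable, p'(ad x) is
    invertible and z = 0. *)
Lemma orbit_velocity x v : M x ->
  (exists2 c : R^o -> V, curve_in M x c & derive1 c 0 = v) <-> tangent_vec ad s x (ginv x) v.
Proof.
move=> Mx; have /SE[xs xx] := MS Mx; have gx := ginvP Mx; split; last first.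
  move=> /(tangent_vecP Hs xs gx)[y ys ->].
  have [z [z0 Mz dz]] := M_path Mx ys.
  exact: submanifold_velocity subM Mx z0 Mz dz.
move=> [c [sc Mc c0] cv]; have D := smooth_curve_is_derive 0 sc; rewrite cv in D.
have vs : v *m s = - v by apply: is_derive_q D => t; have /SE[] := MS (Mc t).
have [_ E] := is_derive_horner_mx p (is_derive_linear_row ad_linear D).
move: E; have -> : (fun t : R => horner_mx (ad (c t)) p) = cst 0 by apply: funext => t; exact: M_p.
rewrite derive_cst c0 => E.
have [te ze] := tangent_decomp Hs xs gx vs.
set e := ad x *m ginv x in te ze.
have vE : v = (v - v *m e) + (v *m ginv x) *m ad x.
  by rewrite -mulmxA (j_adE gx) subrK.
suff z0 : v - v *m e = 0 by move/eqP: z0; rewrite subr_eq0 => /eqP ->.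
apply: (ad_eq0 Hs).
have cz := commuting Hs ze.
apply: (@separable_deriv_inj _ _ (ad x) p); first by split=> //; exact: M_p.
rewrite -(hornermx_deriv_comm p cz).
have L := @hornermx_deriv_linear _ _ (ad x) p 1 (ad (v - v *m e)) (ad (v *m ginv x *m ad x)).
rewrite !scale1r -(ad_add Hs) -vE -E (ad_ad Hs) (hornermx_deriv_commutator _ (M_p Mx)) addr0 in L.
by rewrite -L.
Qed.

Lemma tangent_space_orbit x : M x -> tangent_space M x = orbit_tangent x.
Proof.
move=> Mx; apply: set_span_vspace => v.
by apply: (iff_trans (orbit_velocity v Mx)); apply: iff_sym; exact: mem_orbit_tangent.
Qed.

Definition normal_vec x xi := [/\ xi *m s = - xi, B xi x = 0 & xi *m ad x = 0].

Lemma normal_spaceP (x xi : V) : M x -> Defs.normal_space B S M x xi <-> normal_vec x xi.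
Proof.
move=> Mx; have /SE[xs xx] := MS Mx; have gx := ginvP Mx.
rewrite /Defs.normal_space /= (tangent_space_sphere (MS Mx)) (tangent_space_orbit Mx).
split.
  move=> [/mem_sphere_tangent[xis xix] H]; split=> //.
  apply/(normal_vecP Hs xs gx xis) => u tu.
  by apply: H; apply/mem_orbit_tangent.
move=> [xis xix H]; split; first by apply/mem_sphere_tangent.
by move=> v /mem_orbit_tangent; exact: (normal_vecP Hs xs gx xis).2.
Qed.

Lemma orth_projE (W : {vspace V}) u w : w \in W -> (forall z, z \in W -> B (u - w) z = 0) ->
  (forall v, v \in W -> (forall z, z \in W -> B v z = 0) -> v = 0) -> orth_proj B W u = w.
Proof.
move=> wW wu nd; rewrite /orth_proj; set Q := [set w | _].
have [Q1 Q2] := @xgetPex _ 0 Q (ex_intro _ w (conj wW wu)).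
apply/eqP; rewrite -subr_eq0; apply/eqP; apply: nd; first exact: memvB.
move=> z zW; have := Q2 z zW; have := wu z zW; rewrite !(trace_formBl Hs) => H1 H2; lra.
Qed.

Lemma mem_tangent_space x u : M x -> u \in tangent_space M x <-> tangent_vec ad s x (ginv x) u.
Proof. by move=> Mx; rewrite tangent_space_orbit //; exact: mem_orbit_tangent. Qed.

(** The fixed vector xi is projected onto the centralizer of c(t), then off c(t). Both projections
    are smooth in t because the group inverse is a polynomial in ad(c(t)) with constant
    coefficients. *)
Lemma normal_extension x (xi : V) (c : R^o -> V) : curve_in M x c -> normal_vec x xi ->
  exists nu : R^o -> V, [/\ smooth_curve nu, forall t, normal_vec (c t) (nu t) & nu 0 = xi].
Proof.
move=> [sc Mc c0] [xis xix xiad].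
have sce := smooth_curve_entries sc.
pose w (t : R^o) := xi - xi *m (ad (c t) *m ginv (c t)).
pose nu (t : R^o) := w t - (B (w t) (c t) / r) *: c t.
have sad := smooth_linear_row ad_linear sce.
have sw i : smooth_scalar (fun t => w t 0 i).
  move=> k; have -> : (fun t => w t 0 i) =
      (fun t => cst (xi 0 i) t + cst (-1) t * (cst xi t *m (ad (c t) *m ginv (c t))) 0 i).
    by apply: funext => t; rewrite /w !mxE /cst mulN1r.
  apply: n_derivableD; first exact: n_derivable_cst.
  apply: n_derivableM; first exact: n_derivable_cst.
  apply: smooth_mulmx => [a b l|]; first exact: n_derivable_cst.
  by apply: smooth_mulmx => //; exact: smooth_horner_mx.
have sB : smooth_scalar (fun t => B (w t) (c t)).
  apply: smooth_sum => i; apply: smooth_mulmx => //; exact: smooth_linear_row.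
exists nu; split.
- apply: entries_smooth_curve => i k.
  have -> : (fun t => nu t 0 i) = (fun t => w t 0 i + cst (- r^-1) t * B (w t) (c t) * c t 0 i).
    by apply: funext => t; rewrite /nu !mxE /cst; ring.
  apply: n_derivableD; first exact: sw.
  by apply: n_derivableM; [apply: n_derivableM; [exact: n_derivable_cst|exact: sB]|exact: sce].
- move=> t; have /SE[cs cc] := MS (Mc t); have gt := ginvP (Mc t).
  have [[ts _] te] := tangent_decomp Hs cs gt xis; rewrite -/(w t) in te.
  have ws : w t *m s = - w t by apply: qB.
  split.
  + by apply: qB ws (qZ _ cs).
  + by rewrite /nu (trace_formBl Hs) (trace_formZl Hs) cc divfK // subrr.
  + by rewrite /nu mulmxBl -scalemxAl te (ad_self Hs) scaler0 subr0.
- by rewrite /nu /w c0 mulmxA xiad mul0mx subr0 xix mul0r scale0r subr0.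
Qed.

Lemma sphere_nondeg x v : S x -> v \in sphere_tangent x ->
  (forall z, z \in sphere_tangent x -> B v z = 0) -> v = 0.
Proof.
move=> /SE[xs xx] /mem_sphere_tangent[vs vx] H; apply: (trace_form_nondeg_q Hs vs) => z zs.
have : B v (z - (B z x / r) *: x) = 0.
  apply: H; apply/mem_sphere_tangent; split; first exact: qB zs (qZ _ xs).
  by rewrite (trace_formBl Hs) (trace_formZl Hs) xx divfK // subrr.
by rewrite trace_formC (trace_formBl Hs) (trace_formZl Hs) (trace_formC ad x) vx mulr0 subr0 trace_formC.
Qed.

Let shape_value x (xi : V) (c nu : R^o -> V) : M x -> normal_vec x xi ->
  curve_in M x c -> smooth_curve nu -> (forall t, Defs.normal_space B S M (c t) (nu t)) -> nu 0 = xi ->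
  orth_proj B (tangent_space M x) (covariant_derivative B S x nu) = derive1 c 0 *m ad xi *m ginv x.
Proof.
move=> Mx [xis xix xiad] cM snu nnu nu0; have [sc Mc c0] := cM.
have /SE[xs xx] := MS Mx; have gx := ginvP Mx.
have nn t : normal_vec (c t) (nu t) by apply/normal_spaceP.
have Dc := smooth_curve_is_derive 0 sc; have Dnu := smooth_curve_is_derive 0 snu.
set c' := derive1 c 0 in Dc *; set nu' := derive1 nu 0 in Dnu.
have nus : nu' *m s = - nu' by apply: is_derive_q Dnu => t; case: (nn t).
have [tc tce] : tangent_vec ad s x (ginv x) c' by apply/orbit_velocity => //; exists c.
have E : nu' *m ad x = c' *m ad xi.
  have [_ E] := is_derive_mulmx Dnu (is_derive_linear_row ad_linear Dc).
  have C : (fun t : R => nu t *m ad (c t)) = cst 0 by apply: funext => t; case: (nn t).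
  move: E; rewrite C derive_cst c0 nu0 => /esym/eqP.
  by rewrite (ad_anti Hs xi c') subr_eq0 => /eqP.
(* Projecting off x to get the covariant derivative in the sphere does not affect the part tangent
   to M, since x commutes with itself. *)
pose w := nu' - (B nu' x / r) *: x.
have ws : w *m s = - w by exact: qB nus (qZ _ xs).
have wx : B w x = 0 by rewrite (trace_formBl Hs) (trace_formZl Hs) xx divfK // subrr.
have -> : covariant_derivative B S x nu = w.
  rewrite /covariant_derivative (tangent_space_sphere (MS Mx)); apply: orth_projE.
  - exact/mem_sphere_tangent.
  - move=> z /mem_sphere_tangent[zs zx].
    by rewrite /w opprB addrC subrK (trace_formZl Hs) (trace_formC ad x) zx mulr0.
  - by move=> v; exact: sphere_nondeg (MS Mx).
have we : w *m (ad x *m ginv x) = c' *m ad xi *m ginv x.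
  by rewrite /w mulmxBl -scalemxAl !mulmxA (ad_self Hs) mul0mx scaler0 subr0 E.
have [tw tw0] := tangent_decomp Hs xs gx ws.
rewrite -we; apply: orth_projE.
- exact/mem_tangent_space.
- move=> z /(mem_tangent_space _ Mx) tz.
  apply: (normal_vecP Hs xs gx _).2 tz => //.
  by have [ts _] := tw; exact: qB.
- move=> v /(mem_tangent_space _ Mx) tv H; apply: (tangent_nondeg Hs xs gx tv) => z tz.
  by apply: H; apply/mem_tangent_space.
Qed.

(** The operator is selected by [xget], so an operator with Weingarten's property must be exhibited,
    and any such operator must be determined: every tangent vector is a velocity, and xi extends to
    a normal field along the corresponding curve. *)
Lemma shape_operatorE x (xi : V) (u : subvs_of (tangent_space M x)) : M x -> normal_vec x xi ->
  vsval (shape_operator B S M x xi u) = - (vsval u *m ad xi *m ginv x).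
Proof.
move=> Mx nxi; have [xis xix xiad] := nxi.
have /SE[xs xx] := MS Mx; have gx := ginvP Mx.
pose T := tangent_space M x.
pose f (u : subvs_of T) : subvs_of T := vsproj T (- (vsval u *m ad xi *m ginv x)).
have linf : linear f.
  move=> a v w; rewrite /f -linearP; congr (vsproj T _).
  by rewrite linearP /= !mulmxDl -!scalemxAl opprD scalerN.
pose fl : {linear subvs_of T -> subvs_of T} := HB.pack f (GRing.isLinear.Build _ _ _ _ f linf).
pose A0 : 'End(subvs_of T) := linfun fl.
have A0E v : vsval (A0 v) = - (vsval v *m ad xi *m ginv x).
  rewrite lfunE /= /f vsprojK // memvN; apply/mem_tangent_space => //.
  have [vs ve] : tangent_vec ad s x (ginv x) (vsval v) by apply/mem_tangent_space => //; exact: subvsP.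
  split; last by rewrite -(mulmxA _ (ginv x)) (j_eE gx).
  have sxi := swap_ad Hs xis; have sj := swap_ginv Hs xs gx.
  by rewrite -(mulmxA _ (ginv x) s) sj mulmxN (mulmxA _ s (ginv x)) -(mulmxA _ (ad xi) s) sxi mulmxN (mulmxA _ s (ad xi)) vs !mulNmx opprK.
rewrite /shape_operator; set Q := [set A : 'End(subvs_of T) | _].
have QA0 : Q A0.
  move=> c nu cM snu nnu nu0; rewrite A0E (shape_value Mx nxi cM snu nnu nu0) vsprojK //.
  by apply/mem_tangent_space => //; apply/orbit_velocity => //; exists c.
have QA := @xgetPex _ 0 Q (ex_intro _ A0 QA0).
have : tangent_vec ad s x (ginv x) (vsval u) by apply/mem_tangent_space => //; exact: subvsP.
move=> /(orbit_velocity _ Mx)[c cM cu].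
have [nu [snu nnu nu0]] := normal_extension cM nxi.
have nnu' t : Defs.normal_space B S M (c t) (nu t).
  by apply/normal_spaceP; [case: cM|exact: nnu].
have := QA c nu cM snu nnu' nu0; rewrite cu vsvalK => ->.
by rewrite (shape_value Mx nxi cM snu nnu' nu0) cu.
Qed.

(* [ad x] commutes with [ad xi *m j] and anticommutes with [s]; hence the
   trace over the tangent space is half the full trace. *)
Lemma mxtrace_shape_operator x (xi : V) k : M x -> normal_vec x xi -> odd k ->
  \tr (mxof (vbasis fullv) (vbasis fullv) (shape_operator B S M x xi) ^+ k) =
    - (2^-1 * \tr ((ad xi *m ginv x) ^+ k)).
Proof.
move=> Mx nxi ko; have [xis xix xiad] := nxi.
have /SE[xs xx] := MS Mx; have gx := ginvP Mx.
set j := ginv x in gx *; set e := ad x *m j.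
have es : e *m s = s *m e := e_s Hs xs gx.
(* Projection onto the (-1)-eigenspace of s in the image of [e]. *)
pose P := 2^-1 *: (e - e *m s).
have PW v : v *m P \in tangent_space M x.
  apply/mem_tangent_space => //; split.
    rewrite -scalemxAr -scalemxAl mulmxBr mulmxBl !mulmxA -(mulmxA _ s s) (s_involutive Hs) mulmx1.
    by rewrite -scalerN opprB.
  have PE : P *m e = P.
    rewrite /P -scalemxAl mulmxBl (e_idem gx); congr (_ *: (_ - _)).
    by rewrite -(mulmxA e) -es (mulmxA e) (e_idem gx).
  by rewrite -/j -/e -mulmxA PE.
have WP u : u \in tangent_space M x -> u *m P = u.
  move=> /(mem_tangent_space _ Mx)[us ue].
  rewrite -/j -/e in ue; rewrite /P -scalemxAr mulmxBr (mulmxA u e s) ue us opprK.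
  by apply/rowP => i; rewrite !mxE; lra.
have fA u : vsval (shape_operator B S M x xi u) = vsval u *m (- (ad xi *m j)).
  by rewrite shape_operatorE // mulmxN mulmxA.
rewrite (mxtrace_restrict k fA PW WP).
set A := ad xi *m j.
have -> : (- A) ^+ k = - A ^+ k by rewrite exprNn -signr_odd ko expr1 mulN1r.
have c1 : ad xi *m ad x = ad x *m ad xi := commuting Hs xiad.
have Ax : A *m ad x = ad x *m A.
  by rewrite /A -mulmxA (j_adE gx) -/e /e mulmxA c1 mulmxA.
have Axk : A ^+ k *m ad x = ad x *m A ^+ k.
  by have : GRing.comm (ad x) (A ^+ k) by apply: commrX; exact/esym.
(* This would fail for k = 0, which oddness excludes. *)
have Ae : A ^+ k *m e = A ^+ k.
  case: k ko {Axk} => // k _; rewrite exprSr -mulmxE -mulmxA; congr (_ *m _).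
  by rewrite /A -mulmxA (j_eE gx).
(* Write e = j ad x and move ad x cyclically around the trace: it passes s with a sign and A^k
   without one. *)
have As : \tr (A ^+ k *m s) = 0.
  have E : \tr (A ^+ k *m s) = - \tr (A ^+ k *m s).
    rewrite -{1}Ae /e -(j_adE gx) !mulmxA -(mulmxA _ (ad x)) (swap_ad Hs xs).
    rewrite mulmxN mulmxA linearN /=; congr (- _).
    rewrite mxtrace_mulC !mulmxA -Axk -(mulmxA _ (ad x)) -/e.
    by rewrite Ae.
  lra.
rewrite mulNmx raddfN /=; congr (- _).
by rewrite /P -scalemxAr mxtraceZ mulmxBr (mulmxA _ e s) Ae raddfB /= As subr0.
Qed.

Lemma austere_trace : austere B S M <-> forall x xi, M x -> normal_vec x xi ->
  forall k, odd k -> \tr ((ad xi *m ginv x) ^+ k) = 0.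
Proof.
have E x (xi : V) : M x -> normal_vec x xi ->
  ((let p := end_char_poly (shape_operator B S M x xi) in
    let d := (\dim (tangent_space M x)) in
    forall k, odd k -> (k <= d)%N -> p`_(d - k) = 0) <->
  forall k, odd k -> \tr ((ad xi *m ginv x) ^+ k) = 0).
  move=> Mx nxi; rewrite /= /end_char_poly -(dim_subvsT (tangent_space M x)).
  apply: (iff_trans (odd_coefs_trace _)); split=> H k ko; have := H k ko.
    rewrite (mxtrace_shape_operator Mx nxi ko) => /eqP.
    by rewrite oppr_eq0 mulf_eq0 invr_eq0 pnatr_eq0 /= => /eqP.
  by rewrite (mxtrace_shape_operator Mx nxi ko) => ->; rewrite mulr0 oppr0.
split=> H x xi Mx nxi; first by apply/E => //; apply: H => //; apply/normal_spaceP.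
by apply/E => //; [exact/normal_spaceP|apply: H => //; exact/normal_spaceP].
Qed.

End OrbitGeometry.

(** * Weights of a Cartan subspace *)

Lemma avoid_roots (C : numFieldType) (p : {poly C}) : p != 0 -> exists k : nat, p.[k%:R] != 0.
Proof.
move=> p0; apply: contrapT => H.
pose rs := [seq (k%:R : C) | k <- iota 0 (size p)].
have : p == 0.
  apply/eqP/(@roots_geq_poly_eq0 _ p rs); last by rewrite size_map size_iota.
    apply/allP => _ /mapP[k _ ->]; apply/negPn/negP => pk.
    by apply: H; exists k.
  by rewrite map_inj_uniq ?iota_uniq // => i j /eqP; rewrite eqr_nat => /eqP.
by rewrite (negbTE p0).
Qed.

Section Avoidance.
Context {R : rcfType} {V : lmodType R}.

(** Finitely many proper real subspaces do not cover W. The forms are complex valued but real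
    linear; along [k w' + w] each gives a nonzero polynomial in k, and some natural k avoids all
    their roots. *)
Lemma avoid_kernels (I : finType) (Q : pred I) (f : I -> V -> R[i]) (W : set V) :
  W 0 -> (forall k u v, W u -> W v -> W (k *: u + v)) ->
  (forall i k u v, f i (k *: u + v) = (k%:C)%C * f i u + f i v) ->
  (forall i, Q i -> exists2 w, W w & f i w != 0) ->
  exists2 w, W w & forall i, Q i -> f i w != 0.
Proof.
move=> W0 WD fD H.
suff [w Ww wI] : exists2 w, W w & forall i, i \in enum I -> Q i -> f i w != 0.
  by exists w => // i; apply: wI; rewrite mem_enum.
elim: (enum I) => [|i0 l [w Ww wl]]; first by exists 0.
have [q0|nq0] := boolP (Q i0); last first.
  exists w => // i; rewrite inE => /predU1P[->|]; first by rewrite (negbTE nq0).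
  exact: wl.
have [w' Ww' w'0] := H i0 q0.
pose fac i : {poly R[i]} := (f i w')%:P * 'X + (f i w)%:P.
have fac0 i : (f i w' != 0) || (f i w != 0) -> fac i != 0.
  move=> h; apply/eqP => /polyP E; have := E 0%N; have := E 1%N.
  rewrite !coefD !coefMX !coefC /= addr0 add0r => E1 E0.
  by move: h; rewrite E1 E0 eqxx.
have [|k] := @avoid_roots _ (fac i0 * \prod_(i <- l | Q i) fac i) _.
  by rewrite mulf_neq0 ?fac0 ?w'0 // prodf_seq_neq0; apply/allP => i il; apply/implyP => qi;
    rewrite fac0 // (wl i) ?orbT.
have facE i : (fac i).[k%:R] = f i (k%:R *: w' + w).
  by rewrite fD !hornerE rmorph_nat mulrC.
rewrite hornerM mulf_eq0 negb_or horner_prod => /andP[k0 kl].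
exists (k%:R *: w' + w); first exact: WD.
move=> i; rewrite inE -facE => /predU1P[->//|il qi].
by move: kl; rewrite prodf_seq_neq0 => /allP/(_ i il)/implyP/(_ qi).
Qed.

End Avoidance.

Section SemisimpleElement.
Context {R : rcfType} {n : nat}.

(** The minimal polynomial does not change under field extension; over the complex numbers it
    divides a product of distinct linear factors, and separability descends. *)
Lemma diagonalizable_separable (x : 'M[R]_n.+1) :
  diagonalizable (map_mx (real_complex R) x) ->
  exists p : {poly R}, coprimep p p^`() /\ horner_mx x p = 0.
Proof.
move=> /diagonalizableP[rs urs]; rewrite mxminpoly_map => H.
exists (mxminpoly x); split; last exact: mx_root_minpoly.
have : separable.separable_poly (\prod_(z <- rs) ('X - z%:P)).
  by rewrite separable.separable_prod_XsubC.
move=> /(separable.dvdp_separable H).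
by rewrite separable.separable_map separable.separable_poly.unlock.
Qed.

End SemisimpleElement.

(** Maximality is expressed by the third clause: [a] contains its centralizer in q. *)
Definition cartan (R : realType) n (ad : 'rV[R]_n -> 'M[R]_n) (s : 'M[R]_n) (a : {vspace 'rV[R]_n}) :=
  [/\ forall u, u \in a -> u *m s = - u,
      forall u v, u \in a -> v \in a -> v *m ad u = 0,
      forall xi : 'rV[R]_n, xi *m s = - xi -> (forall u, u \in a -> xi *m ad u = 0) -> xi \in a &
      forall u, u \in a -> diagonalizable (map_mx (real_complex R) (ad u))].

Section Weights.
Context {R : realType} {n : nat}.
Local Notation V := 'rV[R]_n.+1.
Local Notation C := R[i].
Variables (ad : V -> 'M[R]_n.+1) (s : 'M[R]_n.+1) (a : {vspace V}).
Hypothesis Hs : symmetric_algebra ad s.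
Hypothesis Ha : cartan ad s a.
Local Notation B := (trace_form ad).
Local Notation adC u := (map_mx (real_complex R) (ad u)).

Lemma cartan_q u : u \in a -> u *m s = - u. Proof. by case: Ha => + _ _ _; apply. Qed.
Lemma cartan_abelian u v : u \in a -> v \in a -> v *m ad u = 0.
Proof. by case: Ha => _ + _ _; apply. Qed.

Let ad_linear : linear ad. Proof. by case: Hs. Qed.

Lemma adC_linear k u v : adC (k *: u + v) = (k%:C)%C *: adC u + adC v.
Proof. by rewrite ad_linear map_mxD map_mxZ. Qed.

Lemma adC_sum (I : Type) (l : seq I) (k : I -> R) (u : I -> V) :
  adC (\sum_(i <- l) k i *: u i) = \sum_(i <- l) ((k i)%:C)%C *: adC (u i).
Proof.
elim: l => [|i l IH]; first by rewrite !big_nil (ad_zero Hs) map_mx0.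
by rewrite !big_cons adC_linear IH.
Qed.

Lemma cartan_codiagonalizable : exists2 P : 'M[C]_n.+1, P \in unitmx &
  forall u, u \in a -> is_diag_mx (P *m adC u *m invmx P).
Proof.
have [_ abel _ diag] := Ha.
have [|P Pu /allP HP] := (codiagonalizableP [seq adC b | b <- vbasis a]).1.
  split=> [_ _ /mapP[b ba ->] /mapP[c ca ->]|_ /mapP[b ba ->]]; last exact/diag/vbasis_mem.
  rewrite /comm_mx -!map_mxM; congr (map_mx _ _).
  apply/eqP; rewrite -subr_eq0 -(ad_ad Hs) abel ?(ad_zero Hs) //; exact: vbasis_mem.
exists P => // u ua; rewrite (coord_vbasis ua) adC_sum mulmx_sumr mulmx_suml.
apply/is_diag_mxP => i j ij; rewrite summxE big1 // => k _.
rewrite -scalemxAr -scalemxAl mxE.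
have : adC (vbasis a)`_k \in [seq adC b | b <- vbasis a].
  by apply/mapP; exists (vbasis a)`_k; rewrite ?mem_nth ?size_tuple.
by move=> /HP; rewrite /= /similar_to conjumx // => /is_diag_mxP ->; rewrite ?mulr0.
Qed.

Variable P : 'M[C]_n.+1.
Hypothesis Pu : P \in unitmx.
Hypothesis diagP : forall u, u \in a -> is_diag_mx (P *m adC u *m invmx P).

(** The rows of P are weight vectors of [a] in the complexified Lie algebra; entry m is the weight
    of row m evaluated at u, so repetition of a weight encodes its multiplicity. *)
Definition weight (u : V) : 'rV[C]_n.+1 := \row_m (P *m adC u *m invmx P) m m.

Lemma weight_entry u m : weight u 0 m = (P *m adC u *m invmx P) m m.
Proof. exact: mxE. Qed.

Lemma weight_linear k u v m : weight (k *: u + v) 0 m = (k%:C)%C * weight u 0 m + weight v 0 m.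
Proof.
rewrite (weight_entry (_ + _)) (weight_entry u) (weight_entry v) adC_linear mulmxDr mulmxDl -scalemxAr -scalemxAl.
by rewrite mxE; congr (_ + _); rewrite mxE.
Qed.

Lemma weightE u : u \in a -> P *m adC u = diag_mx (weight u) *m P.
Proof.
move=> ua; rewrite -[LHS](mulmxKV Pu); congr (_ *m _).
apply/matrixP => i j; rewrite [RHS]mxE; have [->|ij] := eqVneq i j; first by rewrite mulr1n weight_entry.
by rewrite (is_diag_mxP (diagP ua)) ?mulr0n.
Qed.

Lemma cartan_separable u : u \in a ->
  exists p : {poly R}, coprimep p p^`() /\ horner_mx (ad u) p = 0.
Proof. by move=> ua; apply: diagonalizable_separable; case: Ha => _ _ _; apply. Qed.

Lemma cartan_group_inverse u : u \in a -> exists j, group_inverse (ad u) j.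
Proof.
move=> /cartan_separable[p [cp pu]]; have [h Hh] := @separable_group_inverse _ n _ cp.
by exists (horner_mx (ad u) h); exact: Hh.
Qed.

(* Here [0^-1 = 0], which is what the group inverse of a diagonal matrix requires. *)
Lemma weight_group_inverse u j : u \in a -> group_inverse (ad u) j ->
  P *m map_mx (real_complex R) j = diag_mx (map_mx GRing.inv (weight u)) *m P.
Proof.
move=> ua [c1 x1 j1].
have gj : group_inverse (adC u) (map_mx (real_complex R) j).
  by split; rewrite -!map_mxM ?x1 ?j1 ?c1.
have gd : group_inverse (diag_mx (weight u)) (diag_mx (map_mx GRing.inv (weight u))).
  move: (weight u) => w.
  split; rewrite !mulmx_diag; congr diag_mx; apply/rowP => i; rewrite !mxE.
  - by rewrite mulrC.
  - by have [->|z] := eqVneq (w 0 i) 0; rewrite ?mul0r // mulfV ?mul1r.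
  - by have [->|z] := eqVneq (w 0 i) 0; rewrite ?invr0 ?mul0r // mulVf ?mul1r.
have gP := group_inverse_conj (mulmxV Pu) gd.
have E : invmx P *m diag_mx (weight u) *m P = adC u.
  by rewrite -mulmxA -weightE // mulmxA mulVmx // mul1mx.
rewrite E in gP; rewrite (group_inverse_unique gj gP) -(mulmxA _ _ P).
by rewrite mulKVmx.
Qed.

Lemma trace_weights X xi j k : X \in a -> xi \in a -> group_inverse (ad X) j ->
  (\tr ((ad xi *m j) ^+ k))%:C%C = \sum_m (weight xi 0 m / weight X 0 m) ^+ k.
Proof.
move=> Xa xia gj; pose D := diag_mx (\row_m (weight xi 0 m / weight X 0 m)).
have E : P *m map_mx (real_complex R) (ad xi *m j) = D *m P.
  rewrite map_mxM mulmxA weightE // -mulmxA (weight_group_inverse Xa gj) mulmxA mulmx_diag.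
  by congr (diag_mx _ *m _); apply/rowP => i; move: (weight _) (weight _) => w w'; rewrite !mxE.
have -> : (\tr ((ad xi *m j) ^+ k))%:C%C = \tr (map_mx (real_complex R) (ad xi *m j) ^+ k).
  by rewrite -rmorphXn /mxtrace rmorph_sum; apply: eq_bigr => i _; rewrite mxE.
rewrite (mxtrace_exp_similar k Pu E) /mxtrace; apply: eq_bigr => i _.
have [_ ->] := trig_exp k (diag_mx_is_trig (\row_m (weight xi 0 m / weight X 0 m))).
by move: (weight _) (weight _) => w w'; rewrite !mxE eqxx mulr1n.
Qed.

(** A component of xi along a row of P survives only if its weight vanishes at X and at A, hence on
    all of [a]. So xi centralizes [a] and maximality applies. *)
Lemma cartan_centralizer X A (xi : V) : X \in a -> A \in a ->
  (forall m, weight X 0 m = 0 -> weight A 0 m = 0 -> forall u, u \in a -> weight u 0 m = 0) ->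
  xi *m s = - xi -> xi *m ad X = 0 -> xi *m ad A = 0 -> xi \in a.
Proof.
move=> Xa Aa H xis xiX xiA; have [_ _ + _] := Ha; apply=> // u ua.
pose y := map_mx (real_complex R) xi *m invmx P.
have yE v : v \in a -> map_mx (real_complex R) (xi *m ad v) = y *m diag_mx (weight v) *m P.
  by move=> va; rewrite map_mxM -[in RHS]mulmxA -weightE // /y mulmxA mulmxKV.
have y0 v m : v \in a -> xi *m ad v = 0 -> y 0 m * weight v 0 m = 0.
  move=> va v0; have := yE v va; rewrite v0 map_mx0 => /(congr1 (mulmx^~ (invmx P))).
  rewrite mul0mx mulmxK // => /rowP/(_ m); rewrite mxE => /esym.
  by rewrite mul_mx_diag !mxE.
have : map_mx (real_complex R) (xi *m ad u) = 0.
  rewrite yE //; have -> : y *m diag_mx (weight u) = 0; last by rewrite mul0mx.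
  apply/rowP => m; rewrite mul_mx_diag [RHS]mxE mxE.
  have [->|ym] := eqVneq (y 0 m) 0; first by rewrite mul0r.
  have w0 v : v \in a -> xi *m ad v = 0 -> weight v 0 m = 0.
    by move=> va /(y0 v m va)/eqP; rewrite mulf_eq0 (negbTE ym) => /eqP.
  by rewrite (H m) ?mulr0 // w0.
by move=> /eqP; rewrite map_mx_eq0 => /eqP.
Qed.

Lemma cartan_split A (v : V) j : A \in a -> group_inverse (ad A) j -> v *m s = - v ->
  let Y := - (v *m j) in let w := v - A *m ad Y in
  [/\ Y *m s = Y, w *m s = - w & w *m ad A = 0].
Proof.
move=> Aa gA vs Y w; have As := cartan_q Aa.
have E : A *m ad Y = v *m (ad A *m j).
  by rewrite (ad_anti Hs) /Y mulNmx opprK -mulmxA (j_adE gA).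
have [[ts _] tA] := tangent_decomp Hs As gA vs.
split; last by rewrite /w E.
  by rewrite /Y mulNmx -mulmxA (swap_ginv Hs As gA) mulmxN mulmxA vs mulNmx opprK.
by rewrite /w E mulmxBl vs ts opprB opprK addrC.
Qed.

Lemma cartan_regular : exists2 A, A \in a &
  forall m, weight A 0 m = 0 -> forall u, u \in a -> weight u 0 m = 0.
Proof.
have [||i k u v|i|A Aa H] := @avoid_kernels R V 'I_n.+1
  (fun m => `[< exists2 u, u \in a & weight u 0 m != 0 >]) (fun m u => weight u 0 m) [set` a].
- exact: mem0v.
- by move=> k u v ua va; exact: memvD (memvZ _ ua) va.
- exact: weight_linear.
- by move=> /asboolP.
exists A; first exact: Aa.
move=> m Am u ua; apply/eqP/negPn/negP => um.
have /H : `[< exists2 u, u \in a & weight u 0 m != 0 >] by apply/asboolP; exists u.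
by rewrite Am eqxx.
Qed.

(** For a regular A, q is the sum of [a] and [h, A], and the latter is orthogonal to [a] by
    invariance of the form; nondegeneracy on q thus passes to [a]. *)
Lemma cartan_nondeg u : u \in a -> (forall v, v \in a -> B u v = 0) -> u = 0.
Proof.
move=> ua H; have [A Aa reg] := cartan_regular; have [j gA] := cartan_group_inverse Aa.
apply: (trace_form_nondeg_q Hs (cartan_q ua)) => v vs.
have [Ys ws wA] := cartan_split Aa gA vs.
set Y := - (v *m j) in Ys ws wA; set w := v - A *m ad Y in ws wA.
have wa : w \in a by apply: (cartan_centralizer Aa Aa _ ws wA wA) => m /reg.
have -> : v = w + A *m ad Y by rewrite /w subrK.
rewrite (trace_formDr Hs) H // add0r (ad_anti Hs) (trace_formNr Hs).
rewrite (trace_formC ad) (trace_form_ad Hs) (cartan_abelian Aa ua).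
by rewrite (trace_form0r Hs) !oppr0.
Qed.

End Weights.

(** * Polynomial invariants *)

(** Locked so that rewriting treats the derivative as opaque instead of unfolding a limit. *)
HB.lock Definition dder (R : realType) n (v : 'rV[R]_n) (f : 'rV[R]_n -> R) (x : 'rV[R]_n) : R :=
  'D_v f x.

Section PolynomialFunctions.
Context {R : realType} {n : nat}.
Local Notation V := 'rV[R]_n.
Implicit Types (f g : V -> R) (u v w x : V).

(** An inductive predicate lets facts such as the commutation of derivatives be proved by induction
    on the expression. *)
Inductive polyfun : (V -> R) -> Prop :=
| polyfun_cst c : polyfun (cst c)
| polyfun_coord i : polyfun (fun x => x 0 i)
| polyfunD f g : polyfun f -> polyfun g -> polyfun (fun x => f x + g x)
| polyfunM f g : polyfun f -> polyfun g -> polyfun (fun x => f x * g x).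

Lemma polyfun_sum (I : Type) (r : seq I) (f : I -> V -> R) :
  (forall i, polyfun (f i)) -> polyfun (fun x => \sum_(i <- r) f i x).
Proof.
move=> H; elim: r => [|i r IH].
  by under eq_fun do rewrite big_nil; exact: polyfun_cst.
by under eq_fun do rewrite big_cons; exact: polyfunD.
Qed.

Lemma is_derive_coord x v i : is_derive x v (fun y : V => y 0 i) (v 0 i).
Proof.
have [dP E] := is_derive_id x v.
by split; [exact: (derivable_mxP _ _ _).1|rewrite -[in RHS]E derive_mx // mxE].
Qed.

Lemma is_derive_fD f g x v df dg : is_derive x v f df -> is_derive x v g dg ->
  is_derive x v (fun y => f y + g y) (df + dg).
Proof. by move=> Df Dg; exact: is_deriveD. Qed.

Lemma is_derive_fM f g x v df dg : is_derive x v f df -> is_derive x v g dg ->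
  is_derive x v (fun y => f y * g y) (df * g x + f x * dg).
Proof.
move=> Df Dg; have := is_deriveM Df Dg.
suff -> : f x *: dg + g x *: df = df * g x + f x * dg by [].
by rewrite addrC; congr (_ + _); exact: mulrC.
Qed.

Lemma dderE f x v df : is_derive x v f df -> dder v f x = df.
Proof. by rewrite dder.unlock; case. Qed.

Lemma polyfun_is_derive f x v : polyfun f -> is_derive x v f (dder v f x).
Proof.
elim=> {f} [c|i|f g _ IHf _ IHg|f g _ IHf _ IHg].
- by have D := is_derive_cst c x v; rewrite (dderE D).
- by have D := is_derive_coord x v i; rewrite (dderE D).
- by have D := is_derive_fD IHf IHg; rewrite (dderE D).
- by have D := is_derive_fM IHf IHg; rewrite (dderE D).
Qed.

Lemma deriveD_fun f g v : polyfun f -> polyfun g ->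
  dder v (fun y => f y + g y) = (fun x => dder v f x + dder v g x).
Proof.
move=> pf pg; apply: funext => x.
exact: (dderE (is_derive_fD (polyfun_is_derive x v pf) (polyfun_is_derive x v pg))).
Qed.

Lemma deriveM_fun f g v : polyfun f -> polyfun g ->
  dder v (fun y => f y * g y) = (fun x => dder v f x * g x + f x * dder v g x).
Proof.
move=> pf pg; apply: funext => x.
exact: (dderE (is_derive_fM (polyfun_is_derive x v pf) (polyfun_is_derive x v pg))).
Qed.

Lemma derive_cst_fun (c : R) v : dder v (cst c) = cst 0.
Proof. by apply: funext => x; exact: (dderE (is_derive_cst c x v)). Qed.

Lemma derive_coord_fun v i : dder v (fun y : V => y 0 i) = cst (v 0 i).
Proof. by apply: funext => x; exact: (dderE (is_derive_coord x v i)). Qed.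

Lemma polyfun_derive f v : polyfun f -> polyfun (dder v f).
Proof.
elim=> {f} [c|i|f g pf IHf pg IHg|f g pf IHf pg IHg].
- by rewrite derive_cst_fun; exact: polyfun_cst.
- by rewrite derive_coord_fun; exact: polyfun_cst.
- by rewrite deriveD_fun //; exact: polyfunD.
- by rewrite deriveM_fun //; apply: polyfunD; exact: polyfunM.
Qed.

Lemma derive_dirE f x v : polyfun f -> dder v f x = \sum_i v 0 i * dder (delta_mx 0 i) f x.
Proof.
elim=> {f} [c|i|f g pf IHf pg IHg|f g pf IHf pg IHg].
- by rewrite derive_cst_fun big1 // => i _; rewrite derive_cst_fun /cst mulr0.
- rewrite derive_coord_fun /cst (bigD1 i) //= big1 ?addr0.
    by rewrite derive_coord_fun /cst mxE !eqxx mulr1.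
  by move=> j ji; rewrite derive_coord_fun /cst mxE eq_sym (negbTE ji) andbF mulr0.
- rewrite deriveD_fun // IHf IHg -big_split; apply: eq_bigr => i _.
  by rewrite deriveD_fun // mulrDr.
- rewrite deriveM_fun // IHf IHg mulr_suml mulr_sumr -big_split; apply: eq_bigr => i _ /=.
  by rewrite deriveM_fun //; ring.
Qed.

Lemma derive_comm f v w : polyfun f -> dder v (dder w f) = dder w (dder v f).
Proof.
elim=> {f} [c|i|f g pf IHf pg IHg|f g pf IHf pg IHg].
- by rewrite !derive_cst_fun.
- by rewrite !derive_coord_fun !derive_cst_fun.
- have pd u := polyfun_derive u pf; have pd' u := polyfun_derive u pg.
  rewrite (deriveD_fun w pf pg) (deriveD_fun v pf pg).
  by rewrite (deriveD_fun v (pd w) (pd' w)) (deriveD_fun w (pd v) (pd' v)) IHf IHg.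
- have pd u := polyfun_derive u pf; have pd' u := polyfun_derive u pg.
  rewrite (deriveM_fun w pf pg) (deriveM_fun v pf pg).
  rewrite (deriveD_fun v (polyfunM (pd w) pg) (polyfunM pf (pd' w))).
  rewrite (deriveD_fun w (polyfunM (pd v) pg) (polyfunM pf (pd' v))).
  rewrite (deriveM_fun v (pd w) pg) (deriveM_fun w (pd v) pg).
  rewrite (deriveM_fun v pf (pd' w)) (deriveM_fun w pf (pd' v)) IHf IHg.
  by apply: funext => x; ring.
Qed.

Lemma derive_dir_linear f x k u v : polyfun f -> dder (k *: u + v) f x = k * dder u f x + dder v f x.
Proof.
move=> pf; rewrite !(derive_dirE _ _ pf) mulr_sumr -big_split; apply: eq_bigr => i _ /=.
by rewrite !mxE; ring.
Qed.

(** Derivative along the linear vector field x -> x L; for L = ad Y it is the infinitesimal action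
    of Y on functions. *)
Definition vf_derive (L : 'M[R]_n) f x : R := dder (x *m L) f x.

Lemma derive_vf f L v : polyfun f ->
  dder v (vf_derive L f) = (fun x => dder (v *m L) f x + vf_derive L (dder v f) x).
Proof.
move=> pf; apply: funext => x.
have -> : vf_derive L f = \sum_i (fun y => (y *m L) 0 i * dder (delta_mx 0 i) f y).
  by apply: funext => y; rewrite /vf_derive derive_dirE // fct_sumE.
have lc i : is_derive x v (fun y : V => (y *m L) 0 i) ((v *m L) 0 i).
  have lin : linear (fun u : V => u *m L) by move=> a u w; rewrite mulmxDl scalemxAl.
  have [dP E] := is_derive_linear_row lin (is_derive_id x v).
  by split; [exact: (derivable_mxP _ _ _).1|rewrite -E derive_mx // mxE].
rewrite (dderE (is_derive_sum (fun i => is_derive_fM (lc i)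
  (polyfun_is_derive x v (polyfun_derive (delta_mx 0 i) pf))))).
rewrite big_split /= -derive_dirE // /vf_derive (derive_dirE _ _ (polyfun_derive v pf)).
by congr (_ + _); apply: eq_bigr => i _; rewrite (derive_comm v _ pf).
Qed.

Lemma polyfun_line f x v : polyfun f -> exists p : {poly R},
  forall t, f (x + t *: v) = p.[t] /\ dder v f (x + t *: v) = p^`().[t].
Proof.
elim=> {f} [c|i|f g pf [p Hp] pg [q Hq]|f g pf [p Hp] pg [q Hq]].
- by exists c%:P => t; rewrite derive_cst_fun derivC !hornerE.
- exists ((x 0 i)%:P + (v 0 i) *: 'X) => t; rewrite derive_coord_fun !mxE.
  by rewrite derivD derivC derivZ derivX !hornerE /= /cst (mulrC t).
- exists (p + q) => t; rewrite deriveD_fun // derivD !hornerD.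
  by have [-> ->] := Hp t; have [-> ->] := Hq t.
- exists (p * q) => t; rewrite deriveM_fun // derivM hornerD !hornerM.
  by have [-> ->] := Hp t; have [-> ->] := Hq t.
Qed.

Lemma poly_eq_nat (p q : {poly R}) : (forall k : nat, p.[k%:R] = q.[k%:R]) -> p = q.
Proof.
move=> H; apply/eqP; rewrite -subr_eq0; apply/negPn/negP => /avoid_roots[k].
by rewrite hornerD hornerN H subrr eqxx.
Qed.

(** Along the line through x in the direction v, f is a one-variable polynomial, whose coefficients
    are its iterated derivatives at 0 up to factorials. *)
Lemma taylor_vanish f x v : polyfun f -> (forall m, iter m (dder v) f x = 0) -> f (x + v) = 0.
Proof.
move=> pf H; have [p Hp] := polyfun_line x v pf.
have D m : polyfun (iter m (dder v) f) /\
    forall t, iter m (dder v) f (x + t *: v) = p^`(m).[t].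
  elim: m => [|m [pm Hm]]; first by split=> // t; case: (Hp t).
  split=> [|t]; first exact: polyfun_derive.
  have [q Hq] := polyfun_line x v pm.
  have -> : p^`(m.+1) = q^`().
    by rewrite derivnS; congr deriv; apply: poly_eq_nat => k; rewrite -Hm; case: (Hq k%:R).
  by case: (Hq t).
have p0 : p = 0.
  apply/polyP => m; have [_ /(_ 0)] := D m; rewrite scale0r addr0 H horner_coef0 coef_derivn addn0 ffactnn coef0.
  by move=> /esym/eqP; rewrite mulrn_eq0 (negbTE (lt0n_neq0 (fact_gt0 m))) => /eqP.
by have [] := Hp 1; rewrite scale1r p0 horner0.
Qed.

Section Vanishing.
Variables (F : V -> R) (N Reg : set V) (adm : set 'M[R]_n).
Hypothesis polyF : polyfun F.

(** Derivatives of [F] in m normal directions. Differences and zero are included because moving a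
    vector field past a derivative produces a difference of terms of the same order. *)
Inductive iterated_derivative : nat -> (V -> R) -> Prop :=
| iterated0 : iterated_derivative 0 F
| iterated_zero m : iterated_derivative m (cst 0)
| iteratedB m f g : iterated_derivative m f -> iterated_derivative m g ->
    iterated_derivative m (fun x => f x - g x)
| iteratedD m v f : N v -> iterated_derivative m f -> iterated_derivative m.+1 (dder v f).

Hypothesis admN : forall L v, adm L -> N v -> N (v *m L).
Hypothesis admF : forall L x, adm L -> vf_derive L F x = 0.
Hypothesis RegF : forall x, Reg x -> F x = 0.
(* Every normal direction at a regular point is the sum of a direction in
   which generic points stay regular and of a direction in which [F] is constant. *)
Hypothesis Reg_split : forall x v, Reg x -> N v -> exists w L,
  [/\ v = w + x *m L, adm L &
      exists2 r : {poly R[i]}, r != 0 & forall k : nat, r.[k%:R] != 0 -> Reg (x + k%:R *: w)].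

Lemma polyfunB f g : polyfun f -> polyfun g -> polyfun (fun x => f x - g x).
Proof.
move=> pf pg; have -> : (fun x => f x - g x) = (fun x => f x + cst (-1) x * g x).
  by apply: funext => x; rewrite /cst mulN1r.
by apply: polyfunD => //; apply: polyfunM => //; exact: polyfun_cst.
Qed.

Lemma iterated_polyfun m f : iterated_derivative m f -> polyfun f.
Proof.
elim=> {m f} [|m|m f g _ IHf _ IHg|m v f Nv _ IHf] //.
- exact: polyfun_cst.
- exact: polyfunB.
- exact: polyfun_derive.
Qed.

Lemma deriveB_fun f g x v : polyfun f -> polyfun g ->
  dder v (fun x => f x - g x) x = dder v f x - dder v g x.
Proof.
move=> pf pg; exact: (dderE (is_deriveB (polyfun_is_derive x v pf) (polyfun_is_derive x v pg))).
Qed.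

(** The field of L annihilates [F], and its commutator with the derivative along v is the derivative
    along v L, again a normal direction; the order is therefore preserved. *)
Lemma iterated_vf m f L : adm L -> iterated_derivative m f -> iterated_derivative m (vf_derive L f).
Proof.
move=> aL; elim=> {m f} [|m|m f g itf IHf itg IHg|m v f Nv itf IHf].
- have -> : vf_derive L F = cst 0 by apply: funext => x; rewrite admF.
  exact: iterated_zero.
- have -> : vf_derive L (cst 0) = cst 0 by apply: funext => x; rewrite /vf_derive derive_cst_fun.
  exact: iterated_zero.
- have -> : vf_derive L (fun x => f x - g x) = (fun x => vf_derive L f x - vf_derive L g x).
    by apply: funext => x; rewrite /vf_derive (deriveB_fun _ _ (iterated_polyfun itf) (iterated_polyfun itg)).
  exact: iteratedB.
have -> : vf_derive L (dder v f) = (fun x => dder v (vf_derive L f) x - dder (v *m L) f x).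
  apply: funext => x; rewrite derive_vf; last exact: iterated_polyfun itf.
  by rewrite [RHS]addrC addKr.
by apply: iteratedB; apply: iteratedD => //; exact: admN.
Qed.

(** On the line, f vanishes at every natural parameter that is not a root of r, hence
    identically. *)
Lemma vanish_direction f x w (r : {poly R[i]}) : polyfun f -> r != 0 -> (forall y, Reg y -> f y = 0) ->
  (forall k : nat, r.[k%:R] != 0 -> Reg (x + k%:R *: w)) -> dder w f x = 0.
Proof.
move=> pf r0 f0 Hr; have [p Hp] := polyfun_line x w pf.
suff p0 : p = 0 by have [_] := Hp 0; rewrite p0 deriv0 horner0 scale0r addr0.
apply/eqP; rewrite -(map_poly_eq0 (real_complex R)); apply/negPn/negP => mp0.
have [k] := avoid_roots (mulf_neq0 mp0 r0).
rewrite hornerM mulf_eq0 negb_or => /andP[pk /Hr/f0].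
have [-> _] := Hp k%:R => pk0; move: pk.
by rewrite -(rmorph_nat (real_complex R)) horner_map /= pk0 rmorph0 eqxx.
Qed.

(** Strong induction on the order. The direction v splits as w + x L: along w the lower-order
    function vanishes at nearly all points of a line, and along x L the derivative is that of a
    vector field, which has lower order. The inner induction serves the differences. *)
Lemma iterated_vanish m f : iterated_derivative m f -> forall x, Reg x -> f x = 0.
Proof.
have [k] := ubnP m; elim: k m f => // k IH m f /ltnSE mk it.
elim: it mk => {m f} [|m|m f g itf IHf itg IHg|m v f Nv itf _] mk x Rx.
- exact: RegF.
- by [].
- by rewrite IHf // IHg // subrr.
have pf := iterated_polyfun itf.
have [w [L [-> aL [r r0 Hr]]]] := Reg_split Rx Nv.
have := derive_dir_linear x 1 w (x *m L) pf; rewrite scale1r => ->.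
rewrite (vanish_direction pf r0 _ Hr) ?mulr0 ?add0r; last by move=> y Ry; exact: (IH m).
by apply: (IH m _ mk (iterated_vf aL itf)).
Qed.

Lemma polyfun_vanish x v : Reg x -> N v -> F (x + v) = 0.
Proof.
move=> Rx Nv; apply: (taylor_vanish polyF) => m.
suff it : iterated_derivative m (iter m (dder v) F) by exact: iterated_vanish it _ Rx.
by elim: m => [|m IH]; [exact: iterated0|exact: iteratedD].
Qed.

End Vanishing.

End PolynomialFunctions.

Lemma polyfun_linear (R : realType) n (f : 'rV[R]_n -> R) :
  (forall k u v, f (k *: u + v) = k * f u + f v) -> polyfun f.
Proof.
move=> lf; have f0 : f 0 = 0 by have := lf (-1) 0 0; rewrite scaler0 addr0 mulN1r addNr.
have fS (I : Type) (r : seq I) (k : I -> R) u : f (\sum_(i <- r) k i *: u i) = \sum_(i <- r) k i * f (u i).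
  by elim: r => [|i r IH]; rewrite ?big_nil // !big_cons lf IH.
have -> : f = (fun x => \sum_i x 0 i * cst (f (delta_mx 0 i)) x).
  by apply: funext => x; rewrite {1}(row_sum_delta x) fS.
by apply: polyfun_sum => i; apply: polyfunM; [exact: polyfun_coord|exact: polyfun_cst].
Qed.

Lemma is_derive_mxtrace (R : realType) (V : normedModType R) n (M : V -> 'M[R]_n) x v dM :
  is_derive x v M dM -> is_derive x v (fun y => \tr (M y)) (\tr dM).
Proof.
move=> [dP E]; have -> : (fun y => \tr (M y)) = \sum_i (fun y => M y i i).
  by apply: funext => u; rewrite fct_sumE.
apply: is_derive_sum => i; rewrite -E.
by split; [exact: (derivable_mxP _ _ _).1|rewrite derive_mx // mxE].
Qed.

Lemma affine_poly_neq0 (K : nzRingType) (c d : K) : d != 0 -> c%:P * 'X + d%:P != 0.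
Proof.
move=> d0; apply/eqP => /polyP/(_ 0%N).
by rewrite coefD coefMX !coefC /= add0r => /eqP; rewrite (negbTE d0).
Qed.

(** * From the Cartan subspace to all normal directions *)

Section CartanReduction.
Context {R : realType} {n : nat}.
Local Notation V := 'rV[R]_n.+1.
Local Notation C := R[i].
Variables (ad : V -> 'M[R]_n.+1) (s : 'M[R]_n.+1) (a : {vspace V}).
Hypothesis Hs : symmetric_algebra ad s.
Hypothesis Ha : cartan ad s a.
Local Notation B := (trace_form ad).
Variables (X : V) (j : 'M[R]_n.+1) (k : nat).
Hypothesis Xa : X \in a.
Hypothesis BXX : B X X != 0.
Hypothesis gX : group_inverse (ad X) j.

Let F (xi : V) : R := \tr ((ad xi *m j) ^+ k).

Let ad_linear : linear ad. Proof. by case: Hs. Qed.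

Lemma polyfun_trace_exp : polyfun F.
Proof.
have pe i l m : polyfun (fun xi => ((ad xi *m j) ^+ m) i l).
  elim: m i l => [|m IH] i l; first by under eq_fun do rewrite expr0; exact: polyfun_cst.
  have -> : (fun xi => ((ad xi *m j) ^+ m.+1) i l) =
      (fun xi => \sum_p ((ad xi *m j) ^+ m) i p * (ad xi *m j) p l).
    by apply: funext => xi; rewrite exprSr -mulmxE mxE.
  apply: polyfun_sum => p; apply: polyfunM => //; apply: polyfun_linear => c u v.
  by rewrite ad_linear mulmxDl -scalemxAl mxE; congr (_ + _); rewrite mxE.
by apply: polyfun_sum => i; exact: pe.
Qed.

(** As ad Y commutes with j, moving xi in the direction [Y, xi] changes ad(xi) j by a commutator
    with ad Y, which does not affect traces of powers. *)
Lemma trace_exp_invariant Y xi : Y *m ad X = 0 -> vf_derive (ad Y) F xi = 0.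
Proof.
move=> YX; have lin : linear (fun v : V => ad v *m j).
  by move=> c u v; rewrite ad_linear mulmxDl -scalemxAl.
have D := is_derive_exp k (is_derive_linear_row lin (is_derive_id xi (xi *m ad Y))).
rewrite /vf_derive (dderE (is_derive_mxtrace D)).
have -> : ad (xi *m ad Y) *m j = (- ad Y) *m (ad xi *m j) - (ad xi *m j) *m (- ad Y).
  rewrite (ad_ad Hs) mulmxBl -(mulmxA (ad xi) (ad Y) j) (commuting_ginv Hs gX YX).
  by rewrite mulmxN mulNmx opprK addrC !mulmxA.
by rewrite expmx_deriv_commutator raddfB /= mxtrace_mulC subrr.
Qed.

Lemma normal_vec_act Y xi : Y *m s = Y -> Y *m ad X = 0 ->
  normal_vec ad s X xi -> normal_vec ad s X (xi *m ad Y).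
Proof.
move=> Ys YX [xis xiX xiadX]; split.
- by rewrite (bracket_s Hs) Ys xis mulNmx.
- by rewrite (trace_form_ad Hs) (ad_anti Hs) YX oppr0 (trace_form0r Hs) oppr0.
- by rewrite -mulmxA (commuting Hs YX) mulmxA xiadX mul0mx.
Qed.

Section Diagonal.
Variable P : 'M[C]_n.+1.
Hypothesis Pu : P \in unitmx.
Hypothesis diagP : forall u, u \in a -> is_diag_mx (P *m map_mx (real_complex R) (ad u) *m invmx P).
Local Notation weight := (weight ad P).

(** The weights that vanish at X but not on all of [a]. An A in [a] avoiding their kernels has,
    together with X, no larger centralizer in q than [a]. *)
Let sep m := (weight X 0 m == 0) && `[< exists2 u, u \in a & weight u 0 m != 0 >].

Let Reg : set V := [set A | [/\ A \in a, B A X = 0 & forall m, sep m -> weight A 0 m != 0]].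

Lemma cartan_proj u : u \in a -> u - (B u X / B X X) *: X \in a /\ B (u - (B u X / B X X) *: X) X = 0.
Proof.
move=> ua; split; first exact: memvB ua (memvZ _ Xa).
by rewrite (trace_formBl Hs) (trace_formZl Hs) divfK ?subrr.
Qed.

Lemma regular_exists : exists A, Reg A.
Proof.
have [||i c u v|i|A [Aa AX] H] := @avoid_kernels R V 'I_n.+1 sep
  (fun m u => weight u 0 m) [set u | u \in a /\ B u X = 0].
- by split; [exact: mem0v|rewrite (trace_form0l Hs)].
- move=> c u v [ua uX] [va vX]; split; first exact: memvD (memvZ _ ua) va.
  by rewrite (trace_formDl Hs) (trace_formZl Hs) uX vX mulr0 addr0.
- exact: (weight_linear Hs).
(* Such a weight vanishes at X, so removing the X-component of u leaves its value unchanged. *)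
- move=> /andP[/eqP Xi /asboolP[u ua ui]]; have [va vX] := cartan_proj ua.
  exists (u - (B u X / B X X) *: X); first by split.
  by rewrite addrC -scaleNr (weight_linear Hs) Xi mulr0 add0r.
by exists A.
Qed.

Lemma regular_split A v : Reg A -> normal_vec ad s X v -> exists w L,
  [/\ v = w + A *m L, exists Y, [/\ Y *m s = Y, Y *m ad X = 0 & L = ad Y] &
      exists2 r : {poly C}, r != 0 & forall i : nat, r.[i%:R] != 0 -> Reg (A + i%:R *: w)].
Proof.
move=> [Aa AX regA] [vs vX vadX].
have [jA gA] := cartan_group_inverse Ha Aa.
have [Ys ws wA] := cartan_split Hs Ha Aa gA vs.
set Y := - (v *m jA) in Ys ws wA; set w := v - A *m ad Y in ws wA.
have XA : X *m ad A = 0 := cartan_abelian Ha Aa Xa.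
have AadX : A *m ad X = 0 := cartan_abelian Ha Xa Aa.
(* The group inverse of ad A commutes with ad X, so Y inherits from v that it centralizes X. *)
have YX : Y *m ad X = 0.
  rewrite /Y mulNmx -mulmxA -(commuting_ginv Hs gA XA) mulmxA vadX mul0mx oppr0 //.
have wX : w *m ad X = 0.
  by rewrite /w mulmxBl vadX -mulmxA (commuting Hs YX) mulmxA AadX mul0mx subr0.
have wa : w \in a.
  apply: (cartan_centralizer Ha Pu diagP Xa Aa _ ws wX wA) => m Xm Am u ua.
  apply/eqP/negPn/negP => um.
  by have /regA : sep m; [rewrite /sep Xm eqxx; apply/asboolP; exists u|rewrite Am eqxx].
exists w, (ad Y); split; [by rewrite /w subrK|by exists Y|].
(* Value of weight m along the line A + t w; its constant term is nonzero by regularity of A. *)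
pose fac m : {poly C} := (weight w 0 m)%:P * 'X + (weight A 0 m)%:P.
exists (\prod_(m | sep m) fac m).
  by apply/prodf_neq0 => m /regA Am; exact: affine_poly_neq0.
move=> i; rewrite horner_prod => /prodf_neq0 H; split.
- exact: memvD Aa (memvZ _ wa).
- rewrite (trace_formDl Hs) AX (trace_formZl Hs) /w (trace_formBl Hs) vX (ad_anti Hs) (trace_formNl Hs).
  by rewrite (trace_form_ad Hs) XA (trace_form0r Hs) !oppr0 addr0 mulr0 addr0.
move=> m /H; suff -> : (fac m).[i%:R] = weight (A + i%:R *: w) 0 m by [].
by rewrite addrC (weight_linear Hs) !hornerE rmorph_nat mulrC.
Qed.

Lemma cartan_trace_diag : (forall xi, xi \in a -> B xi X = 0 -> F xi = 0) ->
  forall xi, normal_vec ad s X xi -> F xi = 0.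
Proof.
move=> H xi nxi; have [A RA] := regular_exists; have [Aa AX _] := RA.
rewrite -(subrK A xi) addrC.
apply: (@polyfun_vanish _ _ F (normal_vec ad s X) Reg
  [set L | exists Y, [/\ Y *m s = Y, Y *m ad X = 0 & L = ad Y]] polyfun_trace_exp) => //.
- by move=> L v [Y [Ys YX ->]]; exact: normal_vec_act.
- by move=> L x [Y [Ys YX ->]]; exact: trace_exp_invariant.
- by move=> x [xa xX _]; exact: H.
- exact: regular_split.
have [xis xiX xiadX] := nxi; split.
- by rewrite mulmxBl xis (cartan_q Ha Aa) opprB opprK addrC.
- by rewrite (trace_formBl Hs) xiX AX subrr.
- by rewrite mulmxBl xiadX (cartan_abelian Ha Xa Aa) subrr.
Qed.

End Diagonal.

End CartanReduction.

(** * Restricted roots *)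

Section Complexification.
Context {R : realType} {n : nat}.
Local Notation V := 'rV[R]_n.
Local Notation C := R[i].
Local Notation VC := 'rV[C]_n.
Local Notation RtoC := (real_complex R).
Local Notation ii := (Complex 0 1 : C).

Lemma vcomplex_linear k (u v : V) : vcomplex (k *: u + v) = RtoC k *: vcomplex u + vcomplex v.
Proof. by rewrite /vcomplex map_mxD map_mxZ. Qed.

Lemma vcomplexD (u v : V) : vcomplex (u + v) = vcomplex u + vcomplex v.
Proof. exact: map_mxD. Qed.

Lemma vcomplexN (u : V) : vcomplex (- u) = - vcomplex u.
Proof. exact: map_mxN. Qed.

Lemma vcomplex0 : vcomplex (0 : V) = 0.
Proof. exact: map_mx0. Qed.

Lemma vcomplex_mul (u : V) (M : 'M[R]_n) : vcomplex (u *m M) = vcomplex u *m map_mx RtoC M.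
Proof. exact: map_mxM. Qed.

Lemma complex_split (x y : R) : RtoC x + ii * RtoC y = Complex x y.
Proof. by apply/eqP; rewrite eq_complex /= !(mul0r, mul1r, mulr0, subr0, addr0, add0r) !eqxx. Qed.

Lemma vcomplex_split (Y : VC) : exists u v : V, Y = vcomplex u + ii *: vcomplex v.
Proof.
exists (map_mx (@complex.Re R) Y), (map_mx (@complex.Im R) Y).
by apply/rowP => i; rewrite !mxE complex_split; case: (Y 0 i).
Qed.

Lemma vcomplex_eq0 (u v : V) : vcomplex u + ii *: vcomplex v = 0 -> u = 0 /\ v = 0.
Proof.
move=> /rowP E; split; apply/rowP => i; have := E i; rewrite !mxE complex_split;
  by move=> /eqP; rewrite eq_complex /= => /andP[/eqP ? /eqP ?].
Qed.

Lemma complexifyP (W : {vspace V}) (Y : VC) :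
  Y \in complexify W <-> exists u v, [/\ u \in W, v \in W & Y = vcomplex u + ii *: vcomplex v].
Proof.
split=> [|[u [v [uW vW ->]]]]; last first.
  have H w : w \in W -> vcomplex w \in complexify W.
    move=> wW; rewrite (coord_vbasis wW) /vcomplex raddf_sum; apply: memv_suml => i _ /=.
    rewrite map_mxZ; apply: memvZ; apply: memv_span; apply/mapP.
    by exists (vbasis W)`_i; rewrite ?mem_nth ?size_tuple.
  by apply: memvD; [exact: H|apply: memvZ; exact: H].
rewrite /complexify; set S := map _ _; have sS : size S = \dim W by rewrite size_map size_tuple.
move=> /(coord_span (X := in_tuple S)) ->.
have iS (i : 'I_(size S)) : (i < size (vbasis W))%N.
  by apply: leq_trans (ltn_ord i) _; rewrite sS size_tuple.
have iW (i : 'I_(size S)) : (vbasis W)`_i \in W by apply/vbasis_mem/mem_nth.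
pose c i := coord (in_tuple S) i Y.
exists (\sum_i complex.Re (c i) *: (vbasis W)`_i), (\sum_i complex.Im (c i) *: (vbasis W)`_i); split.
- by apply: memv_suml => i _; exact: memvZ.
- by apply: memv_suml => i _; exact: memvZ.
have vS (k : 'I_(size S) -> R) :
    vcomplex (\sum_i k i *: (vbasis W)`_i) = \sum_i RtoC (k i) *: vcomplex (vbasis W)`_i.
  by rewrite /vcomplex raddf_sum; apply: eq_bigr => i _; exact: map_mxZ.
rewrite !vS scaler_sumr -big_split; apply: eq_bigr => i _ /=.
rewrite (nth_map 0) // -/(c i) scalerA -scalerDl complex_split.
by case: (c i).
Qed.

Lemma complexify_vcomplex (W : {vspace V}) u : u \in W -> vcomplex u \in complexify W.
Proof.
move=> uW; apply/complexifyP; exists u, 0; split=> //; first exact: mem0v.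
by rewrite vcomplex0 scaler0 addr0.
Qed.

End Complexification.

Section ComplexForms.
Context {R : realType} {n : nat} {G : preTopologicalGroupType}.
Variables (e : chart 'rV[R]_n G).
Local Notation V := 'rV[R]_n.
Local Notation C := R[i].
Local Notation VC := 'rV[C]_n.
Local Notation RtoC := (real_complex R).
Local Notation ii := (Complex 0 1 : C).
Hypothesis ad_linear : linear (ad_mx e).

Lemma ad_mxC_linear c (Y Z : VC) : ad_mxC e (c *: Y + Z) = c *: ad_mxC e Y + ad_mxC e Z.
Proof.
rewrite /ad_mxC scaler_sumr -big_split; apply: eq_bigr => i _ /=.
by rewrite !mxE scalerDl scalerA.
Qed.

Lemma ad_mxCD (Y Z : VC) : ad_mxC e (Y + Z) = ad_mxC e Y + ad_mxC e Z.
Proof. by have := ad_mxC_linear 1 Y Z; rewrite !scale1r. Qed.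

Let adL : {linear V -> 'M[R]_n} := HB.pack (ad_mx e) (GRing.isLinear.Build _ _ _ _ _ ad_linear).

Lemma ad_mxC_vcomplex (u : V) : ad_mxC e (vcomplex u) = map_mx RtoC (ad_mx e u).
Proof.
rewrite {2}(row_sum_delta u) -[ad_mx e]/(adL : _ -> _) linear_sum raddf_sum /ad_mxC.
by apply: eq_bigr => i _; rewrite linearZ /= map_mxZ mxE.
Qed.

Lemma killingC_trace (Y Z : VC) : killingC e Y Z = \tr (ad_mxC e Y *m ad_mxC e Z).
Proof.
rewrite /ad_mxC mulmx_suml raddf_sum; apply: eq_bigr => i _ /=.
rewrite mulmx_sumr raddf_sum; apply: eq_bigr => j _ /=.
rewrite -scalemxAl -scalemxAr !mxtraceZ mulrA -map_mxM; congr (_ * _).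
by rewrite trace_map_mx.
Qed.

Lemma killingC_sym (Y Z : VC) : killingC e Y Z = killingC e Z Y.
Proof. by rewrite !killingC_trace mxtrace_mulC. Qed.

Lemma killingC_linear c (Y Y' Z : VC) : killingC e (c *: Y + Y') Z = c * killingC e Y Z + killingC e Y' Z.
Proof. by rewrite !killingC_trace ad_mxC_linear mulmxDl -scalemxAl raddfD /= mxtraceZ. Qed.

Lemma killingC_linearr c (Y Z Z' : VC) : killingC e Y (c *: Z + Z') = c * killingC e Y Z + killingC e Y Z'.
Proof. by rewrite ![killingC e Y _]killingC_sym killingC_linear. Qed.

Lemma killingC_vcomplex (u v : V) : killingC e (vcomplex u) (vcomplex v) = RtoC (killing e u v).
Proof.
rewrite killingC_trace !ad_mxC_vcomplex -map_mxM.
by rewrite trace_map_mx.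
Qed.

End ComplexForms.

Lemma half_polarization (K : numFieldType) n (Y Z : 'rV[K]_n) (c c' : K) :
  c ^+ 2 *: Y + Z + (Z + c' ^+ 2 *: Y) = (c + c') ^+ 2 *: Y -> Z = (c * c') *: Y.
Proof.
move=> /rowP E; apply/rowP => i; move: (E i); rewrite !mxE => {}E.
apply/eqP; rewrite -subr_eq0.
have : 2%:R * (Z 0 i - c * c' * Y 0 i) = 0.
  transitivity (c ^+ 2 * Y 0 i + Z 0 i + (Z 0 i + c' ^+ 2 * Y 0 i) - (c + c') ^+ 2 * Y 0 i).
    by ring.
  by rewrite E subrr.
by move=> /eqP; rewrite mulf_eq0 pnatr_eq0.
Qed.

Lemma weight_vector_scale (K : numFieldType) n (Y Z : 'rV[K]_n) (c c' : K) : c != 0 ->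
  2^-1 *: ((c' / c) *: Z + c^-1 *: ((c * c') *: Y)) = c' *: (2^-1 *: (Y + c^-1 *: Z)).
Proof. by move=> c0; apply/rowP => i; rewrite !mxE; field. Qed.

Lemma anticommuting_combination (K : comNzRingType) n (M N S : 'M[K]_n) c :
  M *m S = - (S *m M) -> N *m S = - (S *m N) ->
  (c *: M + N) *m S = - (S *m (c *: M + N)).
Proof.
by move=> MS NS; rewrite mulmxDl mulmxDr -scalemxAl -scalemxAr MS NS scalerN opprD.
Qed.

(** The map from vectors to forms is injective by nondegeneracy, hence onto by dimension. *)
Lemma nondegenerate_represents (K : fieldType) (U : vectType K) (b : U -> U -> K^o) :
  (forall d, linear (b^~ d)) -> (forall A, linear (b A)) ->
  (forall d, (forall A, b A d = 0) -> d = 0) ->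
  forall alpha : 'Hom(U, K^o), exists d, forall A, b A d = alpha A.
Proof.
move=> lb rb nd alpha.
pose f d : 'Hom(U, K^o) := linfun (HB.pack (b^~ d) (GRing.isLinear.Build _ _ _ _ (b^~ d) (lb d)) : {linear U -> K^o}).
have fE d A : f d A = b A d by rewrite lfunE.
have linf : linear f by move=> c d d'; apply/lfunP => A; rewrite add_lfunE scale_lfunE !fE rb.
pose F := linfun (HB.pack f (GRing.isLinear.Build _ _ _ _ f linf) : {linear U -> 'Hom(U, K^o)}).
have FE d : F d = f d by rewrite lfunE.
have kF : (fullv :&: lker F = 0)%VS.
  apply/eqP; rewrite -subv0; apply/subvP => d; rewrite memv_cap memv_ker FE => /andP[_ /eqP d0].
  by rewrite memv0; apply/eqP/nd => A; rewrite -fE d0 zero_lfunE.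
have : alpha \in (F @: fullv)%VS.
  have -> : (F @: fullv)%VS = fullv; last exact: memvf.
  apply/eqP; rewrite eqEdim subvf (limg_dim_eq kF) !dimvf.
  by rewrite /= (muln1 (dim U) : dim 'Hom(U, K^o) = dim U).
by move=> /memv_imgP[d _ ->]; exists d => A; rewrite FE fE.
Qed.

(** * Restricted roots and multiplicities in terms of weights *)

Section RestrictedRootSystem.
Context {R : realType} {n : nat} {G : preTopologicalGroupType}.
Variables (e : chart 'rV[R]_n.+1 G) (s : 'M[R]_n.+1) (a q : {vspace 'rV[R]_n.+1}).
Local Notation V := 'rV[R]_n.+1.
Local Notation C := R[i].
Local Notation VC := 'rV[C]_n.+1.
Local Notation RtoC := (real_complex R).
Local Notation ii := (Complex 0 1 : C).
Local Notation ad := (ad_mx e).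
Local Notation B := (trace_form ad).
Local Notation aC := (subvs_of (complexify a)).
Hypothesis Hs : symmetric_algebra ad s.
Hypothesis Ha : cartan ad s a.
Hypothesis qE : forall u, (u \in q) = (u *m s == - u).
Variable P : 'M[C]_n.+1.
Hypothesis Pu : P \in unitmx.
Hypothesis diagP : forall u, u \in a -> is_diag_mx (P *m map_mx RtoC (ad u) *m invmx P).

Let ad_linear : linear ad. Proof. by case: Hs. Qed.

Local Notation sC := (map_mx RtoC s).

Lemma sC_involutive : sC *m sC = 1%:M.
Proof. by rewrite -map_mxM (s_involutive Hs) map_mx1. Qed.

Lemma complexify_q (Y : VC) : (Y \in complexify q) = (Y *m sC == - Y).
Proof.
apply/idP/eqP => [/complexifyP[u [v [uq vq ->]]]|Ys].
  move: uq vq; rewrite !qE => /eqP us /eqP vs.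
  by rewrite mulmxDl -scalemxAl -!vcomplex_mul us vs !vcomplexN opprD scalerN.
have [u [v Yuv]] := vcomplex_split Y.
have [|us vs] := @vcomplex_eq0 R n.+1 (u *m s + u) (v *m s + v).
  rewrite !vcomplexD !vcomplex_mul scalerDr addrACA scalemxAl -mulmxDl -Yuv.
  by rewrite Ys addNr.
by apply/complexifyP; exists u, v; rewrite !qE -!addr_eq0 us vs !eqxx.
Qed.

Definition root_weight (m : 'I_n.+1) (A : aC) : C^o := (P *m ad_mxC e (vsval A) *m invmx P) m m.

Lemma root_weight_linear m : linear (root_weight m).
Proof.
move=> c A A'; rewrite /root_weight linearP /= ad_mxC_linear mulmxDr mulmxDl -scalemxAr -scalemxAl mxE.
by congr (_ + _); rewrite mxE.
Qed.

Definition Weight m : dualC a :=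
  linfun (HB.pack (root_weight m) (GRing.isLinear.Build _ _ _ _ (root_weight m) (root_weight_linear m))
    : {linear aC -> C^o}).

Lemma WeightE m A : Weight m A = (P *m ad_mxC e (vsval A) *m invmx P) m m.
Proof. by rewrite lfunE. Qed.

Lemma Weight_vcomplex m (A : aC) u : u \in a -> vsval A = vcomplex u -> Weight m A = weight ad P u 0 m.
Proof. by move=> ua Au; rewrite WeightE Au (ad_mxC_vcomplex ad_linear) weight_entry. Qed.

Lemma vsval_complex (A : aC) : exists u v, [/\ u \in a, v \in a & vsval A = vcomplex u + ii *: vcomplex v].
Proof. exact/complexifyP/subvsP. Qed.

Lemma Weight_diag (A : aC) : P *m ad_mxC e (vsval A) = diag_mx (\row_m Weight m A) *m P.
Proof.
rewrite -[LHS](mulmxKV Pu); congr (_ *m _).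
have [u [v [ua va E]]] := vsval_complex A.
have D : is_diag_mx (P *m ad_mxC e (vsval A) *m invmx P).
  rewrite E addrC ad_mxC_linear !(ad_mxC_vcomplex ad_linear) mulmxDr mulmxDl -scalemxAr -scalemxAl.
  apply/is_diag_mxP => i j ij; rewrite mxE (is_diag_mxP (diagP ua)) // addr0.
  by rewrite mxE (is_diag_mxP (diagP va)) // mulr0.
apply/matrixP => i j; rewrite [RHS]mxE; have [->|ij] := eqVneq i j.
  by rewrite mulr1n [RHS]mxE WeightE.
by rewrite (is_diag_mxP D) ?mulr0n.
Qed.

Lemma row_weight (A : aC) m : row m P *m ad_mxC e (vsval A) = Weight m A *: row m P.
Proof.
by rewrite -row_mul Weight_diag row_mul row_diag_mx -scalemxAl -rowE [_ m]mxE.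
Qed.

Lemma ad_mxC_comm (A A' : aC) :
  ad_mxC e (vsval A) *m ad_mxC e (vsval A') = ad_mxC e (vsval A') *m ad_mxC e (vsval A).
Proof.
have H (Z Z' : aC) : P *m (ad_mxC e (vsval Z) *m ad_mxC e (vsval Z')) =
    diag_mx (\row_m Weight m Z) *m diag_mx (\row_m Weight m Z') *m P.
  rewrite (mulmxA P) (Weight_diag Z) -(mulmxA _ P) (Weight_diag Z').
  by rewrite mulmxA.
by apply: (can_inj (mulKmx Pu)); rewrite !H diag_mxC.
Qed.

Lemma sC_swap (A : aC) : ad_mxC e (vsval A) *m sC = - (sC *m ad_mxC e (vsval A)).
Proof.
have H w : w \in a -> map_mx RtoC (ad w) *m sC = - (sC *m map_mx RtoC (ad w)).
  by move=> wa; rewrite -map_mxM (swap_ad Hs (cartan_q Ha wa)) map_mxN map_mxM.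
have [u [v [ua va ->]]] := vsval_complex A.
rewrite addrC ad_mxC_linear !(ad_mxC_vcomplex ad_linear).
exact: anticommuting_combination (H v va) (H u ua).
Qed.

Definition weight_space (alpha : dualC a) : {vspace VC} :=
  <<[seq row m P | m <- enum 'I_n.+1 & Weight m == alpha]>>%VS.

Lemma mem_weight_space alpha (Y : VC) :
  Y \in weight_space alpha <-> forall A, Y *m ad_mxC e (vsval A) = alpha A *: Y.
Proof.
split=> [Yw A|H].
  pose M := ad_mxC e (vsval A) - (alpha A)%:M.
  suff /subvP/(_ _ Yw) : (weight_space alpha <= mulmx_kernel M)%VS.
    by rewrite mem_mulmx_kernel mulmxBr mul_mx_scalar subr_eq0 => /eqP.
  apply/span_subvP => _ /mapP[m + ->]; rewrite mem_filter => /andP[/eqP mw _].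
  by rewrite mem_mulmx_kernel mulmxBr mul_mx_scalar row_weight mw subrr.
pose y := Y *m invmx P.
have -> : Y = \sum_m y 0 m *: row m P by rewrite -mulmx_sum_row /y mulmxKV.
apply: memv_suml => m _; have [->|ym] := eqVneq (y 0 m) 0; first by rewrite scale0r mem0v.
apply: memvZ; apply: memv_span; apply/mapP; exists m => //.
rewrite mem_filter mem_enum andbT; apply/eqP/lfunP => A.
have : y *m diag_mx (\row_m Weight m A) = alpha A *: y.
  apply: (can_inj (mulmxK Pu)); rewrite -mulmxA -Weight_diag mulmxA -scalemxAl.
  by rewrite /y mulmxKV // H.
rewrite mul_mx_diag => /rowP/(_ m); rewrite mxE [(\row__ _) 0 m]mxE [in RHS]mxE [RHS]mulrC.
exact: (@mulfI C _ ym).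
Qed.

Lemma dim_weight_space alpha : \dim (weight_space alpha) = #|[pred m | Weight m == alpha]|.
Proof.
pose X := [tuple row m P | m < n.+1].
have fX : free X.
  apply/freeP => k; under eq_bigr do rewrite -tnth_nth tnth_mktuple.
  rewrite (eq_bigr (fun i => (\row_i k i) 0 i *: row i P)); last by move=> i _; rewrite mxE.
  rewrite -mulmx_sum_row => /(congr1 (mulmx^~ (invmx P))); rewrite mulmxK // mul0mx.
  by move=> E i; move/rowP/(_ i): E; rewrite !mxE.
rewrite /weight_space; set Y := map _ _.
have : free (Y ++ [seq row m P | m <- enum 'I_n.+1 & Weight m != alpha]).
  by rewrite -map_cat (perm_free (perm_map _ (permEl (perm_filterC _ _)))).
by move=> /catl_free /eqP ->; rewrite size_map cardE enumT.
Qed.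

(** The involution negates [a], hence exchanges the weights alpha and -alpha. *)
Lemma weight_space_s alpha (Y : VC) : Y \in weight_space alpha -> Y *m sC \in weight_space (- alpha).
Proof.
move=> /mem_weight_space H; apply/mem_weight_space => A.
have E : sC *m ad_mxC e (vsval A) = - (ad_mxC e (vsval A) *m sC) by rewrite sC_swap opprK.
by rewrite -mulmxA E mulmxN mulmxA H opp_lfunE -scalemxAl scaleNr.
Qed.

Definition weight_count (alpha : dualC a) := #|[pred m | Weight m == alpha]|.

Lemma weight_countN alpha : weight_count (- alpha) = weight_count alpha.
Proof.
have H beta : (weight_count beta <= weight_count (- beta))%N.
  rewrite /weight_count -!dim_weight_space.
  have inj : (weight_space beta :&: lker (linfun (mulmxr sC : VC -> VC)) = 0)%VS.
    apply/eqP; rewrite -subv0; apply/subvP => v; rewrite memv_cap memv_ker lfunE /= => /andP[_ /eqP v0].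
    by rewrite memv0 -[v]mulmx1 -sC_involutive mulmxA v0 mul0mx.
  rewrite -(limg_dim_eq inj); apply: dimvS; apply/subvP => _ /memv_imgP[v vb ->].
  by rewrite lfunE; exact: weight_space_s.
by apply/eqP; rewrite eqn_leq H andbT; have := H (- alpha); rewrite opprK.
Qed.

(** A root space is defined by squares; since the operators commute, evaluating at A + A' recovers
    the mixed products. *)
Let polarization (alpha : dualC a) (Y : VC) (A A' : aC) :
  (forall A : aC, Y *m ad_mxC e (vsval A) *m ad_mxC e (vsval A) = alpha A ^+ 2 *: Y) ->
  Y *m ad_mxC e (vsval A) *m ad_mxC e (vsval A') = (alpha A * alpha A') *: Y.
Proof.
move=> H; have := H (A + A').
have -> : vsval (A + A') = vsval A + vsval A' by rewrite linearD.
rewrite ad_mxCD !mulmxDr !mulmxDl !H linearD /=.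
rewrite -(mulmxA Y (ad_mxC e (vsval A')) (ad_mxC e (vsval A))) ad_mxC_comm mulmxA.
exact: half_polarization.
Qed.

(* With [alpha A0 != 0], a vector [Y] of the root space is [Z - Z *m sC] for the
   weight vector [Z = (Y + Y *m ad A0 / alpha A0) / 2]. *)
Lemma multiplicityE alpha : alpha != 0 -> multiplicity e q alpha = weight_count alpha.
Proof.
move=> alpha0.
have [A0 aA0] : exists A0, alpha A0 != 0.
  apply: contrapT => H; move/eqP: alpha0; apply; apply/lfunP => A; rewrite zero_lfunE.
  by apply/eqP/negPn/negP => aA; apply: H; exists A.
pose phi : 'End(VC) := linfun (mulmxr (1%:M - sC)).
have phiE Y : phi Y = Y - Y *m sC by rewrite lfunE /= mulmxBr mulmx1.
have adS (A : aC) (y : VC) : y *m sC *m ad_mxC e (vsval A) = - (y *m ad_mxC e (vsval A) *m sC).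
  by rewrite -!mulmxA sC_swap mulmxN opprK.
rewrite /multiplicity (@set_span_vspace _ _ _ (phi @: weight_space alpha)%VS).
  (* [phi] is injective on the weight space: a vector fixed by the involution would have both
     weights alpha and -alpha, which differ at [A0]. *)
  rewrite limg_dim_eq ?dim_weight_space //; apply/eqP; rewrite -subv0; apply/subvP => y.
  rewrite memv_cap memv_ker phiE subr_eq0 memv0 => /andP[/mem_weight_space yw /eqP ys].
  have := adS A0 y; rewrite -ys yw -scalemxAl -ys => /rowP E; apply/eqP/rowP => i; have := E i.
  by rewrite !mxE => /eqP; rewrite -addr_eq0 -mulr2n mulrn_eq0 mulf_eq0 (negbTE aA0) => /eqP.
move=> Y; split=> [[]|/memv_imgP[y yw ->]].
  rewrite complexify_q => /eqP Ys YA.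
  pose Z := 2^-1 *: (Y + (alpha A0)^-1 *: (Y *m ad_mxC e (vsval A0))).
  have YE : Y = phi Z.
    rewrite phiE /Z -!scalemxAl mulmxDl -scalemxAl Ys.
    have -> : Y *m ad_mxC e (vsval A0) *m sC = Y *m ad_mxC e (vsval A0).
      by rewrite -[LHS]opprK -adS Ys mulNmx opprK.
    by apply/rowP => i; rewrite !mxE; field.
  rewrite {1}YE; apply: memv_img; apply/mem_weight_space => A.
  have E1 : Y *m ad_mxC e (vsval A) = (alpha A / alpha A0) *: (Y *m ad_mxC e (vsval A0)).
    have E : Y *m ad_mxC e (vsval A) *m ad_mxC e (vsval A0) *m ad_mxC e (vsval A0) =
        (alpha A0 ^+ 2) *: (Y *m ad_mxC e (vsval A)).
      rewrite -(mulmxA Y) ad_mxC_comm mulmxA -(mulmxA _ (ad_mxC e (vsval A))) ad_mxC_comm mulmxA YA.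
      by rewrite -scalemxAl.
    rewrite (polarization A A0 YA) -scalemxAl in E.
    apply: (@scalerI _ _ (alpha A0 ^+ 2)); first by rewrite expf_neq0.
    by rewrite -E scalerA; congr (_ *: _); field.
  rewrite /Z -scalemxAl mulmxDl E1 -scalemxAl (polarization A0 A YA).
  exact: weight_vector_scale.
have yA A := (mem_weight_space alpha y).1 yw A.
rewrite phiE; split.
  by rewrite complexify_q mulmxBl -mulmxA sC_involutive mulmx1 opprB.
move=> A; rewrite mulmxBl adS yA -scalemxAl opprK mulmxDl -!scalemxAl adS yA -scalemxAl.
by rewrite scalerN scalerBr !scalerA -expr2 -scalerBr scalerBr.
Qed.

Definition pairing (u : V) (Z : aC) : C^o := killingC e (vcomplex u) (vsval Z).

Lemma pairing_linear u : linear (pairing u).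
Proof. by move=> c Z Z'; rewrite /pairing linearP killingC_linearr. Qed.

Let pairingL u : {linear aC -> C^o} := HB.pack (pairing u) (GRing.isLinear.Build _ _ _ _ (pairing u) (pairing_linear u)).

Lemma pairingB u Z Z' : pairing u (Z - Z') = pairing u Z - pairing u Z'.
Proof. exact: (linearB (pairingL u)). Qed.

Lemma pairingN u Z : pairing u (- Z) = - pairing u Z.
Proof. exact: (linearN (pairingL u)). Qed.

Lemma pairingZ u c Z : pairing u (c *: Z) = c * pairing u Z.
Proof.
by have := pairing_linear u c Z 0; rewrite addr0 [pairing u 0](linear0 (pairingL u)) addr0.
Qed.

Lemma pairing_linearl k u v Z : pairing (k *: u + v) Z = RtoC k * pairing u Z + pairing v Z.
Proof. by rewrite /pairing vcomplex_linear killingC_linear. Qed.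

(** Testing against real vectors suffices, because the real and imaginary parts of d are tested
    separately. *)
Lemma killingC_nondeg (d : aC) :
  (forall u, u \in a -> pairing u d = 0) -> d = 0.
Proof.
move=> H; have [u0 [v0 [ua va E]]] := vsval_complex d.
have Z u : u \in a -> B u u0 = 0 /\ B u v0 = 0.
  move=> /H; rewrite /pairing E addrC killingC_linearr !(killingC_vcomplex ad_linear) addrC complex_split.
  move=> E0; split; [exact: (congr1 (@complex.Re R) E0)|exact: (congr1 (@complex.Im R) E0)].
have nd w : w \in a -> (forall u, u \in a -> B u w = 0) -> w = 0.
  by move=> wa Hw; apply: (cartan_nondeg Hs Ha Pu diagP wa) => v va'; rewrite trace_formC Hw.
have u00 : u0 = 0 by apply: nd => // u /Z[].
have v00 : v0 = 0 by apply: nd => // u /Z[].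
by apply: val_inj; rewrite /= E u00 v00 !vcomplex0 scaler0 addr0.
Qed.

Lemma vsval_in_complexify u : u \in a -> vsval (in_complexify a u) = vcomplex u.
Proof. by move=> ua; rewrite /in_complexify vsprojK // complexify_vcomplex. Qed.

Lemma root_vectorP (alpha : dualC a) (A : aC) : killingC e (vsval A) (vsval (root_vector e alpha)) = alpha A.
Proof.
have [| | |d Hd] := @nondegenerate_represents _ _ (fun A A0 : aC => killingC e (vsval A) (vsval A0) : C^o) _ _ _ alpha.
- by move=> d c Y Y'; rewrite linearP killingC_linear.
- by move=> Y c d d'; rewrite linearP killingC_linearr.
- move=> d H; apply: killingC_nondeg => u ua.
  by rewrite /pairing -vsval_in_complexify // H.
rewrite /root_vector; set S := [set A0 : aC | _].
by have := @xgetPex _ 0 S (ex_intro _ d Hd); apply.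
Qed.

Lemma pairing_root_vector alpha u : u \in a -> pairing u (root_vector e alpha) = alpha (in_complexify a u).
Proof. by move=> ua; rewrite /pairing -(vsval_in_complexify ua) root_vectorP. Qed.

Lemma root_vectorN (alpha : dualC a) : root_vector e (- alpha) = - root_vector e alpha.
Proof.
apply/eqP; rewrite -subr_eq0; apply/eqP; apply: killingC_nondeg => u ua.
by rewrite pairingB pairingN !pairing_root_vector // opp_lfunE subrr.
Qed.

Variable X : V.
Hypothesis Xa : X \in a.
Hypothesis BXX : B X X != 0.
Local Notation XC := (in_complexify a X).

(** Both the projection and the scaling factor change sign. This allows all weights to be treated at
    once, without choosing a positive system. *)
Lemma scaled_root_projN (alpha : dualC a) : scaled_root_proj e X (- alpha) = scaled_root_proj e X alpha.
Proof.
rewrite /scaled_root_proj /root_proj /= root_vectorN opp_lfunE invrN opprK mulNr scaleNr opprK.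
by rewrite scaleNr -scalerN opprB addrC.
Qed.

Lemma pairing_complexify u v : v \in a -> pairing u (in_complexify a v) = RtoC (B u v).
Proof. by move=> va; rewrite /pairing (vsval_in_complexify va) (killingC_vcomplex ad_linear). Qed.

Lemma killingCXX : killingC e (vsval XC) (vsval XC) = RtoC (B X X).
Proof. by rewrite (vsval_in_complexify Xa) (killingC_vcomplex ad_linear). Qed.

Lemma pairing_scaled (alpha : dualC a) (u : V) : u \in a ->
  pairing u (scaled_root_proj e X alpha) =
    - (alpha (in_complexify a u) - alpha XC * RtoC (B u X) / RtoC (B X X)) / alpha XC.
Proof.
move=> ua; rewrite /scaled_root_proj /root_proj pairingZ pairingB pairingZ.
rewrite pairing_root_vector // (pairing_complexify u Xa) killingCXX.
by rewrite mulNr mulrC mulNr; congr (- ((_ - _) * _)); rewrite mulrAC.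
Qed.

Lemma pairing_scaled_orth (alpha : dualC a) (u : V) : u \in a -> B u X = 0 ->
  pairing u (scaled_root_proj e X alpha) = - (alpha (in_complexify a u) / alpha XC).
Proof. by move=> ua uX; rewrite pairing_scaled // uX rmorph0 mulr0 mul0r subr0 mulNr. Qed.

Lemma pairing_scaledX (alpha : dualC a) : pairing X (scaled_root_proj e X alpha) = 0.
Proof.
rewrite pairing_scaled // mulfK ?subrr ?oppr0 ?mul0r //.
by rewrite fmorph_eq0.
Qed.

Variable Rplus : set (dualC a).
Hypothesis posR : positive_system (restricted_roots e q a) Rplus.

Lemma restricted_rootsP (alpha : dualC a) : alpha != 0 -> (0 < weight_count alpha)%N ->
  restricted_roots e q a alpha.
Proof.
move=> alpha0; rewrite -multiplicityE // /multiplicity => d0; split=> //.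
apply: contrapT => H; move: d0; rewrite (@set_span_vspace _ _ _ 0%VS) ?dimv0 //.
move=> Y; rewrite memv0; split=> [rY|/eqP ->].
  by apply/negPn/negP => Y0; apply: H; exists Y.
split; first exact: mem0v.
by move=> A; rewrite !mul0mx scaler0.
Qed.

Definition scaled_roots : seq aC :=
  [seq scaled_root_proj e X (Weight m) | m <- enum 'I_n.+1 & Weight m XC != 0].

Let D Z : set (dualC a) := [set alpha | [/\ Rplus alpha, alpha XC != 0 & scaled_root_proj e X alpha = Z]].

Let root_neq0 Z alpha : D Z alpha -> alpha != 0.
Proof. by move=> [_ aX _]; apply: contraNneq aX => ->; rewrite zero_lfunE. Qed.

(** The enumeration f of the weights is a parameter so that the count can be made both with the
    weights and with their opposites. *)
Lemma occurrences_sum Z (f : 'I_n.+1 -> dualC a) :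
  (forall alpha, weight_count alpha = #|[pred m | f m == alpha]|) ->
  occurrences e q X Rplus Z = (\sum_m `[< D Z (f m) >])%N.
Proof.
move=> Hf; rewrite /occurrences -/(D Z).
(* A finite list carrying the support of the sum: other roots have multiplicity zero. *)
pose r := [seq alpha <- undup (map f (enum 'I_n.+1)) | `[< D Z alpha >]].
have rU : uniq r by rewrite filter_uniq ?undup_uniq.
have rP alpha : (alpha \in r) = `[< D Z alpha >] && (alpha \in map f (enum 'I_n.+1)).
  by rewrite mem_filter mem_undup.
rewrite (fsbigE r) //; first last.
- move=> alpha Da; rewrite rP asboolT //= => nf.
  rewrite (multiplicityE (root_neq0 Da)) Hf; apply: eq_card0 => m; rewrite !inE.
  by apply: contraNF nf => /eqP <-; rewrite map_f ?mem_enum.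
- by move=> alpha /=; rewrite rP => /andP[/asboolP].
transitivity (\sum_(alpha <- r) \sum_m (f m == alpha))%N.
  rewrite big_seq_cond [RHS]big_seq; apply: eq_big => [alpha|alpha].
    by apply: andb_idr; rewrite rP => /andP[/asboolP Da _]; exact: mem_set.
  rewrite rP => /andP[/andP[/asboolP Da _] _].
  by rewrite (multiplicityE (root_neq0 Da)) Hf -sum1_card big_mkcond.
rewrite exchange_big; apply: eq_bigr => m _ /=.
under eq_bigr do rewrite eq_sym.
have -> : (\sum_(alpha <- r) (alpha == f m) = count_mem (f m) r)%N.
  by rewrite -sum1_count [RHS]big_mkcond.
by rewrite count_uniq_mem // rP map_f ?mem_enum // andbT.
Qed.

(** Counting once with the weights and once with their opposites, each index m with nonzero value at
    X contributes exactly once for its scaled projection, as one and only one of the two signs is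
    positive. *)
Lemma occurrences_double Z : (occurrences e q X Rplus Z).*2 = count_mem Z scaled_roots.
Proof.
have countN alpha : weight_count alpha = #|[pred m | - Weight m == alpha]|.
  by rewrite -weight_countN; apply: eq_card => m; rewrite !inE eqr_oppLR.
rewrite -addnn {1}(occurrences_sum Z (fun=> erefl _)) (occurrences_sum Z countN) -big_split /=.
rewrite count_map count_filter -sum1_count [RHS]big_mkcond big_enum /=; apply: eq_bigr => m _.
have [X0|X0] := eqVneq (Weight m XC) 0.
  have nD (alpha : dualC a) : alpha XC = 0 -> `[< D Z alpha >] = false.
    by move=> a0; apply: asboolF => -[_]; rewrite a0 eqxx.
  by rewrite (nD _ X0) nD ?andbF // opp_lfunE X0 oppr0.
rewrite andbT; have W0 : Weight m != 0 by apply: contraNneq X0 => ->; rewrite zero_lfunE.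
have /restricted_rootsP /(_ _)/= root : Weight m != 0 by [].
have {}root : restricted_roots e q a (Weight m).
  by apply: root; apply/card_gt0P; exists m; rewrite inE.
have [_ /(_ _ root) posE _] := posR.
have [E|E] := eqVneq (scaled_root_proj e X (Weight m)) Z; last first.
  by rewrite !asboolF // => -[_ _]; rewrite ?scaled_root_projN => E'; rewrite E' eqxx in E.
have [Rm|Rm] := asboolP (Rplus (Weight m)).
  by rewrite asboolT ?asboolF // => -[]; move/posE: Rm.
have RN : Rplus (- Weight m) by apply: contrapT => /posE.
by rewrite asboolF ?asboolT //; [split; rewrite ?opp_lfunE ?oppr_eq0 ?scaled_root_projN|case].
Qed.

Lemma occurrences_symmetric : (forall Z, occurrences e q X Rplus (- Z) = occurrences e q X Rplus Z) <->
  perm_eq scaled_roots (map -%R scaled_roots).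
Proof.
have cN Z : count_mem Z (map -%R scaled_roots) = count_mem (- Z) scaled_roots.
  by rewrite count_map; apply: eq_count => Y /=; rewrite eqr_oppLR.
split=> [H|/permP H Z].
  by apply/allP => Z _ /=; rewrite cN -!occurrences_double H.
by apply: double_inj; rewrite !occurrences_double -cN H.
Qed.

Lemma Weight_in u m : u \in a -> Weight m (in_complexify a u) = weight ad P u 0 m.
Proof. by move=> ua; apply: Weight_vcomplex => //; exact: vsval_in_complexify. Qed.

Lemma weight_power_sum u k : u \in a -> B u X = 0 -> odd k ->
  \sum_m (weight ad P u 0 m / weight ad P X 0 m) ^+ k = - \sum_(z <- map (pairing u) scaled_roots) z ^+ k.
Proof.
move=> ua uX ko; rewrite -map_comp big_map big_filter [in RHS]big_enum_cond -sumrN.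
rewrite (bigID (fun m => Weight m XC != 0)) /= [X in _ + X]big1 ?addr0.
  apply: eq_bigr => m _; rewrite pairing_scaled_orth // exprNn -signr_odd ko expr1 mulN1r opprK.
  by rewrite (Weight_in m ua) (Weight_in m Xa).
(* Weights vanishing at X contribute 0, because division by 0 gives 0 and k, being odd, is
   positive. *)
move=> m /negbNE/eqP E; have {E} : weight ad P X 0 m = 0 by rewrite -(Weight_in m Xa) E.
have H0 (w w' : C) : w = 0 -> (w' / w) ^+ k = 0.
  by move=> ->; rewrite invr0 mulr0 expr0n; case: k ko.
exact: H0.
Qed.

Lemma occurrences_power_sums : (forall Z, occurrences e q X Rplus (- Z) = occurrences e q X Rplus Z) <->
  (forall u, u \in a -> B u X = 0 -> forall k, odd k ->
     \sum_m (weight ad P u 0 m / weight ad P X 0 m) ^+ k = 0).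
Proof.
apply: (iff_trans occurrences_symmetric).
have mapN u : map (pairing u) (map -%R scaled_roots) = map -%R (map (pairing u) scaled_roots).
  by rewrite -!map_comp; apply: eq_map => Z /=; exact: pairingN.
split=> [H u ua uX k ko|H].
  have H1 : perm_eq (map (pairing u) scaled_roots) (map -%R (map (pairing u) scaled_roots)).
    by rewrite -mapN; exact: perm_map.
  rewrite (weight_power_sum ua uX ko).
  by have := (odd_power_sums_perm_eq (map (pairing u) scaled_roots : seq C)).1 H1 k ko => ->; rewrite oppr0.
pose T := scaled_roots ++ map -%R scaled_roots.
have TX Z : Z \in T -> pairing X Z = 0.
  rewrite mem_cat => /orP[/mapP[m _ ->]|/mapP[_ /mapP[m _ ->] ->]]; first exact: pairing_scaledX.
  by rewrite pairingN pairing_scaledX oppr0.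
have [||i c u v|[i j] /= Tij|u [ua uX] sep] := @avoid_kernels R V ('I_(size T) * 'I_(size T))%type
  (fun ij => T`_ij.1 != T`_ij.2) (fun ij u => pairing u (T`_ij.1 - T`_ij.2)) [set u | u \in a /\ B u X = 0].
- by split; [exact: mem0v|rewrite (trace_form0l Hs)].
- move=> c u v [ua uX] [va vX]; split; first exact: memvD (memvZ _ ua) va.
  by rewrite (trace_formDl Hs) (trace_formZl Hs) uX vX mulr0 addr0.
- exact: pairing_linearl.
(* Distinct elements of T are told apart by some u in [a]; as both pair to zero with X, the
   component of u along X can be removed. *)
- apply: contrapT => N; move/eqP: Tij; apply; apply/eqP; rewrite -subr_eq0; apply/eqP.
  apply: killingC_nondeg => u ua; rewrite -(subrK ((B u X / B X X) *: X) u) addrC pairing_linearl.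
  rewrite pairingB !TX ?mem_nth // subrr mulr0 add0r; apply/eqP/negPn/negP => N'.
  by apply: N; exists (u - (B u X / B X X) *: X) => //; exact: (cartan_proj Hs Xa BXX ua).
have inj Z Y : Z \in T -> Y \in T -> pairing u Z = pairing u Y -> Z = Y.
  move=> ZT YT E; have iZ : (index Z T < size T)%N by rewrite index_mem.
  have iY : (index Y T < size T)%N by rewrite index_mem.
  have := sep (Ordinal iZ, Ordinal iY); rewrite /= !nth_index // pairingB E subrr eqxx.
  by apply: contraPeq => ZY /(_ ZY).
have P1 : perm_eq (map (pairing u) scaled_roots) (map (pairing u) (map -%R scaled_roots)).
  rewrite mapN; apply/odd_power_sums_perm_eq => k ko.
  by have := H u ua uX k ko; rewrite (weight_power_sum ua uX ko) => /eqP; rewrite oppr_eq0 => /eqP.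
have cU Z (l : seq aC) : {subset l <= T} -> Z \in T -> count_mem Z l = count_mem (pairing u Z) (map (pairing u) l).
  move=> lT ZT; rewrite count_map; apply: eq_in_count => Y /lT YT /=.
  by apply/eqP/eqP => [->//|]; exact: inj.
apply/allP => Z ZT /=; rewrite !cU //; first by move/permP: P1 => ->.
  by move=> Y; rewrite mem_cat => ->; rewrite orbT.
by move=> Y; rewrite mem_cat => ->.
Qed.

End RestrictedRootSystem.

(** * Reduction to the base point *)

Section Automorphisms.
Context {R : realType} {n : nat}.
Local Notation V := 'rV[R]_n.+1.
Variables (ad : V -> 'M[R]_n.+1) (s g g' : 'M[R]_n.+1).
Hypothesis gg' : g *m g' = 1%:M.
Hypothesis g'g : g' *m g = 1%:M.
Hypothesis gs : g *m s = s *m g.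
Hypothesis adg : forall u : V, ad (u *m g) = g' *m ad u *m g.

Let conjM (M N : 'M[R]_n.+1) : g' *m M *m g *m (g' *m N *m g) = g' *m (M *m N) *m g.
Proof. by rewrite -!mulmxA (mulmxA g g') gg' mul1mx. Qed.

Lemma mxtrace_automorphism (M : 'M[R]_n.+1) : \tr (g' *m M *m g) = \tr M.
Proof. by rewrite mxtrace_mulC mulmxA gg' mul1mx. Qed.

Lemma trace_form_automorphism (u v : V) : trace_form ad (u *m g) (v *m g) = trace_form ad u v.
Proof. by rewrite /trace_form !adg conjM mxtrace_automorphism. Qed.

Lemma normal_vec_automorphism x (xi : V) :
  normal_vec ad s (x *m g) xi -> normal_vec ad s x (xi *m g').
Proof.
have g's : g' *m s = s *m g'.
  by rewrite -[LHS]mulmx1 -gg' -!mulmxA (mulmxA s g) -gs !mulmxA g'g mul1mx.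
have xiE : xi = xi *m g' *m g by rewrite -mulmxA g'g mulmx1.
move=> [xis xix xiadx]; split.
- by rewrite -mulmxA g's mulmxA xis mulNmx.
- by rewrite -trace_form_automorphism -xiE.
- rewrite -[LHS]mulmx1 -gg' mulmxA -(mulmxA _ (ad x)).
  by move: xiadx; rewrite adg !mulmxA => ->; rewrite mul0mx.
Qed.

Lemma exp_automorphism (M : 'M[R]_n.+1) k : (g' *m M *m g) ^+ k = g' *m M ^+ k *m g.
Proof.
elim: k => [|k IH]; first by rewrite !expr0 mulmx1 g'g.
by rewrite !exprSr -!mulmxE IH conjM.
Qed.

Lemma horner_mx_automorphism (M : 'M[R]_n.+1) p : horner_mx (g' *m M *m g) p = g' *m horner_mx M p *m g.
Proof.
rewrite !horner_mx_sum mulmx_sumr mulmx_suml; apply: eq_bigr => i _.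
by rewrite exp_automorphism -scalemxAr -scalemxAl.
Qed.

Lemma trace_exp_automorphism x (xi : V) h k :
  \tr ((ad xi *m horner_mx (ad (x *m g)) h) ^+ k) =
  \tr ((ad (xi *m g') *m horner_mx (ad x) h) ^+ k).
Proof.
have xiE : xi = xi *m g' *m g by rewrite -mulmxA g'g mulmx1.
by rewrite {1}xiE !adg horner_mx_automorphism conjM exp_automorphism mxtrace_automorphism.
Qed.

End Automorphisms.

Lemma mulmx_ext (K : fieldType) n (M N : 'M[K]_n) : (forall v : 'rV_n, v *m M = v *m N) -> M = N.
Proof. by move=> MN; apply/row_matrixP => i; rewrite !rowE MN. Qed.

(* Stated for abstract functions, so that rewriting does not unfold derivatives. *)
Section MatricesOfMaps.
Context {K : fieldType} {n : nat}.
Local Notation V := 'rV[K]_n.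
Variables (br : V -> V -> V) (ad : V -> 'M[K]_n) (L : V -> V) (s : 'M[K]_n).
Hypothesis adE : forall v u, v *m ad u = br u v.
Hypothesis sE : forall v, v *m s = L v.

Lemma ad_bracket_mx : (forall w u v, br w (br u v) = br (br w u) v + br u (br w v)) ->
  forall u w, ad (u *m ad w) = ad u *m ad w - ad w *m ad u.
Proof.
move=> jac u w; apply: mulmx_ext => v.
by rewrite mulmxBr !mulmxA !adE jac addrK.
Qed.

Lemma ad_automorphism_mx (L' : V -> V) s' : (forall v, v *m s' = L' v) ->
  (forall v, L (L' v) = v) -> (forall u v, L (br u v) = br (L u) (L v)) ->
  forall u, ad (u *m s) = s' *m ad u *m s.
Proof.
move=> s'E LL Lbr u; apply: mulmx_ext => v.
by rewrite !mulmxA s'E !adE !sE Lbr LL.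
Qed.

Lemma commuting_mx (L' : V -> V) s' : (forall v, v *m s' = L' v) ->
  (forall v, L (L' v) = L' (L v)) -> s' *m s = s *m s'.
Proof.
by move=> s'E LL; apply: mulmx_ext => v; rewrite !mulmxA s'E !sE s'E LL.
Qed.

Lemma composition_mx (L' L2 : V -> V) s' s2 : (forall v, v *m s' = L' v) ->
  (forall v, v *m s2 = L2 v) -> (forall v, L (L' v) = L2 v) -> s' *m s = s2.
Proof. by move=> s'E s2E LL; apply: mulmx_ext => v; rewrite mulmxA s'E sE s2E. Qed.

End MatricesOfMaps.

(** * The Lie algebra and its involution as matrices *)

Section SymmetricSpace.
Context {R : realType} {n : nat} {G : preTopologicalGroupType}.
Variables (A : set (chart 'rV[R]_n G)) (e : chart 'rV[R]_n G) (sigma : G -> G) (H : set G).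
Hypothesis lieA : lie_group A.
Hypothesis Ae : A e.
Hypothesis e1 : chart_dom e 1%g.
Hypothesis invs : lie_involution A sigma.
Hypothesis ss : semisimple_lie_algebra e.
Local Notation V := 'rV[R]_n.
Local Notation L := (differential1 e sigma).
Local Notation s := (lin1_mx L).

Lemma involution_linear : linear L.
Proof. exact: differential1_linear (involution_local_diff lieA Ae e1 invs). Qed.

Lemma mul_involution_mx (v : V) : v *m s = L v.
Proof. exact: mul_lin1_mx involution_linear. Qed.

Lemma involution_mx_involutive : s *m s = 1%:M.
Proof.
apply: (composition_mx mul_involution_mx mul_involution_mx (mulmx1 (m := 1) (n := n))).
exact: differential_involutive lieA Ae e1 invs.
Qed.

Lemma lie_symmetric_algebra : symmetric_algebra (ad_mx e) s.
Proof.
have adE (v u : V) : v *m ad_mx e u = bracket e u v := mul_ad_mx lieA Ae e1 u v.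
split.
- exact: ad_mx_linear lieA Ae e1.
- exact: ad_bracket_mx adE (jacobi lieA Ae e1).
- by move=> u Hu; apply: ss => v; exact: Hu.
- exact: involution_mx_involutive.
- apply: (ad_automorphism_mx adE mul_involution_mx mul_involution_mx).
    exact: differential_involutive lieA Ae e1 invs.
  move=> u v; have [_ sM _] := invs.
  by apply: (differential1_bracket lieA Ae e1); [exact: (involution_local_diff lieA Ae e1 invs)|exact: sM].
Qed.

Lemma mem_q_space (u : V) : (u \in q_space e sigma) = (u *m s == - u).
Proof.
pose fl : {linear V -> V} := HB.pack L (GRing.isLinear.Build _ _ _ _ L involution_linear).
rewrite mul_involution_mx /q_space /leigenspace memv_ker.
have -> : linfun L = linfun fl by [].
by rewrite add_lfunE opp_lfunE scale_lfunE id_lfunE lfunE /= scaleN1r opprK addr_eq0.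
Qed.

Section Orbit.
Hypothesis subH : subgroup H.
Hypothesis H_fixed : H `<=` fixed_points sigma.
Hypothesis H_component : connected_component (fixed_points sigma) 1%g `<=` H.
Local Notation g h := (lin1_mx (Ad e h)).

Let AdE h v : v *m g h = Ad e h v := mul_Ad_mx lieA Ae e1 h v.

(** Matrices act on rows from the right, which reverses the order of products. *)
Lemma Ad_mx_mul h k : g k *m g h = g (h * k)%g.
Proof.
apply: (composition_mx (AdE h) (AdE k) (AdE (h * k)%g)) => v.
exact/esym/(Ad_mul lieA Ae e1).
Qed.

Lemma Ad_mx1 : g 1%g = 1%:M.
Proof. by apply: mulmx_ext => v; rewrite AdE (Ad1 lieA Ae e1) mulmx1. Qed.

Lemma Ad_mx_invr h : g h *m g (h^-1)%g = 1%:M.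
Proof. by rewrite Ad_mx_mul mulVg Ad_mx1. Qed.

Lemma Ad_mx_invl h : g (h^-1)%g *m g h = 1%:M.
Proof. by rewrite Ad_mx_mul mulgV Ad_mx1. Qed.

Lemma Ad_mx_involution h : H h -> g h *m s = s *m g h.
Proof.
move=> Hh; have [_ sM _] := invs; have ls := involution_local_diff lieA Ae e1 invs.
apply: (commuting_mx mul_involution_mx (AdE h)) => v.
have lh := local_diff_conj lieA Ae e1 h.
rewrite /Ad -(differential1_comp lieA Ae e1 _ lh ls) -(differential1_comp lieA Ae e1 _ ls lh).
have sh : sigma h = h := H_fixed Hh.
have shV : sigma (h^-1)%g = (h^-1)%g.
  by have [_ _ HV] := subH; exact: H_fixed (HV _ Hh).
suff -> : sigma \o (fun x => (h * x * h^-1)%g) = (fun x => (h * x * h^-1)%g) \o sigma by [].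
by apply: funext => x; rewrite /= !sM sh shV.
Qed.

Lemma ad_mx_Ad h (u : V) : ad_mx e (u *m g h) = g (h^-1)%g *m ad_mx e u *m g h.
Proof.
apply: (ad_automorphism_mx (fun v w => mul_ad_mx lieA Ae e1 w v) (AdE h) (AdE (h^-1)%g)).
  by move=> v; rewrite -(Ad_mul lieA Ae e1) mulgV (Ad1 lieA Ae e1).
exact: Ad_bracket lieA Ae e1 h.
Qed.

Lemma Ad_orbitP X (v : V) : Ad_orbit e H X v <-> exists2 h, H h & v = X *m g h.
Proof.
by split=> [[h Hh <-]|[h Hh ->]]; exists h; rewrite ?(mul_Ad_mx lieA Ae e1).
Qed.

Lemma orbit_path X x (y : V) : Ad_orbit e H X x -> y *m s = y -> exists z : R -> V,
  [/\ z 0 = x, \forall t \near (0 : R), Ad_orbit e H X (z t) &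
      is_derive (0 : R) (1 : R) z (y *m ad_mx e x)].
Proof.
(* [y *m ad_mx e x] is [x, y] = [-y, x], so the path in the group must start with velocity -y. *)
move=> [h Hh hX] ys; have LNy : L (- y) = - y by rewrite -mul_involution_mx mulNmx ys.
have [c [c0 Dc cH]] := fixed_points_path lieA Ae e1 invs LNy.
pose F (u : V) := Ad e (chart_inv e u) x.
exists (F \o c); split.
- have [[_ _ iA _ _] _ _] := lieA; have [_ _ eK _ _] := iA _ Ae.
  by rewrite /F /= c0 (eK _ e1) (Ad1 lieA Ae e1).
- apply/nbhs_ballP; exists 1 => //= t _; exists (chart_inv e (c t) * h)%g; last by rewrite (Ad_mul lieA Ae e1) hX.
  by have [_ + _] := subH; apply => //; exact: H_component.
have [dc E] := Dc.
have dF : differentiable F (c 0) by rewrite c0; exact: Ad_differentiable lieA Ae e1 x.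
have dc' : differentiable c (0 : R) by apply/derivable1_diffP.
split; first exact/derivable1_diffP/differentiable_comp.
rewrite (derive_comp _ dc' dF) E c0.
have <- : x *m ad_mx e (- y) = 'D_(- y) F (chart_map e 1%g) := mul_ad_mx lieA Ae e1 (- y) x.
by rewrite (ad_opp lie_symmetric_algebra) mulmxN (ad_anti lie_symmetric_algebra x y) opprK.
Qed.

End Orbit.
End SymmetricSpace.

Lemma abelian_extension (R : realType) n (ad : 'rV[R]_n -> 'M[R]_n) s (a : {vspace 'rV[R]_n}) (xi : 'rV[R]_n) :
  symmetric_algebra ad s -> (forall u v, u \in a -> v \in a -> v *m ad u = 0) ->
  (forall u, u \in a -> xi *m ad u = 0) ->
  forall u v k l, u \in a -> v \in a -> (v + l *: xi) *m ad (u + k *: xi) = 0.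
Proof.
move=> Hs ab xia u v k l ua va.
rewrite mulmxDl -scalemxAl (ad_add Hs) (ad_scale Hs) !mulmxDr -!scalemxAr (ab u v) // (xia u) //.
by rewrite (ad_anti Hs v xi) (xia v) // (ad_self Hs) oppr0 !(scaler0, addr0).
Qed.

(** Adjoining to [a] a vector of q that centralizes it gives an abelian subspace, which by
    maximality is [a] itself. *)
Lemma cartan_subspace_cartan (R : realType) n (G : preTopologicalGroupType) (e : chart 'rV[R]_n G) s
    (q a : {vspace 'rV[R]_n}) : symmetric_algebra (ad_mx e) s ->
  (forall u v : 'rV[R]_n, v *m ad_mx e u = bracket e u v) ->
  (forall u, (u \in q) = (u *m s == - u)) -> cartan_subspace e q a -> cartan (ad_mx e) s a.
Proof.
move=> Hs adE qE [/subvP aq abel amax ass].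
have ab u v : u \in a -> v \in a -> v *m ad_mx e u = 0 by move=> ua va; rewrite adE; exact: abel.
split=> //; first by move=> u /aq; rewrite qE => /eqP.
move=> xi xis xia.
have <- : (a + <[xi]>)%VS = a; last exact: subvP (addvSr _ _) _ (memv_line _).
apply: amax; first exact: addvSl.
  apply/subvP => _ /memv_addP[u ua [_ /vlineP[k ->] ->]].
  by apply: memvD; [exact: aq|apply: memvZ; rewrite qE xis].
move=> _ _ /memv_addP[u ua [_ /vlineP[k ->] ->]] /memv_addP[v va [_ /vlineP[l ->] ->]].
by rewrite -adE (abelian_extension Hs ab xia).
Qed.

Theorem proposition3p2 (R : realType) (n : nat) (G : preTopologicalGroupType)
    (A : set (chart 'rV[R]_n G)) (e : chart 'rV[R]_n G)
    (sigma : G -> G) (H : set G)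
    (X : 'rV[R]_n) (r : R) (a : {vspace 'rV[R]_n}) (Rplus : set (dualC a)) :
  lie_group A -> A e -> chart_dom e 1%g ->
  connected [set: G] -> ~ compact [set: G] -> semisimple_lie_algebra e ->
  lie_involution A sigma ->
  subgroup H -> closed H ->
  connected_component (fixed_points sigma) 1%g `<=` H ->
  H `<=` fixed_points sigma ->
  0 < r ->
  let B := killing e in
  let q := q_space e sigma in
  let S := pseudo_hypersphere e sigma r in
  let M := Ad_orbit e H X in
  X \in q ->
  pseudo_riemannian_submanifold B S M ->
  cartan_subspace e q a -> X \in a ->
  positive_system (restricted_roots e q a) Rplus ->
  (austere B S M <->
   forall Z : subvs_of (complexify a),
     occurrences e q X Rplus (- Z) = occurrences e q X Rplus Z).
Proof.
move=> lieA Ae e1 _ _ ss invs subH _ compH Hfix r0 B q S M Xq [subM MS _] cart Xa posR.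
have [H1 HM HV] := subH.
have MX : M X by exists 1%g => //; exact: Ad1 lieA Ae e1 X.
have [Sq BXX] := MS _ MX.
(* The ring of matrices is used in size [n.+1]; for n = 0 every trace is 0, against r > 0. *)
case: n => [|n] in A e sigma H X a Rplus lieA Ae e1 ss invs subH compH Hfix B q S M Xq subM MS cart Xa posR H1 HM HV MX Sq BXX *.
  by move: r0; rewrite -BXX /killing /mxtrace big_ord0 ltxx.
set s := lin1_mx (differential1 e sigma).
have Hs : symmetric_algebra (ad_mx e) s := lie_symmetric_algebra lieA Ae e1 invs ss.
have qE u : (u \in q) = (u *m s == - u) := mem_q_space lieA Ae e1 invs u.
have Ha : cartan (ad_mx e) s a.
  exact: cartan_subspace_cartan Hs (fun u v => mul_ad_mx lieA Ae e1 u v) qE cart.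
have BXX0 : trace_form (ad_mx e) X X != 0 by rewrite -[trace_form _ _ _]/(killing e X X) BXX gt_eqF.
(* The polynomial is chosen at X only; conjugation by Ad(H) extends its equation to the whole
   orbit. *)
have [p [cop_p Xp]] := cartan_separable Ha Xa.
have [h inv_h] := @separable_group_inverse _ n _ cop_p.
have orbP := Ad_orbitP H lieA Ae e1 X.
pose gm k := lin1_mx (Ad e k).
have gi k : gm k *m gm (k^-1)%g = 1%:M := Ad_mx_invr lieA Ae e1 k.
have ig k : gm (k^-1)%g *m gm k = 1%:M := Ad_mx_invl lieA Ae e1 k.
have adg k u : ad_mx e (u *m gm k) = gm (k^-1)%g *m ad_mx e u *m gm k := ad_mx_Ad lieA Ae e1 k u.
have M_p x : M x -> horner_mx (ad_mx e x) p = 0.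
  move=> /orbP[k _ ->]; rewrite adg (horner_mx_automorphism (gi k) (ig k)) Xp.
  by rewrite mulmx0 mul0mx.
have SE v : S v <-> v *m s = - v /\ trace_form (ad_mx e) v v = r.
  by rewrite /S /pseudo_hypersphere /= -/q qE; split=> -[/eqP ? ?].
apply: (iff_trans (austere_trace Hs r0 SE MS subM cop_p M_p inv_h _)).
  by move=> x y; exact: (orbit_path lieA Ae e1 invs ss subH compH).
have [P Pu diagP] := cartan_codiagonalizable Hs Ha.
apply: iff_sym; apply: (iff_trans (occurrences_power_sums Hs Ha qE Pu diagP Xa BXX0 posR)).
have gX := inv_h _ Xp.
split=> [W x xi Mx nxi k ko|W u ua uX k ko]; last first.
  (* Vectors of [a] orthogonal to X are themselves normal at X. *)
  rewrite -(trace_weights Pu diagP k Xa ua gX) W ?rmorph0 //; split.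
  - by have [aq _ _ _] := Ha; exact: aq.
  - exact: uX.
  - by have [_ ab _ _] := Ha; exact: ab.
move/orbP: Mx nxi => [g Hg ->] nxi.
rewrite (trace_exp_automorphism (gi g) (ig g) (adg g)).
apply: (cartan_trace_diag Hs Ha Xa BXX0 gX Pu diagP); last first.
  exact: (normal_vec_automorphism (gi g) (ig g) (Ad_mx_involution lieA Ae e1 invs subH Hfix Hg) (adg g)).
move=> u ua uX; have := W u ua uX k ko.
by rewrite -(trace_weights Pu diagP k Xa ua gX) => /eqP; rewrite fmorph_eq0 => /eqP.
Qed.
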